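(* For any infinite dimensional closed subspace $X$ of Gowers unconditional space $X_U$ there is a bounded operator defined on a subspace of $X$ which is not a strictly singular perturbation of a restriction of a diagonal operator on $X_U$. That is, there are a closed subspace $W\subset X$ and a bounded operator $T:W\to X_U$ such that $T$ is not of the form $T=D|_W+S$ with $D:X_U\to X_U$ a bounded diagonal operator and $S:W\to X_U$ a bounded strictly singular operator.
   Context: Definition of Gowers unconditional space $X_U$. Let $c_{00}$ be the space of finitely supported real sequences with unit vectors $(e_i)$, and $f(x)=\log_2(x+1)$. For $x=\sum_i x_ie_i$, $\operatorname{supp}x=\{i:x_i\neq0\}$, and for $E\subset\mathbb{N}$, $Ex=\sum_{i\in E}x_ie_i$; write $E<F$ if $\max E<\min F$, and $x<y$ if $\operatorname{supp}x<\operatorname{supp}y$ (such vectors are called successive). Fix an infinite set $J=\{j_1<j_2<\dots\}\subset\mathbb{N}$ with $f(j_1)>256$ and $\log\log\log n\geq4m^2$ for all $m<n$ in $J$; let $K=\{j_1,j_3,j_5,\dots\}$ and $L=\{j_2,j_4,\dots\}$. Let $\mathbf{Q}$ be the set of elements of $c_{00}$ with rational coordinates of modulus at most $1$. Fix an injection $\sigma$ (coding function) from the set of finite sequences of successive elements of $\mathbf{Q}$ into $L$ such that if $S=\sigma(z_1,\dots,z_s)$ then $\frac1{20}f(S^{1/40})^{1/2}$ is at least the number of integers in the smallest interval containing $\operatorname{supp}(z_1+\dots+z_s)$. Given a norm $\|\cdot\|'$ on $c_{00}$, let $A^*_m(\|\cdot\|')$ be the set of $x^*=\frac1{f(m)}(x_1^*+\dots+x_m^*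 )$ with $x_1^*<\dots<x_m^*$ in $c_{00}$ of dual norm at most $1$ (elements of $c_{00}$ acting on $c_{00}$ by the usual pairing). A special functional of length $k$ is a functional $\frac1{\sqrt{f(k)}}\sum_{j=1}^kx_j^*$, where $x_1^*<\dots<x_k^*$ belong to $\mathbf{Q}$, $x_1^*\in A^*_{j_{2k}}(\|\cdot\|')$ and $x_{j+1}^*\in A^*_{n_{j+1}}(\|\cdot\|')$ with $n_{j+1}=\sigma(|x_1^*|,\dots,|x_j^*|)$ for $j=1,\dots,k-1$ (moduli taken coordinatewise). Put $\|x\|_0=\|x\|_\infty$ and $$\|x\|_{N+1}=\max\Big\{\|x\|_\infty,\ \sup_n\tfrac1{f(n)}\sup\big\{\sum_{i=1}^n\|E_ix\|_N:E_1<\dots<E_n\big\},\ \sup\{|x^*(x)|:x^*\text{ special functional of length }k\text{ with respect to }\|\cdot\|_N,\ k\in K\}\Big\}.$$ These norms increase to a norm $\|\cdot\|$ on $c_{00}$, and $X_U$ is the completion of $(c_{00},\|\cdot\|)$; $(e_i)$ is a 1-unconditional basis of $X_U$. Other conventions. A diagonal operator on $X_U$ is an operator $D$ with $De_i=\lambda_ie_i$ for all $i$, for some scalars $(\lambda_i)$. A bounded operator is strictly singular if none of its restrictions to an infinite dimensional closed subspace is an isomorphism onto its image. *)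

(* Defs.v *)
From HB Require Import structures.
From mathcomp Require Import all_boot all_order all_algebra finmap.
From mathcomp Require Import all_classical all_reals all_analysis.

Set Implicit Arguments.
Unset Strict Implicit.
Unset Printing Implicit Defensive.

Import Order.TTheory GRing.Theory Num.Theory.
Import numFieldNormedType.Exports.

Local Open Scope classical_set_scope.
Local Open Scope ring_scope.

Section FinitelySupported.
Variable R : realType.

Definition support_of (x : nat -> R) : set nat := [set i | x i != 0].

Definition c00_pred : {pred (nat -> R)} :=
  mem [set x : nat -> R | finite_set (support_of x)].

Fact c00_submod_closed : submod_closed c00_pred.
Proof.
split.
  rewrite inE /=; apply: (@sub_finite_set _ _ set0) => // i.
  by rewrite /support_of /= eqxx.
move=> a u v; rewrite !inE /= => fu fv.
apply: (@sub_finite_set _ _ (support_of u `|` support_of v)); last first.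
  by rewrite finite_setU.
move=> i; rewrite /support_of /=.
have [ui|ui] := eqVneq (u i) 0; last by left.
have [vi|vi] := eqVneq (v i) 0; last by right.
have -> : (a *: u + v) i = a * u i + v i by [].
by rewrite ui vi mulr0 addr0 eqxx.
Qed.

HB.instance Definition _ :=
  GRing.isSubmodClosed.Build R (nat -> R) c00_pred c00_submod_closed.

Record c00 := C00 {
  c00_val :> nat -> R ;
  c00_valP : c00_val \in c00_pred }.

HB.instance Definition _ := [isSub for c00_val].
HB.instance Definition _ := [Choice of c00 by <:].
HB.instance Definition _ := [SubChoice_isSubLmodule of c00 by <:].

Definition supp (x : c00) : set nat := support_of x.

Fact unit_vec_subproof i : (fun k : nat => (k == i)%:R : R) \in c00_pred.
Proof.
rewrite inE /=; apply: (@sub_finite_set _ _ [set i]) => // k.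
by rewrite /support_of /=; case: (k =P i) => [//|_]; rewrite mulr0n eqxx.
Qed.

Definition unit_vec (i : nat) : c00 := C00 (unit_vec_subproof i).

Fact restr_subproof (E : set nat) (x : c00) :
  (fun i => if i \in E then x i else 0) \in c00_pred.
Proof.
have := c00_valP x; rewrite !inE /=; apply: sub_finite_set => i.
by rewrite /support_of /=; case: ifP => //; rewrite eqxx.
Qed.

Definition restr (E : set nat) (x : c00) : c00 := C00 (restr_subproof E x).

Fact modulus_subproof (x : c00) : (fun i => `|x i|) \in c00_pred.
Proof.
have := c00_valP x; rewrite !inE /=; apply: sub_finite_set => i.
by rewrite /support_of /= normr_eq0.
Qed.

Definition modulus (x : c00) : c00 := C00 (modulus_subproof x).

Definition pairing (xs x : c00) : R := \sum_(i \in [set: nat]) xs i * x i.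

End FinitelySupported.

Definition set_lt (E F : set nat) : Prop :=
  forall i k, E i -> F k -> (i < k)%N.

(* The terms are required to be nonempty, so that max E and min F make sense. *)
Definition successive_sets (s : seq (set nat)) : Prop :=
  (forall i, (i < size s)%N -> nth set0 s i !=set0) /\
  (forall i, (i.+1 < size s)%N -> set_lt (nth set0 s i) (nth set0 s i.+1)).

Definition successive (R : realType) (s : seq (c00 R)) : Prop :=
  successive_sets (map (@supp R) s).

(* The smallest interval of integers containing A. *)
Definition interval_hull (A : set nat) : set nat :=
  [set k | exists a b, [/\ A a, A b & (a <= k <= b)%N]].

Section GowersNorm.
Variable R : realType.
Implicit Types (p : c00 R -> R) (x y : c00 R).

Definition log2p1 (x : R) : R := ln (x + 1) / ln 2.

Definition in_Q x : Prop :=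
  forall i, (exists q : rat, x i = ratr q) /\ `|x i| <= 1.

(* J is given by its increasing enumeration, which is 0-based: j i stands for
   j_{i+1}, so that K consists of the j (2i), L of the j (2i+1), and j_{2k} is
   j (2k - 1). *)
Definition admissible_J (j : nat -> nat) : Prop :=
  [/\ forall i, (j i < j i.+1)%N,
      256 < log2p1 (j 0%N)%:R
    & forall m n, range j m -> range j n -> (m < n)%N ->
        4 * m%:R ^+ 2 <= ln (ln (ln (n%:R : R)))].

Definition K_of (j : nat -> nat) : set nat := range (fun i => j i.*2).
Definition L_of (j : nat -> nat) : set nat := range (fun i => j i.*2.+1).

Definition Q_sequences : set (seq (c00 R)) :=
  [set s | [/\ s != [::], successive s & forall z, z \in s -> in_Q z]].

Definition coding_function (j : nat -> nat) (sigma : seq (c00 R) -> nat) : Prop :=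
  [/\ {in Q_sequences &, injective sigma},
      forall s, Q_sequences s -> L_of j (sigma s)
    & forall s, Q_sequences s ->
        (#|` fset_set (interval_hull (supp (\sum_(z <- s) z)%R))|)%:R
        <= 20^-1 * Num.sqrt (log2p1 ((sigma s)%:R `^ 40^-1))].

Definition dual_norm p (xs : c00 R) : \bar R :=
  ereal_sup [set (`|pairing xs x|%:E) | x in [set x | p x <= 1]].

Definition Astar p (m : nat) : set (c00 R) :=
  [set xs | exists s : seq (c00 R),
     [/\ size s = m, successive s,
         forall y, y \in s -> (dual_norm p y <= 1)%E
       & xs = (log2p1 m%:R)^-1 *: \sum_(y <- s) y]].

Definition special_functional (j : nat -> nat) (sigma : seq (c00 R) -> nat)
    p (k : nat) : set (c00 R) :=
  [set xs | exists s : seq (c00 R),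
     [/\ size s = k /\ successive s,
         forall y, y \in s -> in_Q y,
         Astar p (j k.*2.-1) (nth 0 s 0),
         forall i, (i.+1 < k)%N ->
           Astar p (sigma (map (@modulus R) (take i.+1 s))) (nth 0 s i.+1)
       & xs = (Num.sqrt (log2p1 k%:R))^-1 *: \sum_(y <- s) y]].

Definition sup_norm x : R := sup (range (fun i => `|x i|)).

Definition next_norm (j : nat -> nat) (sigma : seq (c00 R) -> nat) p x : R :=
  Num.max (sup_norm x)
  (Num.max
    (sup [set (log2p1 n%:R)^-1 *
              sup [set \sum_(E <- s) p (restr E x)
                  | s in [set s | size s = n /\ successive_sets s]]
         | n in [set n | (0 < n)%N]])
    (sup [set r | exists k xs, [/\ K_of j k, special_functional j sigma p k xs
                                 & r = `|pairing xs x|]])).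

Fixpoint norm_stage (j : nat -> nat) (sigma : seq (c00 R) -> nat) (N : nat)
    : c00 R -> R :=
  if N is N'.+1 then next_norm j sigma (norm_stage j sigma N') else sup_norm.

Definition gowers_norm (j : nat -> nat) (sigma : seq (c00 R) -> nat) x : R :=
  limn (fun N => norm_stage j sigma N x).

(* XU is the completion of c00 for the norm p, with canonical embedding iota;
   this determines (XU, iota) up to isometric isomorphism. *)
Definition is_completion p (XU : completeNormedModType R)
    (iota : {linear c00 R -> XU}) : Prop :=
  (forall x, `|iota x| = p x) /\ closure (range iota) = setT.

End GowersNorm.

(* An operator defined on a subspace V of E is represented by a function on E,
   of which only the values on V matter. *)
Section Operators.
Variables (R : realType) (E F : normedModType R).

Definition subspace (V : set E) : Prop :=
  V 0 /\ forall (a : R) u v, V u -> V v -> V (a *: u + v).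

Definition closed_subspace (V : set E) : Prop := subspace V /\ closed V.

Definition finite_dimensional (V : set E) : Prop :=
  exists (n : nat) (v : 'I_n -> E), (forall i, V (v i)) /\
    forall x, V x -> exists c : 'I_n -> R, x = \sum_(i < n) c i *: v i.

Definition bounded_operator (V : set E) (T : E -> F) : Prop :=
  (forall (a : R) u v, V u -> V v -> T (a *: u + v) = a *: T u + T v) /\
  exists C : R, forall u, V u -> `|T u| <= C * `|u|.

End Operators.

Definition isomorphism_onto_image (R : realType) (E F : normedModType R)
    (V : set E) (S : E -> F) : Prop :=
  bounded_operator V S /\
  exists G : F -> E, bounded_operator (S @` V) G /\ forall v, V v -> G (S v) = v.

Definition strictly_singular (R : realType) (E F : normedModType R)
    (W : set E) (S : E -> F) : Prop :=
  forall V : set E, V `<=` W -> closed_subspace V -> ~ finite_dimensional V ->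
    ~ isomorphism_onto_image V S.

Definition diagonal_operator (R : realType) (XU : completeNormedModType R)
    (iota : {linear c00 R -> XU}) (D : XU -> XU) : Prop :=
  bounded_operator [set: XU] D /\
  exists lambda : nat -> R,
    forall i, D (iota (unit_vec R i)) = lambda i *: iota (unit_vec R i).

(* Main.v *)
Require Import Defs.
From mathcomp Require Import all_boot all_order all_algebra finmap.
From mathcomp Require Import all_classical all_reals all_analysis.
From mathcomp Require Import ring lra zify.
Set Implicit Arguments.
Unset Strict Implicit.
Unset Printing Implicit Defensive.
Import Order.TTheory GRing.Theory Num.Theory.
Import numFieldNormedType.Exports.
Local Open Scope classical_set_scope.
Local Open Scope ring_scope.

(** The idea is to build an operator which separates vectors that no diagonal
operator can separate. In the given subspace one finds, for each [n], vectors
[w] and [v 0, .., v d] of the [n]-th system, the systems being supported on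
successive intervals, such that

- [w] lies pointwise below the average of the moduli of the [v k];
- in every combination [b *: w + \sum_k a k *: v k] the vector [b *: w] is, up
  to a part of small norm, dominated pointwise by twice the combination.

The second property and unconditionality make bounded, on the closed span [W] of
all the systems, the projection [T] which keeps every [w] and annihilates every
[v k] (lemma [operator_on_span]). Suppose that [T = D + S] where [D] multiplies
the coordinates by [lam], and let [A] be the set where [`|lam i|] is at least
1/2. Either infinitely many of the [w] are not negligible off [A], where [S]
acts on them as the multiplier [1 - lam]; or, by the first property, for all but
finitely many systems some [v k] is not negligible on [A], where [S] acts on it
as the multiplier [- lam] (lemma [spread_system_large]). In both cases [S] acts
on a rapidly increasing sequence as a multiplier that is bounded below on a set
on which the sequence is not negligible, and such an operator is not strictly
singular (lemma [not_strictly_singular]).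

This last fact is where the definition of the norm enters. Given a set [B] on
which a rapidly increasing sequence is not negligible, one builds along with
averages of the sequence a special functional of length [k] supported in [B],
which gives the sum of the [k] averages a norm of order at least
[k / sqrt (f k)] on [B]. Off [B] this functional vanishes, and because of the
coding function all others of length [k] have bounded values on the sum of the
averages (lemma [coding_argument]); then the upper estimate for
rapidly increasing sequences, [ris_part_bound], bounds the norm off [B] by a
multiple of [k / f k]. So there are combinations large on [B] and small off [B]
(lemma [unbalanced_combination]), and on the span of a sequence of them the
multiplier is bounded below.

The systems come from two sources. As the weights grow slower than every power,
there are near any infinite dimensional subspace finite block sequences, of any
length, on which the norm is equivalent to the sum of the moduli of the
coefficients (lemma [l1_blocks]); this reduces the construction to one in the
space of summable sequences. There [w] is constant on one group of coordinates,
and on this group [v k] is a sum, over many scales, of random signs on the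
windows of that scale which contain [k], with a height inversely proportional to
the length of the window. If the number of scales is large compared with the sum
of the coefficients, a combination of the [v k] is small compared with [w] on
most of these coordinates (lemma [large_small]). The other coordinates are shared
out between the [v k] and bound their combinations from below, so that the
contribution of [w] is negligible when the sum of the coefficients is larger
(lemma [spread_system_exists]). *)

(** * Finitely supported vectors *)

Section FinitelySupportedVectors.
Variable R : realType.
Implicit Types (x y : c00 R) (E F : set nat) (a : R).

Lemma c00P x y : (forall i, x i = y i) -> x = y.
Proof. by move=> xy; apply: val_inj; apply/funext. Qed.

Lemma c000 i : (0 : c00 R) i = 0. Proof. by []. Qed.
Lemma c00D x y i : (x + y) i = x i + y i. Proof. by []. Qed.
Lemma c00N x i : (- x) i = - x i. Proof. by []. Qed.
Lemma c00Z a x i : (a *: x) i = a * x i. Proof. by []. Qed.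

Lemma c00_sum (I : Type) (r : seq I) (P : pred I) (F : I -> c00 R) i :
  (\sum_(k <- r | P k) F k) i = \sum_(k <- r | P k) F k i.
Proof. exact: (big_morph (fun x : c00 R => x i)). Qed.

Lemma restrE E x i : restr E x i = if i \in E then x i else 0.
Proof. by []. Qed.

Lemma modulusE x i : modulus x i = `|x i|. Proof. by []. Qed.

Lemma unit_vecE k i : unit_vec R k i = (i == k)%:R. Proof. by []. Qed.

Lemma suppE x i : supp x i = (x i != 0) :> Prop. Proof. by []. Qed.

Lemma c00_finsupp x : exists n, forall i, (n <= i)%N -> x i = 0.
Proof.
have := c00_valP x; rewrite inE /= => fx.
exists (\sum_(k <- finmap.enum_fset (fset_set (support_of x))) k.+1)%N => i ni.
apply: contrapT => /eqP xi.
have: i \in finmap.enum_fset (fset_set (support_of x)).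
  by rewrite in_fset_set // inE.
move=> /[dup] iin; move: ni => /[swap] _; rewrite leqNgt => /negP; apply.
by rewrite (big_rem i) //= ltnS leq_addr.
Qed.

Lemma c00_finsupp2 x y :
  exists n, forall i, (n <= i)%N -> x i = 0 /\ y i = 0.
Proof.
have [n xn] := c00_finsupp x; have [m ym] := c00_finsupp y.
exists (maxn n m) => i; rewrite geq_max => /andP[ni mi].
by rewrite xn // ym.
Qed.

Lemma fsum_ord (g : nat -> R) n : (forall i, (n <= i)%N -> g i = 0) ->
  \sum_(i \in [set: nat]) g i = \sum_(i < n) g i.
Proof.
move=> g0; rewrite fsbig_ord; apply/esym/fsbig_widen => // i [_ /=] /negP.
by rewrite -leqNgt => /g0.
Qed.

Fact mulc_subproof (lam : nat -> R) x :
  (fun i => lam i * x i) \in @c00_pred R.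
Proof.
have := c00_valP x; rewrite !inE /=; apply: sub_finite_set => i.
by rewrite /support_of /= mulf_eq0 negb_or => /andP[].
Qed.

Definition mulc (lam : nat -> R) x : c00 R := C00 (mulc_subproof lam x).

Lemma mulcE lam x i : mulc lam x i = lam i * x i. Proof. by []. Qed.

Lemma mulcD lam x y : mulc lam (x + y) = mulc lam x + mulc lam y.
Proof. by apply: c00P => i; rewrite mulcE !c00D mulrDr. Qed.

Lemma mulcZ lam a x : mulc lam (a *: x) = a *: mulc lam x.
Proof. by apply: c00P => i; rewrite mulcE !c00Z mulcE mulrCA. Qed.

Lemma mulc_sum lam (I : Type) (r : seq I) (P : pred I) (F : I -> c00 R) :
  mulc lam (\sum_(k <- r | P k) F k) = \sum_(k <- r | P k) mulc lam (F k).
Proof.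
apply: (big_morph (mulc lam) (mulcD lam)).
by apply: c00P => i; rewrite mulcE c000 mulr0.
Qed.

Lemma restrD E x y : restr E (x + y) = restr E x + restr E y.
Proof.
by apply: c00P => i; rewrite !(restrE, c00D); case: ifP; rewrite ?addr0.
Qed.

Lemma restrZ E a x : restr E (a *: x) = a *: restr E x.
Proof.
by apply: c00P => i; rewrite !(restrE, c00Z); case: ifP; rewrite ?mulr0.
Qed.

Lemma restr0 E : restr E (0 : c00 R) = 0.
Proof. by apply: c00P => i; rewrite restrE c000 if_same. Qed.

Lemma restr_sum (I : Type) (r : seq I) (P : pred I) (F : I -> c00 R) E :
  restr E (\sum_(k <- r | P k) F k) = \sum_(k <- r | P k) restr E (F k).
Proof. exact: (big_morph (restr E) (restrD E) (restr0 E)). Qed.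

Lemma restrI E F x : restr E (restr F x) = restr (E `&` F) x.
Proof.
by apply: c00P => i; rewrite !restrE in_setI; case: (i \in E).
Qed.

Lemma restrT x : restr setT x = x.
Proof. by apply: c00P => i; rewrite restrE in_setT. Qed.

Lemma restr_out E x : (forall i, E i -> x i = 0) -> restr E x = 0.
Proof.
move=> xE; apply: c00P => i; rewrite restrE; case: ifP => //.
by rewrite inE => /xE.
Qed.

Lemma restr_id E x : (forall i, x i != 0 -> E i) -> restr E x = x.
Proof.
move=> xE; apply: c00P => i; rewrite restrE; case: ifPn => //.
by rewrite notin_setE => nE; apply/esym/eqP/negPn/negP => /xE.
Qed.

Lemma restr_setC E x : x = restr E x + restr (~` E) x.
Proof.
apply: c00P => i; rewrite c00D !restrE in_setC.
by case: (_ \in _); rewrite ?addr0 ?add0r.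
Qed.

Definition dom x y := forall i, `|x i| <= `|y i|.

Lemma dom_restr E x : dom (restr E x) x.
Proof. by move=> i; rewrite restrE; case: ifP; rewrite ?normr0. Qed.

Definition l1 x := \sum_(i \in [set: nat]) `|x i|.

Lemma l1_ord x n : (forall i, (n <= i)%N -> x i = 0) ->
  l1 x = \sum_(i < n) `|x i|.
Proof. by move=> xn; apply: fsum_ord => i /xn ->; rewrite normr0. Qed.

Lemma pairing_ord x y n : (forall i, (n <= i)%N -> y i = 0) ->
  pairing x y = \sum_(i < n) x i * y i.
Proof. by move=> yn; apply: fsum_ord => i /yn ->; rewrite mulr0. Qed.

Lemma pairingDr x y z : pairing x (y + z) = pairing x y + pairing x z.
Proof.
have [n yz] := c00_finsupp2 y z.
rewrite !(@pairing_ord _ _ n) => [|i /yz[]//|i /yz[]//|i /yz[ey ez]].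
  by rewrite -big_split; apply: eq_bigr => i _; rewrite c00D mulrDr.
by rewrite c00D ey ez addr0.
Qed.

Lemma pairingZr a x y : pairing x (a *: y) = a * pairing x y.
Proof.
have [n yn] := c00_finsupp y.
rewrite !(@pairing_ord _ _ n) // => [|i /yn e].
  by rewrite mulr_sumr; apply: eq_bigr => i _; rewrite c00Z mulrCA.
by rewrite c00Z e mulr0.
Qed.

Lemma pairingC x y : pairing x y = pairing y x.
Proof. by rewrite /pairing; apply: eq_fsbigr => i _; rewrite mulrC. Qed.

Lemma pairingDl x y z : pairing (x + y) z = pairing x z + pairing y z.
Proof. by rewrite !(pairingC _ z) pairingDr. Qed.

Lemma pairingZl a x y : pairing (a *: x) y = a * pairing x y.
Proof. by rewrite !(pairingC _ y) pairingZr. Qed.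

Lemma pairing0r x : pairing x 0 = 0.
Proof. by rewrite -(scale0r x) pairingZr mul0r. Qed.

Lemma pairing0l x : pairing 0 x = 0.
Proof. by rewrite pairingC pairing0r. Qed.

Lemma pairing_suml (I : Type) (r : seq I) (P : pred I) (F : I -> c00 R) y :
  pairing (\sum_(k <- r | P k) F k) y = \sum_(k <- r | P k) pairing (F k) y.
Proof.
apply: (big_morph (fun x : c00 R => pairing x y)) => [a b|].
  exact: pairingDl.
exact: pairing0l.
Qed.

Lemma pairing_sumr (I : Type) (r : seq I) (P : pred I) (F : I -> c00 R) y :
  pairing y (\sum_(k <- r | P k) F k) = \sum_(k <- r | P k) pairing y (F k).
Proof. by rewrite pairingC pairing_suml; under eq_bigr do rewrite pairingC. Qed.

Lemma pairing_restr E x y : pairing (restr E x) y = pairing x (restr E y).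
Proof.
apply: eq_fsbigr => i _; rewrite !restrE.
by case: ifP => _; rewrite ?mul0r ?mulr0.
Qed.

Lemma pairing_supp x y : pairing x (restr (supp x) y) = pairing x y.
Proof.
rewrite -pairing_restr; congr (pairing _ y); apply: restr_id => i.
by rewrite /supp /support_of.
Qed.

Lemma eq_pairing x y : (forall i, x i * y i = 0) -> pairing x y = 0.
Proof. by move=> xy; rewrite /pairing; apply: fsbig1 => i _. Qed.

Lemma l1_ge0 x : 0 <= l1 x.
Proof.
have [n xn] := c00_finsupp x.
by rewrite (l1_ord xn); apply: sumr_ge0.
Qed.

Lemma l1_dom x y : dom x y -> l1 x <= l1 y.
Proof.
move=> xy; have [n yz] := c00_finsupp2 x y.
by rewrite !(@l1_ord _ n) => [|i /yz[]//|i /yz[]//]; apply: ler_sum.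
Qed.

Lemma coord_l1 x i : `|x i| <= l1 x.
Proof.
have [n xn] := c00_finsupp x; rewrite (l1_ord xn).
have [ni|ni] := leqP n i; first by rewrite xn // normr0 sumr_ge0.
by rewrite (bigD1 (Ordinal ni)) //= lerDl sumr_ge0.
Qed.

Lemma pairing_le_l1 x y : (forall i, `|x i| <= 1) -> `|pairing x y| <= l1 y.
Proof.
move=> x1; have [n yn] := c00_finsupp y.
rewrite (pairing_ord x yn) (l1_ord yn).
apply: (le_trans (ler_norm_sum _ _ _)); apply: ler_sum => i _.
by rewrite normrM ler_piMl.
Qed.

Lemma pairing_unit x i : pairing x (unit_vec R i) = x i.
Proof.
rewrite (@pairing_ord _ _ i.+1) => [|k ik]; last first.
  by rewrite unit_vecE gtn_eqF.
rewrite big_ord_recr /= big1 ?add0r => [|k _].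
  by rewrite eqxx mulr1.
by rewrite ltn_eqF // mulr0.
Qed.

Lemma l1_unit i : l1 (unit_vec R i) = 1.
Proof.
rewrite (@l1_ord _ i.+1) => [|k ik]; last by rewrite unit_vecE gtn_eqF.
rewrite big_ord_recr /= big1 ?add0r => [|k _].
  by rewrite eqxx normr1.
by rewrite ltn_eqF // normr0.
Qed.

Lemma c00_decomp x n : (forall i, (n <= i)%N -> x i = 0) ->
  x = \sum_(i < n) x i *: unit_vec R i.
Proof.
move=> xn; apply: c00P => k; rewrite c00_sum.
have [nk|kn] := leqP n k.
  rewrite xn // big1 // => i _; rewrite c00Z unit_vecE gtn_eqF ?mulr0 //.
  exact: leq_trans nk.
rewrite (bigD1 (Ordinal kn)) // c00Z unit_vecE eqxx mulr1 big1.
  by rewrite [RHS]addr0.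
move=> i /eqP ik; rewrite c00Z unit_vecE; case: eqP; last by rewrite mulr0.
by move=> ki; case: ik; apply: val_inj.
Qed.

(** The choice of the sign of zero makes all signs unimodular, so that
multiplication by them keeps the support. *)
Definition usg (t : R) : R := if t < 0 then -1 else 1.

Lemma norm_usg t : `|usg t| = 1.
Proof. by rewrite /usg; case: ifP; rewrite ?normrN1 ?normr1. Qed.

Lemma usg_mul t : usg t * t = `|t|.
Proof.
rewrite /usg; case: ltP => t0; last by rewrite mul1r ger0_norm.
by rewrite mulN1r ltr0_norm.
Qed.

End FinitelySupportedVectors.

(** * The weights *)

Section Log2.
Variable R : realType.
Implicit Types (x y : R).

Local Notation f n := (log2p1 (n%:R : R)).

Lemma ln2_gt0 : 0 < ln 2 :> R.
Proof. by rewrite ln_gt0 // ltr1n. Qed.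

Lemma ln2_le1 : ln 2 <= 1 :> R.
Proof. by rewrite (_ : 2 = 1 + 1) // le_ln1Dx //; lra. Qed.

Lemma ln2_ge2V : 1 / 2 <= ln 2 :> R.
Proof.
have -> : ln 2 = - ln (1 + - (1 / 2)) :> R.
  by rewrite -lnV ?posrE; [congr ln; field|lra].
by rewrite lerNr le_ln1Dx //; lra.
Qed.

Lemma log2p1_0 : log2p1 (0 : R) = 0.
Proof. by rewrite /log2p1 add0r ln1 mul0r. Qed.

Lemma log2p1_1 : log2p1 (1 : R) = 1.
Proof. by rewrite /log2p1 -[1 + 1]/2 divff // gt_eqF // ln2_gt0. Qed.

Lemma log2p1_le x y : 0 <= x -> x <= y -> log2p1 x <= log2p1 y.
Proof.
move=> x0 xy; rewrite ler_pM2r ?invr_gt0 ?ln2_gt0 //.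
by rewrite ler_ln ?posrE //; lra.
Qed.

Lemma log2p1_ge0 x : 0 <= x -> 0 <= log2p1 x.
Proof. by move=> x0; rewrite -log2p1_0 log2p1_le. Qed.

Lemma log2_mono (m n : nat) : (m <= n)%N -> f m <= f n.
Proof. by move=> mn; rewrite log2p1_le // ler_nat. Qed.

Lemma log2_ge0 (n : nat) : 0 <= f n.
Proof. exact: log2p1_ge0. Qed.

Lemma log2_ge1 (n : nat) : (0 < n)%N -> 1 <= f n.
Proof. by move=> n0; rewrite -[leLHS]log2p1_1; apply: log2p1_le; rewrite ?ler1n. Qed.

Lemma log2_gt0 (n : nat) : (0 < n)%N -> 0 < f n.
Proof. by move/log2_ge1; apply: lt_le_trans. Qed.

Lemma log2_inv_le1 (n : nat) : 0 <= (f n)^-1 <= 1.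
Proof.
rewrite invr_ge0 log2_ge0 /=; case: n => [|n].
  by rewrite log2p1_0 invr0.
by rewrite invf_le1 ?log2_ge1 // log2_gt0.
Qed.

Lemma log2_invsqrt_le1 (n : nat) : 0 <= (Num.sqrt (f n))^-1 <= 1.
Proof.
rewrite invr_ge0 sqrtr_ge0 /=; case: n => [|n].
  by rewrite log2p1_0 sqrtr0 invr0.
rewrite invf_le1 ?sqrtr_gt0 ?log2_gt0 // -[leLHS]sqrtr1.
by apply: ler_wsqrtr; exact: log2_ge1.
Qed.

Lemma log2_le_nat (n : nat) : f n <= n%:R.
Proof.
rewrite ler_pdivrMr ?ln2_gt0 // mulr_natl -lnXn // ler_ln ?posrE //.
by rewrite -natrX natr1 ler_nat ltn_expl.
Qed.

Lemma log2_2 : 3 / 2 <= f 2.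
Proof.
rewrite ler_pdivlMr ?ln2_gt0 //.
suff: 3 * ln 2 <= 2 * ln (2 + 1) :> R by lra.
rewrite -[3]/(3%:R) -[2]/(2%:R) !mulr_natl -!lnXn // ler_ln ?posrE //.
by rewrite -natrX natr1 -natrX ler_nat.
Qed.

Lemma nat_le_exp_log2 (n : nat) : n%:R <= expR (f n).
Proof.
apply: (@le_trans _ _ (expR (ln (n%:R + 1)))).
  by rewrite lnK ?lerDl // posrE; have: 0 <= n%:R :> R by []; lra.
rewrite ler_expR ler_pdivlMr ?ln2_gt0 // ler_piMr ?ln2_le1 // ln_ge0 //.
by rewrite lerDr.
Qed.

Lemma log2_ge_lt (n : nat) x : 0 <= x -> f n < x -> n%:R <= expR x.
Proof.
move=> x0 /ltW fx; apply: le_trans (nat_le_exp_log2 n) _.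
by rewrite ler_expR.
Qed.

Lemma log2_unbounded x : exists n0 : nat, forall n, (n0 <= n)%N -> x <= f n.
Proof.
pose k := Num.bound `|x|.
exists (2 ^ k)%N => n kn; apply: (@le_trans _ _ (f (2 ^ k))).
  apply: (@le_trans _ _ k%:R).
    apply: (le_trans (ler_norm _)); apply: ltW.
    exact: archi_boundP (normr_ge0 _).
  rewrite ler_pdivlMr ?ln2_gt0 // mulr_natl -lnXn // ler_ln ?posrE //.
  by rewrite natrX lerDl.
exact: log2_mono.
Qed.

End Log2.

(** * Suprema and successive sets *)

Section SupremumBounds.
Variable R : realType.
Implicit Types (E : set R) (B r : R).

Lemma sup_le_bound E B : 0 <= B -> (forall r, E r -> r <= B) -> sup E <= B.
Proof.
move=> B0 EB; have [->|/set0P E0] := eqVneq E set0; first by rewrite sup0.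
exact: ge_sup.
Qed.

Lemma le_sup_bound E B r : (forall r, E r -> r <= B) -> E r -> r <= sup E.
Proof. by move=> EB Er; apply: ub_le_sup => //; exists B. Qed.

End SupremumBounds.

Section SuccessiveSets.
Implicit Types (E F : set nat) (s : seq (set nat)).

Definition seq_union s : set nat :=
  [set k | exists2 i, (i < size s)%N & nth set0 s i k].

Lemma seq_union_cons E s : seq_union (E :: s) = E `|` seq_union s.
Proof.
apply/seteqP; split=> [k [[|i] /= si nk]|k [Ek|[i si nk]]].
- by left.
- by right; exists i.
- by exists 0%N.
- by exists i.+1.
Qed.

Lemma seq_union_nil : seq_union [::] = set0.
Proof. by apply/seteqP; split => // k [i]. Qed.

Lemma successive_sets_cons E s : successive_sets (E :: s) ->
  [/\ E !=set0, set_lt E (seq_union s) & successive_sets s].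
Proof.
move=> [ne lt]; split.
- exact: (ne 0%N).
- suff H i : (i < size s)%N -> set_lt E (nth set0 s i).
    by move=> a b Ea [i si nb]; apply: (H i).
  elim: i => [|i IH] si; first exact: (lt 0%N).
  move=> a b Ea nb; have [c nc] := ne i.+1 (ltnW si).
  exact: ltn_trans (IH (ltnW si) _ _ Ea nc) (lt i.+1 si _ _ nc nb).
- by split=> i si; [exact: (ne i.+1)|exact: (lt i.+1)].
Qed.

Lemma successive_setsP s : successive_sets s ->
  forall i k, (i < k)%N -> (k < size s)%N ->
    set_lt (nth set0 s i) (nth set0 s k).
Proof.
elim: s => [_ i k _|E s IH] //= /successive_sets_cons[_ lt ss] [|i] [|k] //= ik ks.
  by move=> a b Ea nb; apply: lt => //; exists k.
exact: IH.
Qed.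

Lemma set_lt_disjoint E F i : set_lt E F -> E i -> F i -> False.
Proof. by move=> EF Ei /(EF _ _ Ei); rewrite ltnn. Qed.

End SuccessiveSets.

(** * Unconditional norms and their dual balls *)

Section SolidNorms.
Variable R : realType.
Implicit Types (x y : c00 R) (E F : set nat) (p : c00 R -> R).

Local Notation f n := (log2p1 (n%:R : R)).

(** The 1-unconditional norms for which the unit vectors are normalized. *)
Record solid_norm p : Prop := SolidNorm {
  solid_ge0 : forall x, 0 <= p x ;
  solidD : forall x y, p (x + y) <= p x + p y ;
  solidZ : forall a x, p (a *: x) = `|a| * p x ;
  solid_dom : forall x y, dom x y -> p x <= p y ;
  solid_coord : forall x i, `|x i| <= p x ;
  solid_l1 : forall x, p x <= l1 x }.

Lemma solid0 p : solid_norm p -> p 0 = 0.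
Proof. by move=> sp; rewrite -(scale0r 0) solidZ // normr0 mul0r. Qed.

Lemma solid_sum p (I : Type) (r : seq I) (P : pred I) (F : I -> c00 R) :
  solid_norm p -> p (\sum_(k <- r | P k) F k) <= \sum_(k <- r | P k) p (F k).
Proof.
move=> sp; elim/big_rec2: _ => [|i y1 y2 _ le]; first by rewrite solid0.
by apply: (le_trans (solidD sp _ _)); rewrite lerD2l.
Qed.

Lemma solid_restr p E x : solid_norm p -> p (restr E x) <= p x.
Proof. by move=> sp; apply: solid_dom => //; exact: dom_restr. Qed.

Lemma solid_setC p E x : solid_norm p ->
  p x <= p (restr E x) + p (restr (~` E) x).
Proof. by move=> sp; rewrite [in leLHS](restr_setC E x) solidD. Qed.

Lemma sum_l1_successive s x : successive_sets s ->
  \sum_(E <- s) l1 (restr E x) <= l1 (restr (seq_union s) x).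
Proof.
elim: s => [_|E s IH /successive_sets_cons[_ lt ss]].
  by rewrite big_nil l1_ge0.
rewrite big_cons seq_union_cons.
apply: (le_trans (lerD (lexx _) (IH ss))).
have [n xn] := c00_finsupp x.
have rn F i : (n <= i)%N -> restr F x i = 0.
  by move=> /xn e; rewrite restrE e if_same.
rewrite !(l1_ord (rn _)) -big_split; apply: ler_sum => i _ /=.
rewrite in_setU.
case: (boolP ((i : nat) \in E)) => [iE|_ /=]; last by rewrite normr0 add0r.
rewrite ifF ?normr0 ?addr0 //; apply/negbTE/negP => iU.
by move: iE iU; rewrite !inE => iE iU; exact: (set_lt_disjoint lt iE iU).
Qed.

Lemma sum_solid_successive p s x : solid_norm p -> successive_sets s ->
  \sum_(E <- s) p (restr E x) <= l1 x.
Proof.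
move=> sp ss; apply: (@le_trans _ _ (\sum_(E <- s) l1 (restr E x))).
  by apply: ler_sum => E _; exact: solid_l1.
apply: (le_trans (sum_l1_successive x ss)).
by apply: l1_dom; exact: dom_restr.
Qed.

Lemma successive_nth (s : seq (c00 R)) i k : successive s ->
  (i < k)%N -> (k < size s)%N -> set_lt (supp (nth 0 s i)) (supp (nth 0 s k)).
Proof.
move=> /successive_setsP ss ik ks; have := ss i k ik.
by rewrite size_map !(nth_map 0) // ?(ltn_trans ik) //; apply.
Qed.

Lemma supp_sum_successive (s : seq (c00 R)) :
  supp (\sum_(y <- s) y) `<=` seq_union (map (@supp R) s).
Proof.
elim: s => [|y s IH] i.
  by rewrite big_nil /supp /support_of /= eqxx.
rewrite big_cons /= seq_union_cons.
have [yi|yi] := eqVneq (y i) 0; last by left.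
move=> ui; right; apply: IH; move: ui.
by rewrite suppE c00D yi add0r.
Qed.

Lemma coord_sum_successive (s : seq (c00 R)) i (B : R) : 0 <= B ->
  successive s -> (forall y, y \in s -> `|y i| <= B) ->
  `|(\sum_(y <- s) y) i| <= B.
Proof.
move=> B0; elim: s => [_ _|y s IH]; first by rewrite big_nil normr0.
move=> /successive_sets_cons[_ lt ss] yB; rewrite big_cons c00D.
have [yi|yi] := eqVneq (y i) 0.
  by rewrite yi add0r IH // => z zs; rewrite yB // in_cons zs orbT.
have -> : (\sum_(z <- s) z) i = 0.
  apply: contrapT => /eqP /(@supp_sum_successive s i) ui.
  exact: (set_lt_disjoint lt yi ui).
by rewrite addr0 yB // in_cons eqxx.
Qed.

Lemma sup_norm_le x (B : R) : 0 <= B -> (forall i, `|x i| <= B) ->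
  sup_norm x <= B.
Proof. by move=> B0 xB; apply: sup_le_bound => // _ [i _ <-]. Qed.

Lemma sup_norm_ge x i : `|x i| <= sup_norm x.
Proof.
by apply: (@le_sup_bound _ _ (l1 x)) => [_ [k _ <-]|]; [exact: coord_l1|exists i].
Qed.

Lemma sup_norm_ge0 x : 0 <= sup_norm x.
Proof. exact: le_trans (normr_ge0 _) (sup_norm_ge x 0%N). Qed.

Lemma sup_norm_solid : solid_norm (@sup_norm R).
Proof.
have leZ a x : sup_norm (a *: x) <= `|a| * sup_norm x.
  apply: sup_norm_le => [|i]; first by rewrite mulr_ge0 // sup_norm_ge0.
  by rewrite c00Z normrM ler_wpM2l // sup_norm_ge.
split.
- exact: sup_norm_ge0.
- move=> x y; apply: sup_norm_le => [|i].
    by rewrite addr_ge0 // sup_norm_ge0.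
  by rewrite c00D (le_trans (ler_normD _ _)) // lerD // sup_norm_ge.
- move=> a x; apply/le_anti; rewrite leZ /=.
  have [->|a0] := eqVneq a 0; first by rewrite normr0 mul0r sup_norm_ge0.
  rewrite -ler_pdivlMl ?normr_gt0 // -normfV.
  by rewrite -{1}(scalerK a0 x) leZ.
- move=> x y xy; apply: sup_norm_le => [|i]; first exact: sup_norm_ge0.
  exact: le_trans (xy i) (sup_norm_ge _ _).
- exact: sup_norm_ge.
- by move=> x; apply: sup_norm_le => [|i]; [exact: l1_ge0|exact: coord_l1].
Qed.

Definition dual_ball p y := forall x, `|pairing y x| <= p x.

Lemma dual_ballP p y : solid_norm p ->
  (dual_norm p y <= 1)%E <-> dual_ball p y.
Proof.
move=> sp; split=> [le1 x|yp].
  have [px0|px0] := eqVneq (p x) 0.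
    have -> : x = 0.
      apply: c00P => i; apply/eqP; rewrite -normr_le0 -px0.
      exact: solid_coord.
    by rewrite pairing0r normr0 solid_ge0.
  have pxp : 0 < p x by rewrite lt_neqAle eq_sym px0 solid_ge0.
  have : (`|pairing y ((p x)^-1 *: x)|%:E <= 1)%E.
    apply: le_trans le1; apply: ereal_sup_ubound; exists ((p x)^-1 *: x) => //=.
    by rewrite solidZ // normfV gtr0_norm // mulVf.
  rewrite lee_fin pairingZr normrM normfV (ger0_norm (ltW pxp)).
  by rewrite ler_pdivrMl // mulr1.
apply: ge_ereal_sup => _ [x /= px <-]; rewrite lee_fin.
exact: le_trans (yp x) px.
Qed.

Lemma dual_ball_coord p y i : solid_norm p -> dual_ball p y -> `|y i| <= 1.
Proof.
move=> sp yp; rewrite -pairing_unit (le_trans (yp _)) //.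
by rewrite -(l1_unit R i) solid_l1.
Qed.

Definition signs (th : nat -> R) := forall i, th i = 1 \/ th i = -1.

Lemma signs_norm th i : signs th -> `|th i| = 1.
Proof. by move=> /(_ i)[]->; rewrite ?normrN1 ?normr1. Qed.

Lemma signs_usg (g : nat -> R) : signs (fun i => usg (g i)).
Proof. by move=> i; rewrite /usg; case: ifP; [right|left]. Qed.

Lemma signs_neq0 th i : signs th -> th i != 0.
Proof. by move=> sth; rewrite -normr_eq0 (signs_norm _ sth) oner_eq0. Qed.

Lemma pairing_mulc th x y : pairing (mulc th x) y = pairing x (mulc th y).
Proof. by apply: eq_fsbigr => i _; rewrite !mulcE mulrAC mulrC mulrA. Qed.

(** The sign changes [th] act on the functionals and not on the vectors: this is
how the unconditionality of special functionals is obtained, since the coding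
function only sees moduli. *)
Lemma dual_ball_signs p th y : solid_norm p -> signs th ->
  dual_ball p y -> dual_ball p (mulc th y).
Proof.
move=> sp sth yp x; rewrite pairing_mulc (le_trans (yp _)) //.
by apply: solid_dom => // i; rewrite mulcE normrM (signs_norm _ sth) mul1r.
Qed.

Lemma supp_signs th y : signs th -> supp (mulc th y) = supp y.
Proof.
move=> sth; apply/seteqP; split=> i; rewrite /supp /support_of /=.
  by rewrite mulf_eq0 negb_or => /andP[].
by move=> yi; rewrite mulf_neq0 // signs_neq0.
Qed.

Lemma modulus_signs th y : signs th -> modulus (mulc th y) = modulus y.
Proof.
by move=> sth; apply: c00P => i; rewrite !modulusE mulcE normrM (signs_norm _ sth) mul1r.
Qed.

Lemma successive_signs th (s : seq (c00 R)) : signs th ->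
  successive s -> successive (map (mulc th) s).
Proof.
move=> sth; rewrite /successive -map_comp.
by rewrite (@eq_map _ _ _ (@supp R)) // => y; exact: supp_signs.
Qed.

Lemma in_Q_signs th y : signs th -> in_Q y -> in_Q (mulc th y).
Proof.
move=> sth yQ i; have [[q yq] y1] := yQ i; split.
  rewrite mulcE; have [->|->] := sth i; first by exists q; rewrite mul1r.
  by exists (- q); rewrite yq rmorphN mulN1r.
by rewrite mulcE normrM (signs_norm _ sth) mul1r.
Qed.

Lemma Astar_signs p th m y : solid_norm p -> signs th ->
  Astar p m y -> Astar p m (mulc th y).
Proof.
move=> sp sth [s [sm ss sB ->]]; exists (map (mulc th) s); split.
- by rewrite size_map.
- exact: successive_signs.
- move=> _ /mapP[y' y's ->]; apply/dual_ballP => //.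
  by apply: dual_ball_signs => //; apply/dual_ballP => //; exact: sB.
- by rewrite mulcZ mulc_sum big_map.
Qed.

(** An element of [Astar p m] is a rescaled sum of [m] functionals, each of
which sees at most the [p]-norm of the part of the vector below it. *)
Lemma Astar_pairing_le p m y x : solid_norm p -> Astar p m y ->
  exists s, [/\ size s = m, successive_sets s, seq_union s = supp y &
    `|pairing y x| <= (f m)^-1 * \sum_(E <- s) p (restr E x)].
Proof.
move=> sp [s [sm ss sB ->]]; exists (map (@supp R) s); split => //.
- by rewrite size_map.
- case: m sm => [|m] sm.
    rewrite (size0nil sm) big_nil scaler0 seq_union_nil.
    by apply/seteqP; split => // i; rewrite /supp /support_of /= eqxx.
  apply/seteqP; split=> i.
    case=> k; rewrite size_map => ks; rewrite (nth_map 0) // => ski.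
    rewrite suppE c00Z mulf_neq0 //.
      by rewrite gt_eqF // invr_gt0 log2_gt0.
    have nz: nth 0 s k i != 0 by [].
    rewrite c00_sum (big_nth 0) big_mkord (bigD1 (Ordinal ks)) //= big1 ?addr0 //.
    move=> l lk; apply: contrapT => /eqP sli.
    have := lk; rewrite -val_eqE /= neq_ltn => /orP[lk'|kl].
      exact: (set_lt_disjoint (successive_nth ss lk' ks) sli nz).
    exact: (set_lt_disjoint (successive_nth ss kl (ltn_ord l)) nz sli).
  rewrite suppE c00Z mulf_eq0 negb_or => /andP[_ si].
  exact: (@supp_sum_successive s i).
- have /andP[fi0 _] := log2_inv_le1 R m.
  rewrite pairingZl normrM ger0_norm // ler_wpM2l // pairing_suml big_map.
  apply: (le_trans (ler_norm_sum _ _ _)); rewrite big_seq [leRHS]big_seq.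
  apply: ler_sum => z zs; rewrite -pairing_supp.
  by have /dual_ballP -> := sB z zs.
Qed.

End SolidNorms.

(** * The stages of the norm and their limit *)

Section NextNorm.
Variables (R : realType) (j : nat -> nat) (sigma : seq (c00 R) -> nat).
Implicit Types (x y : c00 R) (E F : set nat) (p q : c00 R -> R).

Local Notation f n := (log2p1 (n%:R : R)).

(** The coding function is applied to moduli, hence a change of signs leaves the
sequence of weights of a special functional unchanged. *)
Lemma special_signs p th k y : solid_norm p -> signs th ->
  special_functional j sigma p k y ->
  special_functional j sigma p k (mulc th y).
Proof.
move=> sp sth [s [[sk ss] sQ s0 sS ->]]; exists (map (mulc th) s); split.
- by rewrite size_map; split => //; exact: successive_signs.
- by move=> _ /mapP[z zs ->]; apply: in_Q_signs => //; exact: sQ.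
- have [s00|s00] := ltnP 0 (size s).
    by rewrite (nth_map 0) //; exact: Astar_signs.
  move: s0 => /(Astar_signs sp sth); rewrite !nth_default ?size_map //.
  have -> : mulc th 0 = 0 by apply: c00P => i; rewrite mulcE mulr0.
  by [].
- move=> i ik; rewrite (nth_map 0) ?sk // -map_take -map_comp.
  have -> : [seq (@modulus R \o mulc th) z | z <- take i.+1 s]
          = [seq modulus z | z <- take i.+1 s].
    by apply: eq_map => z; exact: modulus_signs.
  by apply: Astar_signs => //; exact: sS.
- by rewrite mulcZ mulc_sum big_map.
Qed.

Lemma special_coord p k y i : solid_norm p ->
  special_functional j sigma p k y -> `|y i| <= 1.
Proof.
move=> sp [s [[sk ss] sQ _ _ ->]].
have /andP[fi0 fi1] := log2_invsqrt_le1 R k.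
rewrite c00Z normrM ger0_norm //; apply: mulr_ile1 => //.
by apply: coord_sum_successive => // z /sQ /(_ i)[].
Qed.

(** Unconditionality in the form used for special functionals: the sign of
each coordinate may be adapted to the vector acted upon. *)
Lemma special_dom p k z x y : solid_norm p ->
  special_functional j sigma p k z -> dom x y ->
  exists2 z', special_functional j sigma p k z' &
    `|pairing z x| <= `|pairing z' y|.
Proof.
move=> sp zk xy.
exists (mulc (fun i => usg (z i * y i)) z).
  by apply: special_signs => //; exact: signs_usg.
have [n xyn] := c00_finsupp2 x y.
rewrite !(@pairing_ord _ _ _ n) => [|i /xyn[]//|i /xyn[]//].
apply: (le_trans (ler_norm_sum _ _ _)); rewrite ger0_norm; last first.
  by apply: sumr_ge0 => i _; rewrite mulcE -mulrA usg_mul.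
apply: ler_sum => i _; rewrite mulcE -mulrA usg_mul !normrM.
by rewrite ler_wpM2l.
Qed.

Lemma next_norm_le p x (B : R) : 0 <= B -> (forall i, `|x i| <= B) ->
  (forall n s, (0 < n)%N -> size s = n -> successive_sets s ->
     (f n)^-1 * \sum_(E <- s) p (restr E x) <= B) ->
  (forall k y, K_of j k -> special_functional j sigma p k y ->
     `|pairing y x| <= B) ->
  next_norm j sigma p x <= B.
Proof.
move=> B0 Bsup Bfst Bsp; rewrite /next_norm !ge_max; apply/and3P; split.
- exact: sup_norm_le.
- apply: sup_le_bound => // _ [n /= n0 <-].
  rewrite ler_pdivrMl ?log2_gt0 //; apply: sup_le_bound.
    by rewrite mulr_ge0 // log2_ge0.
  move=> _ [s [sn ss] <-].
  by rewrite -ler_pdivrMl ?log2_gt0 // Bfst.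
- by apply: sup_le_bound => // _ [k [y [Kk yk ->]]]; exact: Bsp Kk yk.
Qed.

Lemma next_norm_coord p x i : `|x i| <= next_norm j sigma p x.
Proof. by rewrite /next_norm le_max sup_norm_ge. Qed.

Lemma next_norm_fst p x n s : solid_norm p -> (0 < n)%N -> size s = n ->
  successive_sets s ->
  (f n)^-1 * \sum_(E <- s) p (restr E x) <= next_norm j sigma p x.
Proof.
move=> sp n0 sn ss; rewrite /next_norm !le_max; apply/or3P/Or32.
have le1 m t : size t = m -> successive_sets t ->
    \sum_(E <- t) p (restr E x) <= l1 x.
  by move=> _ tt; exact: sum_solid_successive.
have sup1 m : sup [set \sum_(E <- s) p (restr E x)
    | s in [set s | size s = m /\ successive_sets s]] <= l1 x.
  apply: sup_le_bound; first exact: l1_ge0.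
  by move=> _ [t [tm tt] <-]; exact: le1 tm tt.
apply: (@le_trans _ _ ((f n)^-1 * sup [set \sum_(E <- s) p (restr E x)
    | s in [set s | size s = n /\ successive_sets s]])).
  rewrite ler_wpM2l ?invr_ge0 ?log2_ge0 //.
  apply: (@le_sup_bound _ _ (l1 x)); last by exists s.
  by move=> _ [t [tm tt] <-]; exact: le1 tm tt.
apply: (@le_sup_bound _ _ (l1 x)); last by exists n.
move=> _ [m /= m0 <-]; rewrite ler_pdivrMl ?log2_gt0 //.
by apply: (le_trans (sup1 m)); rewrite ler_peMl ?l1_ge0 ?log2_ge1.
Qed.

Lemma next_norm_special p x k y : solid_norm p -> K_of j k ->
  special_functional j sigma p k y -> `|pairing y x| <= next_norm j sigma p x.
Proof.
move=> sp Kk yk; rewrite /next_norm !le_max; apply/or3P/Or33.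
apply: (@le_sup_bound _ _ (l1 x)); last by exists k, y.
move=> _ [k' [z [_ zk ->]]]; apply: pairing_le_l1 => i.
exact: special_coord zk.
Qed.

Lemma next_norm_ge0 p x : 0 <= next_norm j sigma p x.
Proof. exact: le_trans (normr_ge0 _) (next_norm_coord p x 0%N). Qed.

Lemma next_norm_solid p : solid_norm p -> solid_norm (next_norm j sigma p).
Proof.
move=> sp.
have sdom x y : dom x y -> next_norm j sigma p x <= next_norm j sigma p y.
  move=> xy; apply: next_norm_le; first exact: next_norm_ge0.
  - by move=> i; apply: le_trans (xy i) (next_norm_coord p y i).
  - move=> n s n0 sn ss; apply: le_trans (next_norm_fst y sp n0 sn ss).
    rewrite ler_wpM2l ?invr_ge0 ?log2_ge0 //; apply: ler_sum => E _.
    by apply: solid_dom => // i; rewrite !restrE; case: ifP; rewrite ?normr0.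
  - move=> k z Kk zk; have [z' z'k le] := special_dom sp zk xy.
    exact: le_trans le (next_norm_special y sp Kk z'k).
have sZ a x : next_norm j sigma p (a *: x) <= `|a| * next_norm j sigma p x.
  apply: next_norm_le; first by rewrite mulr_ge0 // next_norm_ge0.
  - by move=> i; rewrite c00Z normrM ler_wpM2l // next_norm_coord.
  - move=> n s n0 sn ss.
    have -> : \sum_(E <- s) p (restr E (a *: x)) =
              `|a| * \sum_(E <- s) p (restr E x).
      by rewrite mulr_sumr; apply: eq_bigr => E _; rewrite restrZ solidZ.
    by rewrite mulrCA ler_wpM2l //; exact: next_norm_fst.
  - move=> k z Kk zk; rewrite pairingZr normrM ler_wpM2l //.
    exact: next_norm_special zk.
split.
- exact: next_norm_ge0.
- move=> x y; apply: next_norm_le; first by rewrite addr_ge0 // next_norm_ge0.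
  + move=> i; rewrite c00D (le_trans (ler_normD _ _)) //.
    by rewrite lerD // next_norm_coord.
  + move=> n s n0 sn ss.
    apply: le_trans (lerD (next_norm_fst x sp n0 sn ss)
                          (next_norm_fst y sp n0 sn ss)).
    rewrite -mulrDr ler_wpM2l ?invr_ge0 ?log2_ge0 // -big_split.
    by apply: ler_sum => E _; rewrite restrD solidD.
  + move=> k z Kk zk; rewrite pairingDr (le_trans (ler_normD _ _)) //.
    by rewrite lerD //; exact: next_norm_special zk.
- move=> a x; apply/le_anti; rewrite sZ /=.
  have [->|a0] := eqVneq a 0; first by rewrite normr0 mul0r next_norm_ge0.
  rewrite -ler_pdivlMl ?normr_gt0 // -normfV.
  by rewrite -{1}(scalerK a0 x) sZ.
- exact: sdom.
- exact: next_norm_coord.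
- move=> x; apply: next_norm_le; first exact: l1_ge0.
  + exact: coord_l1.
  + move=> n s n0 sn ss; rewrite ler_pdivrMl ?log2_gt0 //.
    apply: (le_trans (sum_solid_successive x sp ss)).
    by rewrite ler_peMl ?l1_ge0 ?log2_ge1.
  + move=> k z _ zk; apply: pairing_le_l1 => i; exact: special_coord zk.
Qed.

Lemma dual_ball_mono p q y : (forall x, p x <= q x) ->
  dual_ball p y -> dual_ball q y.
Proof. by move=> pq yp x; exact: le_trans (yp x) (pq x). Qed.

Lemma Astar_mono p q m y : solid_norm p -> solid_norm q ->
  (forall x, p x <= q x) -> Astar p m y -> Astar q m y.
Proof.
move=> sp sq pq [s [sm ss sB ->]]; exists s; split => // z zs.
by apply/dual_ballP => //; apply: dual_ball_mono pq _; apply/dual_ballP => //;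
  exact: sB.
Qed.

Lemma special_mono p q k y : solid_norm p -> solid_norm q ->
  (forall x, p x <= q x) -> special_functional j sigma p k y ->
  special_functional j sigma q k y.
Proof.
move=> sp sq pq [s [sk sQ s0 sS ->]]; exists s; split => //.
  exact: Astar_mono pq s0.
by move=> i ik; apply: Astar_mono pq _ => //; exact: sS.
Qed.

Lemma next_norm_mono p q : solid_norm p -> solid_norm q ->
  (forall x, p x <= q x) ->
  forall x, next_norm j sigma p x <= next_norm j sigma q x.
Proof.
move=> sp sq pq x; apply: next_norm_le.
- exact: next_norm_ge0.
- exact: next_norm_coord.
- move=> n s n0 sn ss; apply: le_trans (next_norm_fst x sq n0 sn ss).
  by rewrite ler_wpM2l ?invr_ge0 ?log2_ge0 //; apply: ler_sum.
- move=> k y Kk yk; apply: (next_norm_special x sq Kk).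
  exact: special_mono pq yk.
Qed.

End NextNorm.

Section GowersNormTheory.
Variables (R : realType) (j : nat -> nat) (sigma : seq (c00 R) -> nat).
Implicit Types (x y : c00 R) (E F : set nat).

Local Notation f n := (log2p1 (n%:R : R)).
Local Notation P := (norm_stage j sigma).
Local Notation G := (gowers_norm j sigma).

Lemma stage_solid N : solid_norm (P N).
Proof.
elim: N => [|N IH] /=; first exact: sup_norm_solid.
exact: next_norm_solid.
Qed.

Lemma stage_leS N x : P N x <= P N.+1 x.
Proof.
elim: N x => [|N IH] x.
  by apply: sup_norm_le => [|i]; [exact: next_norm_ge0|exact: next_norm_coord].
apply: next_norm_mono; [exact: stage_solid|exact: (stage_solid N.+1)|exact: IH].
Qed.

Lemma stage_le N M x : (N <= M)%N -> P N x <= P M x.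
Proof.
move=> /subnK <-; elim: (M - N)%N => [|n IH]; first by rewrite add0n.
by rewrite addSn; exact: le_trans IH (stage_leS _ _).
Qed.

Lemma stage_cvg x : cvgn (fun N => P N x).
Proof.
apply: nondecreasing_is_cvgn; first by move=> N M NM; exact: stage_le.
by exists (l1 x) => _ [N _ <-]; exact: solid_l1 (stage_solid N) x.
Qed.

Lemma stage_le_norm N x : P N x <= G x.
Proof.
apply: (@nondecreasing_cvgn_le _ (fun N => P N x)); last exact: stage_cvg.
by move=> n m nm; exact: stage_le.
Qed.

Lemma norm_le x (B : R) : (forall N, P N x <= B) -> G x <= B.
Proof. by move=> PB; apply: limr_le; [exact: stage_cvg|exact: nearW]. Qed.

Lemma stage_near_norm x (e : R) : 0 < e -> exists N, G x - e < P N x.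
Proof.
move=> e0; apply: contrapT => /forallNP H.
suff: G x <= G x - e by lra.
by apply: norm_le => N; rewrite leNgt; apply/negP; exact: H.
Qed.

Lemma norm_solid : solid_norm G.
Proof.
have leZ a x : G (a *: x) <= `|a| * G x.
  apply: norm_le => N; rewrite (solidZ (stage_solid N)) ler_wpM2l //.
  exact: stage_le_norm.
have ge0 x : 0 <= G x.
  exact: le_trans (solid_ge0 (stage_solid 0) x) (stage_le_norm 0 x).
split => //.
- move=> x y; apply: norm_le => N; apply: (le_trans (solidD (stage_solid N) _ _)).
  by rewrite lerD // stage_le_norm.
- move=> a x; apply/le_anti; rewrite leZ /=.
  have [->|a0] := eqVneq a 0; first by rewrite normr0 mul0r ge0.
  rewrite -ler_pdivlMl ?normr_gt0 // -normfV.
  by rewrite -{1}(scalerK a0 x) leZ.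
- move=> x y xy; apply: norm_le => N.
  exact: le_trans (solid_dom (stage_solid N) xy) (stage_le_norm N y).
- move=> x i.
  exact: le_trans (solid_coord (stage_solid 0) x i) (stage_le_norm 0 x).
- by move=> x; apply: norm_le => N; exact: solid_l1 (stage_solid N) x.
Qed.

(** The limit of the stages passes through a finite sum of suprema because the
stages increase. *)
Lemma sum_norm_le (s : seq (set nat)) x (B : R) :
  (forall N, \sum_(E <- s) P N (restr E x) <= B) ->
  \sum_(E <- s) G (restr E x) <= B.
Proof.
move=> PB; apply/ler_addgt0Pr => e e0.
have [N HN] : exists N, \sum_(E <- s) G (restr E x) <=
    \sum_(E <- s) P N (restr E x) + e.
  elim: s e e0 {PB} => [|E s IH] e e0; first by exists 0%N; rewrite !big_nil; lra.
  have [|N1 H1] := IH (e / 2); first by lra.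
  have [|N2 H2] := @stage_near_norm (restr E x) (e / 2); first by lra.
  exists (maxn N1 N2); rewrite !big_cons.
  have le2 := stage_le (restr E x) (leq_maxr N1 N2).
  have : \sum_(E <- s) P N1 (restr E x) <=
         \sum_(E <- s) P (maxn N1 N2) (restr E x).
    by apply: ler_sum => F _; rewrite stage_le // leq_maxl.
  by lra.
by apply: (le_trans HN); rewrite lerD2r.
Qed.

Lemma norm_fst x n s : (0 < n)%N -> size s = n -> successive_sets s ->
  (f n)^-1 * \sum_(E <- s) G (restr E x) <= G x.
Proof.
move=> n0 sn ss; rewrite ler_pdivrMl ?log2_gt0 //; apply: sum_norm_le => N.
rewrite -ler_pdivrMl ?log2_gt0 //.
apply: le_trans (stage_le_norm N.+1 x).
by apply: next_norm_fst => //; exact: stage_solid.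
Qed.

Lemma norm_special N x k y : K_of j k ->
  special_functional j sigma (P N) k y -> `|pairing y x| <= G x.
Proof.
move=> Kk yk; apply: le_trans (stage_le_norm N.+1 x).
by apply: next_norm_special Kk yk; exact: stage_solid.
Qed.

End GowersNormTheory.

(** * Lacunary lengths and the coding function *)

Section LacunaryLengths.
Variables (R : realType) (j : nat -> nat) (sigma : seq (c00 R) -> nat).
Hypotheses (hj : admissible_J R j) (hsigma : coding_function j sigma).

Local Notation f n := (log2p1 (n%:R : R)).

Lemma j_mono a b : (a < b)%N -> (j a < j b)%N.
Proof.
have [js _ _] := hj; elim: b => // b IH; rewrite ltnS leq_eqVlt.
by move=> /orP[/eqP ->//|/IH H]; exact: ltn_trans H (js b).
Qed.

Lemma j_inj : injective j.
Proof.
move=> a b jab; have [ab|ba|//] := ltngtP a b.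
- by have := j_mono ab; rewrite jab ltnn.
- by have := j_mono ba; rewrite jab ltnn.
Qed.

Lemma j_ge_id a : (a <= j a)%N.
Proof. by elim: a => // a IH; exact: leq_ltn_trans IH (j_mono (ltnSn a)). Qed.

Lemma J_large m : range j m -> 256 < f m.
Proof.
move=> [a _ <-]; have [_ j0 _] := hj; apply: (lt_le_trans j0).
by apply: log2_mono; case: a => // a; apply/ltnW/j_mono.
Qed.

Lemma J_gt0 m : range j m -> (0 < m)%N.
Proof.
by move=> /J_large; case: m => //; rewrite log2p1_0 => h; exfalso; lra.
Qed.

Lemma ln_le_self (x : R) : 0 < ln x -> 0 < x /\ ln x <= x.
Proof.
move=> lx; have x0 : 0 < x.
  by rewrite ltNge; apply/negP => /ln0 lx0; move: lx; rewrite lx0 ltxx.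
split => //; rewrite [in leLHS](_ : x = 1 + (x - 1)); last by ring.
by apply: (@le_trans _ _ (x - 1)); [apply: le_ln1Dx; lra|lra].
Qed.

(** All comparisons between different lengths go through this consequence of the
lacunarity: the weight of a length beats the square of every smaller length. *)
Lemma J_growth m n : range j m -> range j n -> (m < n)%N ->
  4 * m%:R ^+ 2 <= f n.
Proof.
move=> Jm Jn mn; have [_ _ /(_ m n Jm Jn mn) h] := hj.
have m0 : 0 < 4 * m%:R ^+ 2 :> R.
  by rewrite mulr_gt0 // exprn_gt0 // ltr0n; exact: J_gt0.
have [l2 h2] := ln_le_self (lt_le_trans m0 h).
have [l1 h1] := ln_le_self l2.
apply: (le_trans h); apply: (le_trans h2); apply: (le_trans h1).
rewrite ler_pdivlMr ?ln2_gt0 //.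
apply: (@le_trans _ _ (ln n%:R)).
  by rewrite ler_piMr ?ln2_le1 // ltW.
by rewrite ler_ln ?posrE ?ltr_wpDl // ?lerDl // ltr0n; exact: J_gt0.
Qed.

Lemma K_sub_J k : K_of j k -> range j k.
Proof. by move=> [a _ <-]; exists a.*2. Qed.

Lemma L_sub_J k : L_of j k -> range j k.
Proof. by move=> [a _ <-]; exists a.*2.+1. Qed.

Lemma K_L_disjoint k l : K_of j k -> L_of j l -> k != l.
Proof.
move=> [a _ <-] [b _ <-]; apply/eqP => /j_inj /(congr1 odd).
by rewrite /= !odd_double.
Qed.

Lemma first_weight_L k : (0 < k)%N -> L_of j (j k.*2.-1).
Proof. by case: k => // k _; exists k => //; rewrite doubleS. Qed.

Lemma K_lt_first_weight k : K_of j k -> (k < j k.*2.-1)%N.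
Proof.
move=> Kk; have k0 := J_gt0 (K_sub_J Kk); have kf := J_large (K_sub_J Kk).
have k1 : (1 < k)%N.
  have : 256 < k%:R :> R by apply: lt_le_trans kf (log2_le_nat _ _).
  by case: (k) => [|[|//]] h; exfalso; move: h; rewrite ?mulr1n; lra.
move: Kk => [a _ ak]; rewrite -{1}ak; apply: j_mono.
have := j_ge_id a.*2; rewrite ak => h; rewrite -addnn; lia.
Qed.

Lemma successive_spread s m : successive_sets s -> size s = m.+1 ->
  exists a b, [/\ seq_union s a, seq_union s b & (a + m <= b)%N].
Proof.
elim: s m => // E [_ [|m] //|F s IH m].
- move=> /successive_sets_cons[[a Ea] _ _] _.
  by exists a, a; split; [exists 0%N|exists 0%N|rewrite addn0].
- case: m => // m /successive_sets_cons[[a Ea] lt ss] [sm].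
  have [b [c [Ub Uc bc]]] := IH m ss (congr1 S sm).
  exists a, c; rewrite seq_union_cons; split; [by left|by right|].
  have := lt _ _ Ea Ub; lia.
Qed.

Lemma interval_hull_card (A : set nat) a b m : finite_set A -> A a -> A b ->
  (a + m <= b)%N -> (m < #|` fset_set (interval_hull A)|)%N.
Proof.
move=> fA Aa Ab ab.
have [n An] : exists n, A `<=` `I_n.
  have [n hn] := c00_finsupp (restr A (\sum_(i <- finmap.enum_fset (fset_set A))
    unit_vec R i)).
  exists n => i Ai /=; rewrite ltnNge; apply/negP => /hn.
  rewrite restrE mem_set // c00_sum.
  under eq_bigr do rewrite unit_vecE.
  rewrite (big_rem i) /=; last by rewrite in_fset_set ?inE.
  rewrite eqxx => /eqP; rewrite gt_eqF //.
  by rewrite ltr_pwDl // sumr_ge0 // => k _; rewrite ler0n.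
have fh : finite_set (interval_hull A).
  apply: (@sub_finite_set _ _ `I_n); last exact: finite_II.
  by move=> i [c [d [_ /An /= dn /andP[_ id]]]] /=; exact: leq_ltn_trans id dn.
have : {subset iota a m.+1 <= finmap.enum_fset (fset_set (interval_hull A))}.
  move=> i; rewrite mem_iota => /andP[ai im]; rewrite in_fset_set // inE.
  by exists a, b; split => //; rewrite ai /=; lia.
by move/(uniq_leq_size (iota_uniq _ _)); rewrite size_iota.
Qed.

Lemma finite_supp (x : c00 R) : finite_set (supp x).
Proof. by have := c00_valP x; rewrite inE. Qed.

Lemma supp_modulus (x : c00 R) : supp (modulus x) = supp x.
Proof.
by apply/seteqP; split=> i; rewrite !suppE modulusE normr_eq0.
Qed.

Lemma in_Q_modulus (x : c00 R) : in_Q x -> in_Q (modulus x).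
Proof.
move=> xQ i; have [[q xq] x1] := xQ i; rewrite modulusE normr_id; split => //.
by exists `|q|; rewrite xq ratr_norm.
Qed.

Lemma Q_sequences_modulus (s : seq (c00 R)) : s != [::] -> successive s ->
  (forall z, z \in s -> in_Q z) -> Q_sequences (map (@modulus R) s).
Proof.
move=> s0 ss sQ; split.
- by case: s s0 {ss sQ}.
- rewrite /successive -map_comp (@eq_map _ _ _ (@supp R)) // => y.
  exact: supp_modulus.
- by move=> _ /mapP[z zs ->]; apply: in_Q_modulus; exact: sQ.
Qed.

Lemma successive_take (s : seq (c00 R)) n : successive s -> successive (take n s).
Proof.
rewrite /successive map_take; move: (map _ _) => t [ne lt].
have st : (size (take n t) <= size t)%N by rewrite size_take_min geq_minr.
have nt i : (i < size (take n t))%N -> nth set0 (take n t) i = nth set0 t i.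
  by rewrite size_take_min => h; rewrite nth_take //; exact: leq_trans h (geq_minl _ _).
split=> i hi; first by rewrite nt //; apply: ne; exact: leq_trans hi st.
by rewrite !nt ?(ltnW hi) //; apply: lt; exact: leq_trans hi st.
Qed.

Lemma supp_sum_modulus (s : seq (c00 R)) z : z \in s ->
  supp z `<=` supp (\sum_(y <- map (@modulus R) s) y).
Proof.
move=> zs i; rewrite !suppE => zi; rewrite c00_sum big_map (big_rem z) //=.
by rewrite gt_eqF // ltr_pwDl ?normr_gt0 // sumr_ge0.
Qed.

(** The growth condition on the coding function enters only here: a value of
the coding function exceeds the number of terms of each coded functional. *)
Lemma coding_gt p m (s : seq (c00 R)) z : solid_norm p -> (0 < m)%N ->
  successive s -> (forall y, y \in s -> in_Q y) -> z \in s -> Astar p m z ->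
  (m < sigma (map (@modulus R) s))%N.
Proof.
move=> sp m0 ss sQ zs zm; have [_ sL scard] := hsigma.
have s0 : s != [::] by case: s zs {ss sQ}.
have Qs := Q_sequences_modulus s0 ss sQ.
set S := sigma _; have JS : range j S by apply/L_sub_J/sL.
have [t [tm tt tu _]] := Astar_pairing_le 0 sp zm.
have [a [b [ta tb ab]]] : exists a b,
    [/\ seq_union t a, seq_union t b & (a + m.-1 <= b)%N].
  by apply: successive_spread => //; rewrite prednK.
have sub := supp_sum_modulus zs.
have := interval_hull_card (finite_supp _) (sub _ (eq_ind _ (fun U => U a) ta _ tu))
   (sub _ (eq_ind _ (fun U => U b) tb _ tu)) ab.
rewrite prednK // => mcard.
have {}mcard : m%:R <= 20^-1 * Num.sqrt (log2p1 (S%:R `^ 40^-1)) :> R.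
  by apply: le_trans (scard _ Qs); rewrite ler_nat.
have S1 : 1 <= S%:R :> R by rewrite ler1n; exact: J_gt0.
have pS : (S%:R : R) `^ 40^-1 <= S%:R.
  by rewrite -[leRHS]powRr1 ?ler_powR //; lra.
have lS : log2p1 ((S%:R : R) `^ 40^-1) <= S%:R.
  apply: (@le_trans _ _ (f S)); last exact: log2_le_nat.
  by apply: log2p1_le => //; exact: powR_ge0.
have sqS : Num.sqrt (log2p1 ((S%:R : R) `^ 40^-1)) <= S%:R.
  apply: (le_trans (ler_wsqrtr lS)).
  rewrite -[leRHS]ger0_norm // -sqrtr_sqr.
  by apply: ler_wsqrtr; rewrite expr2 ler_peMr.
rewrite -(ltr_nat R); lra.
Qed.

(** The weights of the parts of a special functional of length [k] are all much
larger than [k]: the first by its choice, the others because they belong to the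
set of lengths and exceed the first by the growth of the coding function. *)
Lemma special_weights N k z : K_of j k ->
  special_functional j sigma (norm_stage j sigma N) k z ->
  exists (s : seq (c00 R)) (m : nat -> nat), [/\ size s = k /\ successive s,
    (forall i, (i < k)%N -> Astar (norm_stage j sigma N) (m i) (nth 0 s i)),
    (forall i, (i < k)%N -> (0 < m i)%N /\ 4 * k%:R ^+ 2 <= f (m i)),
    [/\ m 0%N = j k.*2.-1, forall i, (i < k)%N -> range j (m i) &
      forall i, (i.+1 < k)%N ->
      [/\ m i.+1 = sigma (map (@modulus R) (take i.+1 s)),
      Q_sequences (map (@modulus R) (take i.+1 s)) & (m 0 < m i.+1)%N]] &
    z = (Num.sqrt (f k))^-1 *: \sum_(y <- s) y].
Proof.
move=> Kk [s [[sk ss] sQ s0 sS zE]].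
pose m i := if i is i'.+1 then sigma (map (@modulus R) (take i'.+1 s))
            else j k.*2.-1.
have k0 : (0 < k)%N by exact: J_gt0 (K_sub_J Kk).
have sN := stage_solid j sigma N.
have LQ i : (i.+1 < k)%N -> Q_sequences (map (@modulus R) (take i.+1 s)).
  move=> ik; apply: Q_sequences_modulus.
  - by rewrite -size_eq0 size_take sk ik.
  - exact: successive_take.
  - by move=> y /mem_take; exact: sQ.
have m0i i : (i.+1 < k)%N -> (m 0 < m i.+1)%N.
  move=> ik; apply: (@coding_gt _ (m 0%N) _ (nth 0 s 0) sN) => //=.
  - exact: J_gt0 (L_sub_J (first_weight_L k0)).
  - exact: successive_take.
  - by move=> y /mem_take; exact: sQ.
  - by case: (s) sk => [|y t _]; [move=> /esym h; rewrite h in k0|rewrite /= in_cons eqxx].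
have Jm i : (i < k)%N -> range j (m i).
  case: i => [_|i ik]; first exact: L_sub_J (first_weight_L k0).
  by have [_ sL _] := hsigma; apply/L_sub_J/sL/LQ.
exists s, m; split => //.
- by case=> [_|i] //; exact: sS.
- move=> i ik; split; first exact: J_gt0 (Jm i ik).
  apply: J_growth (K_sub_J Kk) (Jm i ik) _.
  apply: (leq_trans (K_lt_first_weight Kk)).
  by case: i ik => // i ik; apply: ltnW; exact: m0i.
- by split=> // i ik; split => //; [exact: LQ|exact: m0i].
Qed.

End LacunaryLengths.

(** * Block sequences cut by successive sets *)

Section Counting.
Variable R : realType.
Implicit Types (y : nat -> c00 R) (E F : set nat) (c : nat -> R).

Definition block_seq y := forall l l' i k, (l < l')%N ->
  y l i != 0 -> y l' k != 0 -> (i < k)%N.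

Definition meets E (x : c00 R) : bool := `[< exists2 i, E i & x i != 0 >].

Lemma meetsP E (x : c00 R) : reflect (exists2 i, E i & x i != 0) (meets E x).
Proof. exact: asboolP. Qed.

Lemma restr_meets E (x : c00 R) : ~~ meets E x -> restr E x = 0.
Proof.
move=> /meetsP h; apply: restr_out => i Ei; apply: contrapT => /eqP xi.
by apply: h; exists i.
Qed.

Lemma meets_restr E F (x : c00 R) : meets F (restr E x) = meets (F `&` E) x.
Proof.
apply/meetsP/meetsP => -[i].
- move=> Fi; rewrite restrE; case: ifP => [|_ /eqP//].
  by rewrite inE => Ei xi; exists i.
- by move=> [Fi Ei] xi; exists i => //; rewrite restrE mem_set.
Qed.

Lemma meetsS E F (x : c00 R) : E `<=` F -> meets E x -> meets F x.
Proof. by move=> EF /meetsP[i Ei xi]; apply/meetsP; exists i => //; exact: EF. Qed.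

Lemma block_seq_restr E y : block_seq y -> block_seq (fun l => restr E (y l)).
Proof.
move=> by_ l l' i k ll'; rewrite !restrE; case: ifP; rewrite ?eqxx // => _.
by case: ifP; rewrite ?eqxx // => _; exact: by_.
Qed.

Definition wcount c y n E := \sum_(l < n) c l * (meets E (y l))%:R.

Lemma wcount_ge0 c y n E : (forall l, 0 <= c l) -> 0 <= wcount c y n E.
Proof. by move=> c0; apply: sumr_ge0 => l _; rewrite mulr_ge0. Qed.

Lemma wcountS c y n E F : (forall l, 0 <= c l) -> E `<=` F ->
  wcount c y n E <= wcount c y n F.
Proof.
move=> c0 EF; apply: ler_sum => l _; rewrite ler_wpM2l // ler_nat.
by case: (boolP (meets E (y l))) => // /(meetsS EF) ->.
Qed.

Lemma wcount_le_sum c y n E : (forall l, 0 <= c l) ->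
  wcount c y n E <= \sum_(l < n) c l.
Proof. by move=> c0; apply: ler_sum => l _; rewrite ler_piMr // lern1 leq_b1. Qed.

(** At most one block meets both of two successive sets. *)
Lemma wcountU c y n E F (B : R) : block_seq y -> 0 <= B ->
  (forall l, 0 <= c l <= B) -> set_lt E F ->
  wcount c y n E + wcount c y n F <= wcount c y n (E `|` F) + B.
Proof.
move=> yb B0 cB EF.
have split1 l : c l * (meets E (y l))%:R + c l * (meets F (y l))%:R =
    c l * (meets (E `|` F) (y l))%:R +
    c l * (meets E (y l) && meets F (y l))%:R.
  rewrite -!mulrDr; congr (_ * _); rewrite -!natrD; congr (_%:R).
  have -> : meets (E `|` F) (y l) = meets E (y l) || meets F (y l).
    apply/meetsP/orP => [[i [Ei|Fi] yi]|[]/meetsP[i Ei yi]].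
    - by left; apply/meetsP; exists i.
    - by right; apply/meetsP; exists i.
    - by exists i => //; left.
    - by exists i => //; right.
  by case: (meets E _); case: (meets F _).
rewrite /wcount -big_split (eq_bigr _ (fun (l : 'I_n) _ => split1 l)).
rewrite big_split lerD2l.
(* Two blocks met by both sets would have to interleave with them. *)
have [[l0 ml0]|none] := pselect (exists l : 'I_n,
    meets E (y l) && meets F (y l)); last first.
  rewrite big1 // => l _; case: (boolP (_ && _)) => [h|_]; last by rewrite mulr0.
  by exfalso; apply: none; exists l.
rewrite (bigD1 l0) //= big1.
  by rewrite addr0 ml0 mulr1; have /andP[] := cB l0.
move=> l /eqP ll0; case: (boolP (_ && _)) => [h|_]; last by rewrite mulr0.
exfalso; move: h ml0 => /andP[/meetsP[i Ei yi] /meetsP[k Fk yk]].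
move=> /andP[/meetsP[i' Ei' yi'] /meetsP[k' Fk' yk']].
have [lt|lt|/val_inj//] := ltngtP l l0.
- have := yb _ _ _ _ lt yk yi'; have := EF _ _ Ei' Fk; lia.
- have := yb _ _ _ _ lt yk' yi; have := EF _ _ Ei Fk'; lia.
Qed.

(** Successive sets cut a block sequence with little overlap: each set of the
family shares at most one block with the sets that follow it. *)
Lemma sum_wcount c y n (s : seq (set nat)) (B : R) : block_seq y -> 0 <= B ->
  (forall l, 0 <= c l <= B) -> successive_sets s ->
  \sum_(F <- s) wcount c y n F <= wcount c y n (seq_union s) + B * (size s)%:R.
Proof.
move=> yb B0 cB; have c0 l : 0 <= c l by have /andP[] := cB l.
elim: s => [_|E s IH /successive_sets_cons[_ lt ss]].
  by rewrite big_nil mulr0 addr0 wcount_ge0.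
rewrite big_cons seq_union_cons.
have := wcountU n yb B0 cB lt; have := IH ss.
rewrite /= -natr1 mulrDr mulr1; lra.
Qed.

End Counting.

(** * Rapidly increasing sequences *)

Section RapidlyIncreasing.
Variables (R : realType) (j : nat -> nat) (sigma : seq (c00 R) -> nat).
Hypotheses (hj : admissible_J R j) (hsigma : coding_function j sigma).

Local Notation f n := (log2p1 (n%:R : R)).
Local Notation P := (norm_stage j sigma).
Local Notation G := (gowers_norm j sigma).
Implicit Types (y : nat -> c00 R) (E F : set nat).

(** The vector [x] behaves like an average of a long sequence equivalent to the
basis of the space of summable sequences: cutting it into at most [M] pieces
does not increase the sum of the norms beyond 1. *)
Definition averaging (M : nat) (x : c00 R) := forall s, (0 < size s <= M)%N ->
  successive_sets s -> \sum_(E <- s) G (restr E x) <= 1.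

(** Rapidly increasing sequences. In the last condition the factor [2 ^+ l]
makes the contributions of all terms preceding a given one summable. *)
Record ris (y : nat -> c00 R) (M : nat -> nat) : Prop := Ris {
  ris_block : block_seq y ;
  ris_avg : forall l, averaging (M l) (y l) ;
  ris_gt0 : forall l, (0 < M l)%N ;
  ris_mono : forall l l', (l <= l')%N -> (M l <= M l')%N ;
  ris_l1 : forall l, 2 ^+ l * l1 (y l) <= Num.sqrt (f (M l.+1)) }.
Arguments ris_avg {y M} _ l.

Lemma averaging_norm M x : (0 < M)%N -> averaging M x -> G x <= 1.
Proof.
move=> M0 /(_ [:: setT]); rewrite /= M0 big_seq1 restrT; apply => //.
by split=> [[|i]|[|i]] //= _; exists 0%N.
Qed.

Lemma averaging_restr M E x : averaging M x -> averaging M (restr E x).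
Proof.
move=> ax s sM ss; apply: le_trans (ax s sM ss); apply: ler_sum => F _.
apply: (solid_dom (norm_solid j sigma)) => i; rewrite !restrE.
by case: ifP => // _; case: ifP; rewrite ?normr0.
Qed.

Arguments averaging_restr {M} E {x} _.

Lemma ris_norm y M l : ris y M -> G (y l) <= 1.
Proof.
by move=> ry; apply: (@averaging_norm (M l)); [exact: ris_gt0 ry l|exact: ris_avg ry l].
Qed.

(** Only one term of a rapidly increasing sequence can see a given weight [m]
as being of its own order of magnitude: to later terms the weight looks small,
and they are averages; earlier ones are too short to compete with it. *)
Lemma ris_weight_sum y M n (m : nat) (th : R) (A b : nat -> R) : ris y M ->
  0 <= th -> th * Num.sqrt (f m) <= 1 -> (forall l, 0 <= b l) ->
  (forall l, (m <= M l)%N -> A l <= b l) ->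
  (forall l, A l <= l1 (y l)) -> (forall l, th * A l <= 1) ->
  \sum_(l < n) th * A l <= th * \sum_(l < n) b l + 3.
Proof.
move=> ry th0 thm b0 Ab Al1 A1.
(* The difference of the two truth values is 1 for the term whose own order of
magnitude is that of [m], and telescopes in the sum. *)
have term l : th * A l <= th * b l + 2^-1 ^+ l +
    ((M l < m)%N%:R - (M l.+1 < m)%N%:R).
  have thb : 0 <= th * b l by rewrite mulr_ge0.
  have e0 : 0 <= 2^-1 ^+ l :> R by rewrite exprn_ge0.
  have [mM|Mm] := leqP m (M l).
    rewrite (_ : (M l.+1 < m)%N = false); last first.
      by rewrite ltnNge (leq_trans mM) // (ris_mono ry).
    by have := ler_wpM2l th0 (Ab l mM); rewrite /=; lra.
  have [mM'|Mm'] := leqP m (M l.+1); first by have := A1 l; rewrite /=; lra.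
  rewrite /=; suff : th * A l <= 2^-1 ^+ l by lra.
  have h1 : A l <= 2^-1 ^+ l * Num.sqrt (f m).
    apply: (le_trans (Al1 l)); rewrite exprVn -ler_pdivrMl ?invr_gt0 ?exprn_gt0 //.
    rewrite invrK; apply: (le_trans (ris_l1 ry l)); apply: ler_wsqrtr.
    exact/log2_mono/ltnW.
  apply: (le_trans (ler_wpM2l th0 h1)); rewrite mulrCA ler_piMr //.
apply: (le_trans (ler_sum _ (fun (l : 'I_n) _ => term l))).
have geo k : \sum_(l < k) (2^-1 : R) ^+ l = 2 - 2 * 2^-1 ^+ k.
  elim: k => [|k IH]; first by rewrite big_ord0 expr0; ring.
  by rewrite big_ord_recr /= IH exprS; field.
have tele k : \sum_(l < k) ((M l < m)%N%:R - (M l.+1 < m)%N%:R : R) =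
    (M 0%N < m)%N%:R - (M k < m)%N%:R.
  elim: k => [|k IH]; first by rewrite big_ord0 subrr.
  by rewrite big_ord_recr /= IH; ring.
rewrite big_split /= tele big_split /= geo -mulr_sumr.
have : (M 0%N < m)%N%:R - (M n < m)%N%:R <= 1 :> R.
  by case: (M 0%N < m)%N; case: (M n < m)%N; rewrite /=; lra.
have : 0 <= 2^-1 ^+ n :> R by rewrite exprn_ge0.
lra.
Qed.

Definition part (y : nat -> c00 R) n E := restr E (\sum_(l < n) y l : c00 R).
Definition nmeet (y : nat -> c00 R) n E := wcount (fun=> 1) y n E.

Lemma nmeet_ge0 y n E : 0 <= nmeet y n E.
Proof. exact: wcount_ge0. Qed.

Lemma nmeet_le y n E : nmeet y n E <= n%:R.
Proof.
by apply: (le_trans (wcount_le_sum _ _ _ _)) => //; rewrite sumr_const card_ord.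
Qed.

Lemma sum_nmeet y n E s : block_seq y -> successive_sets s ->
  \sum_(F <- s) nmeet y n (F `&` E) <= nmeet y n (E `&` seq_union s) + (size s)%:R.
Proof.
move=> yb ss.
have := @sum_wcount _ (fun=> 1) _ n s 1 (@block_seq_restr _ E y yb) ler01
  (fun=> _) ss.
rewrite mul1r setIC; set W := (fun E0 => _) => h.
have eqW F : wcount (fun=> 1) (fun l => restr E (y l)) n F = nmeet y n (F `&` E).
  by apply: eq_bigr => l _; rewrite meets_restr.
rewrite -eqW; under eq_bigr do rewrite -eqW; apply: h => l.
by rewrite ler01 lexx.
Qed.

Lemma partE y n E : part y n E = \sum_(l < n) restr E (y l).
Proof. exact: restr_sum. Qed.

Lemma restr_part y n E F : restr F (part y n E) = part y n (F `&` E).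
Proof. by rewrite /part restrI. Qed.

Lemma part_coord y n E i (B : R) : block_seq y -> 0 <= B ->
  (forall l, `|y l i| <= B) -> `|part y n E i| <= B.
Proof.
move=> yb B0 yB; apply: (@le_trans _ _ `|(\sum_(l < n) y l) i|).
  exact: dom_restr.
rewrite c00_sum; have [[l0 yl0]|none] := pselect (exists l : 'I_n, y l i != 0).
  rewrite (bigD1 l0) //= big1 ?addr0 // => l /eqP ll0.
  apply: contrapT => /eqP yl; have [lt|lt|/val_inj//] := ltngtP l l0.
  - by have := yb _ _ _ _ lt yl yl0; rewrite ltnn.
  - by have := yb _ _ _ _ lt yl0 yl; rewrite ltnn.
rewrite big1 ?normr0 // => l _; apply: contrapT => /eqP yl; apply: none.
by exists l.
Qed.

(** A weighted functional of the first kind on a sum of a rapidly increasing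
sequence: apart from a bounded error, each term met contributes at most the
inverse of the weight. *)
Lemma weighted_part y M n E s : ris y M -> (0 < size s)%N ->
  successive_sets s ->
  (f (size s))^-1 * \sum_(F <- s) G (restr F (part y n E)) <=
  (f (size s))^-1 * nmeet y n (E `&` seq_union s) + 3.
Proof.
move=> ry s0 ss; set U := seq_union s; set fm := f (size s).
have sG := norm_solid j sigma.
have f1 : 1 <= fm by exact: log2_ge1.
have f0 : 0 < fm by lra.
pose A l := \sum_(F <- s) G (restr F (restr E (y l))).
have le1 : \sum_(F <- s) G (restr F (part y n E)) <= \sum_(l < n) A l.
  rewrite exchange_big; apply: ler_sum => F _.
  by rewrite partE restr_sum; exact: solid_sum.
have A0 l : ~~ meets (E `&` U) (y l) -> A l = 0.
  move=> h; rewrite /A big1_seq // => F /andP[_ Fs].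
  rewrite restrI restr_meets ?solid0 //; apply: contra h; apply: meetsS.
  move=> i [Fi Ei]; split => //; exists (index F s); rewrite ?index_mem //.
  by rewrite nth_index.
apply: (@le_trans _ _ (\sum_(l < n) fm^-1 * A l)).
  by rewrite -mulr_sumr ler_wpM2l // invr_ge0 ltW.
apply: (le_trans (@ris_weight_sum y M n (size s) fm^-1 A
   (fun l => 1 * (meets (E `&` U) (y l))%:R) ry _ _ _ _ _ _)) => //.
- by rewrite invr_ge0 ltW.
- rewrite ler_pdivrMl // mulr1 -[leRHS]ger0_norm ?(ltW f0) // -sqrtr_sqr.
  by apply: ler_wsqrtr; rewrite expr2 ler_peMr // ltW.
- move=> l sM; rewrite mul1r; case: (boolP (meets _ _)) => [_|/A0 -> //].
  by have /(_ s) := averaging_restr E (ris_avg ry l); apply => //; rewrite s0.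
- move=> l; apply: (le_trans (sum_solid_successive _ sG ss)).
  exact/l1_dom/dom_restr.
- move=> l; have h : fm^-1 * A l <= G (restr E (y l)) by exact: norm_fst.
  apply: (le_trans h).
  by apply: (le_trans (solid_restr _ _ sG)); exact: ris_norm ry.
Qed.

Lemma special_dual_ball N k z : K_of j k -> special_functional j sigma (P N) k z ->
  dual_ball G z.
Proof. by move=> Kk zk x; exact: norm_special Kk zk. Qed.

Lemma Astar_dual_ball N m z : (0 < m)%N -> Astar (P N) m z -> dual_ball (P N.+1) z.
Proof.
move=> m0 zm x; have sN := stage_solid j sigma N.
have [s [sm ss _ le]] := Astar_pairing_le x sN zm.
apply: (le_trans le); exact: next_norm_fst.
Qed.

(** A special functional much longer than the number of terms takes bounded
values: except for one term and for errors that are summable, each term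
contributes at most the inverse of [Num.sqrt (f k)], by its averaging property,
and there are no more than [Num.sqrt (f k)] terms. *)
Lemma long_special_part y M n E N k z : ris y M -> K_of j k ->
  special_functional j sigma (P N) k z -> n%:R ^+ 2 <= f k ->
  `|pairing z (part y n E)| <= 4.
Proof.
move=> ry Kk zk nk; have sG := norm_solid j sigma.
have [s [m [[sk ss] sA mk _ zE]]] := special_weights hj hsigma Kk zk.
have k0 : (0 < k)%N by apply: (J_gt0 hj); exact: K_sub_J.
have rt0 : 0 < Num.sqrt (f k) by rewrite sqrtr_gt0 log2_gt0.
set th := (Num.sqrt (f k))^-1; have th0 : 0 <= th by rewrite invr_ge0 ltW.
pose A l := `|pairing (\sum_(w <- s) w) (restr E (y l))|.
have sB w : w \in s -> dual_ball G w.
  move=> /(nthP 0)[i]; rewrite sk => ik <- x.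
  have [mi0 _] := mk i ik.
  by apply: le_trans (Astar_dual_ball mi0 (sA i ik) x) (stage_le_norm _ _ _ _).
apply: (@le_trans _ _ (\sum_(l < n) th * A l)).
  rewrite zE pairingZl normrM ger0_norm // -mulr_sumr ler_wpM2l //.
  by rewrite partE pairing_sumr; exact: ler_norm_sum.
apply: (le_trans (@ris_weight_sum y M n k th A (fun=> 1) ry _ _ _ _ _ _)) => //.
- by rewrite /th mulVf ?gt_eqF.
- move=> l kM; apply: (@le_trans _ _ (\sum_(F <- map (@supp R) s)
      G (restr F (restr E (y l))))).
    rewrite /A pairing_suml big_map; apply: (le_trans (ler_norm_sum _ _ _)).
    rewrite big_seq [leRHS]big_seq; apply: ler_sum => w ws.
    by rewrite -pairing_supp; exact: sB.
  have /(_ (map (@supp R) s)) := averaging_restr E (ris_avg ry l).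
  by apply => //; rewrite size_map sk k0.
- move=> l; apply: (@le_trans _ _ (l1 (restr E (y l)))).
    apply: pairing_le_l1 => i; apply: coord_sum_successive => // w ws.
    exact: dual_ball_coord sG (sB w ws).
  exact/l1_dom/dom_restr.
- move=> l; have := special_dual_ball Kk zk (restr E (y l)).
  rewrite zE pairingZl normrM ger0_norm // -/th -/(A l) => h.
  apply: (le_trans h); apply: (le_trans (solid_restr _ _ sG)).
  exact: ris_norm ry.
- rewrite sumr_const card_ord.
  suff : th * n%:R <= 1 by lra.
  rewrite /th ler_pdivrMl // mulr1 -[leLHS]ger0_norm // -sqrtr_sqr.
  exact: ler_wsqrtr.
Qed.

End RapidlyIncreasing.

(** * The upper estimate *)

Section UpperEstimate.
Variables (R : realType) (j : nat -> nat) (sigma : seq (c00 R) -> nat).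
Hypotheses (hj : admissible_J R j) (hsigma : coding_function j sigma).

Local Notation f n := (log2p1 (n%:R : R)).
Local Notation P := (norm_stage j sigma).
Local Notation G := (gowers_norm j sigma).
Implicit Types (y : nat -> c00 R) (E F : set nat).

Section Stage.
Variables (y : nat -> c00 R) (M : nat -> nat) (n N : nat) (D : R).
Hypotheses (ry : ris j sigma y M) (D2 : 2 <= D).
Hypothesis IH : forall E a, 1 <= a ->
  P N (part y n E) <= 8 * nmeet y n E / a + D * expR a.

Let nm0 E : 0 <= nmeet y n E := nmeet_ge0 y n E.
Let nmS E F : E `<=` F -> nmeet y n E <= nmeet y n F.
Proof. by move=> EF; apply: wcountS. Qed.

Lemma stage_large_weight s E : (0 < size s)%N -> successive_sets s ->
  (f (size s))^-1 * \sum_(F <- s) P N (restr F (part y n E)) <=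
  (f (size s))^-1 * nmeet y n (E `&` seq_union s) + 3.
Proof.
move=> s0 ss; apply: le_trans (weighted_part n E ry s0 ss).
rewrite ler_wpM2l ?invr_ge0 ?log2_ge0 //; apply: ler_sum => F _.
exact: stage_le_norm.
Qed.

Lemma stage_small_weight s E a : successive_sets s -> 1 <= a ->
  (f (size s))^-1 * \sum_(F <- s) P N (restr F (part y n E)) <=
  (f (size s))^-1 * (8 * (nmeet y n (E `&` seq_union s) + (size s)%:R) / a
                     + (size s)%:R * (D * expR a)).
Proof.
move=> ss a1; rewrite ler_wpM2l ?invr_ge0 ?log2_ge0 //.
have a0 : 0 < a by lra.
apply: (@le_trans _ _ (\sum_(F <- s) (8 / a * nmeet y n (F `&` E) + D * expR a))).
  apply: ler_sum => F _; rewrite restr_part; apply: (le_trans (IH _ a1)).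
  by rewrite mulrAC.
rewrite big_split /= -mulr_sumr big_const_seq count_predT iter_addr_0.
rewrite -[_ *+ size s]mulr_natl lerD2r mulrAC ler_wpM2r ?invr_ge0 ?(ltW a0) //.
rewrite ler_wpM2l //.
by apply: sum_nmeet ss; exact: ris_block ry.
Qed.

(** For a weight [f m] with [a <= 4 * f m] the direct estimate is already good
enough. Otherwise the induction hypothesis is applied to the [m] pieces with
[a / f m] in place of [a], which restores the factor [1 / a] after the division
by the weight. The pieces overlap in at most [m] terms, and the [m] error terms
are absorbed since [m <= expR (a / 4)] and [3 / 2 <= f m]. *)
Lemma stage_weighted s E a : (0 < size s)%N -> successive_sets s -> 1 <= a ->
  (f (size s))^-1 * \sum_(F <- s) P N (restr F (part y n E)) <=
  8 * nmeet y n (E `&` seq_union s) / a + D * expR a.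
Proof.
move=> s0 ss a1; have a0 : 0 < a by lra.
have ea : 1 + a <= expR a by exact: expR_ge1Dx.
have Dea : 2 * expR a <= D * expR a by rewrite ler_wpM2r // expR_ge0.
set t := nmeet y n _; have t0 : 0 <= t by exact: nm0.
have [s1|s1] := leqP (size s) 1.
  case: s s0 ss s1 @t t0 => [|F []] //= _ _ _ _.
  rewrite big_seq1 log2p1_1 invr1 mul1r restr_part.
  by rewrite seq_union_cons seq_union_nil setU0 setIC; exact: (IH _ a1).
have f32 : 3 / 2 <= f (size s).
  by apply: (le_trans (log2_2 R)); exact: log2_mono.
set fm := f (size s) in f32 *; have fm0 : 0 < fm by lra.
have [afm|fma] := leP (a / 4) fm.
  apply: (le_trans (stage_large_weight _ s0 ss)); rewrite -/fm -/t.
  have h1 : fm^-1 * t <= 4 * (t / a).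
    rewrite mulrCA mulrC ler_wpM2l // -[leRHS]invf_div.
    by rewrite lef_pV2 ?posrE // divr_gt0.
  have h2 : 0 <= t / a by rewrite divr_ge0 // ltW.
  rewrite -[8 * t / a]mulrA; lra.
have a6 : 6 < a by lra.
have a'1 : 1 <= a / fm by rewrite ler_pdivlMr //; lra.
apply: (le_trans (stage_small_weight _ ss a'1)); rewrite -/fm -/t.
set m : R := (size s)%:R.
have m0 : 0 <= m by [].
have me : m <= expR (a / 4) by apply: log2_ge_lt => //; lra.
have -> : fm^-1 * (8 * (t + m) / (a / fm) + m * (D * expR (a / fm))) =
    8 * t / a + (8 * m / a + fm^-1 * (m * (D * expR (a / fm)))).
  by field; rewrite !gt_eqF.
rewrite lerD2l.
have e34 : 2 <= expR (3 * a / 4).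
  by apply: le_trans (expR_ge1Dx _); lra.
have e1 : expR a = expR (a / 4) * expR (3 * a / 4).
  by rewrite -expRD; congr expR; field.
have h1 : 8 * m / a <= 2^-1 / 3 * (2 * (D * expR a)).
  apply: (@le_trans _ _ (8 / 6 * expR (a / 4))).
    rewrite mulrAC ler_pM ?divr_ge0 ?(ltW a0) //.
    by rewrite ler_pM2l // lef_pV2 ?posrE // ltW.
  have : expR (a / 4) * 2 <= expR a by rewrite e1 ler_wpM2l ?expR_ge0.
  lra.
(* [a / fm] is at most [2 * a / 3], and the product of the two exponentials has
exponent [11 * a / 12]. *)
have h2 : m * expR (a / fm) <= expR a.
  apply: (@le_trans _ _ (expR (a / 4) * expR (2 * a / 3))).
    rewrite ler_pM ?expR_ge0 // ler_expR ler_pdivrMr // mulrAC.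
    have := ler_wpM2l (ltW a0) f32; lra.
  by rewrite -expRD ler_expR; lra.
have h3 : fm^-1 * (m * (D * expR (a / fm))) <= 2 / 3 * (D * expR a).
  have q : fm^-1 <= 2 / 3.
    by rewrite -[leRHS]invf_div lef_pV2 ?posrE //; lra.
  have D0 : 0 <= D by apply: le_trans D2.
  have r : D * (m * expR (a / fm)) <= D * expR a by rewrite ler_wpM2l.
  rewrite [m * _]mulrCA ler_pM ?invr_ge0 ?(ltW fm0) //.
  by rewrite !mulr_ge0 ?expR_ge0.
lra.
Qed.

(** The functionals constituting a special functional have weights exceeding
the square of their number [k]; either such a weight is comparable with [a], or
[a] is so large that the [k] error terms together stay below [D * expR a]. *)
Lemma stage_special k z E a : K_of j k ->
  special_functional j sigma (P N) k z -> k%:R <= D -> 1 <= a ->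
  `|pairing z (part y n E)| <= 8 * nmeet y n E / a + D * expR a.
Proof.
move=> Kk zk kD a1; have a0 : 0 < a by lra.
have ea : 1 + a <= expR a by exact: expR_ge1Dx.
have sN := stage_solid j sigma N.
have [s [m [[sk ss] sA mk _ zE]]] := special_weights hj hsigma Kk zk.
have k0 : (0 < k)%N by apply: (J_gt0 hj); exact: K_sub_J.
have k1 : 1 <= k%:R :> R by rewrite ler1n.
have D0 : 0 <= D by lra.
have term i : (i < k)%N -> `|pairing (nth 0 s i) (part y n E)| <=
    16 / a * nmeet y n (supp (nth 0 s i) `&` E) + (3 + D * expR a / (4 * k%:R)).
  move=> ik; have [mi0 kfm] := mk i ik.
  have [t [tm tt tu le]] := Astar_pairing_le (part y n E) sN (sA i ik).
  apply: (le_trans le); rewrite -tm -tu setIC.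
  have t0 : (0 < size t)%N by rewrite tm.
  set T := nmeet _ _ _; have T0 : 0 <= T by exact: nm0.
  have TA : 0 <= T / a by rewrite divr_ge0 // ltW.
  have De0 : 0 <= D * expR a / (4 * k%:R).
    by rewrite divr_ge0 ?mulr_ge0 ?expR_ge0.
  have [afm|fma] := leP (a / 8) (f (m i)).
    apply: (le_trans (stage_large_weight E t0 tt)); rewrite -/T tm.
    have h1 : (f (m i))^-1 * T <= 8 * (T / a).
      rewrite mulrCA mulrC ler_wpM2l // -[leRHS]invf_div.
      have fm0 : 0 < f (m i) by exact: log2_gt0.
      by rewrite lef_pV2 ?posrE // divr_gt0.
    by rewrite mulrAC -mulrA; lra.
  have k2 : 4 * k%:R <= 4 * k%:R ^+ 2 :> R.
    by rewrite ler_pM2l // expr2 ler_peMr.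
  have a2 : 1 <= a / 2 by lra.
  apply: (le_trans (stage_weighted E t0 tt a2)); rewrite -/T.
  have -> : 8 * T / (a / 2) = 16 / a * T by field; rewrite gt_eqF.
  rewrite lerD2l; apply: (@le_trans _ _ (D * expR a / (4 * k%:R))); last by lra.
  rewrite -mulrA ler_wpM2l // ler_pdivlMr ?mulr_gt0 //; last by rewrite ltr0n.
  have -> : expR a = expR (a / 2) * expR (a / 2) by rewrite -expRD; congr expR; field.
  rewrite ler_wpM2l ?expR_ge0 //; apply: le_trans (expR_ge1Dx (a / 2)); lra.
have kfk : 256 < f k by apply: (J_large hj); exact: K_sub_J.
have rtk : (Num.sqrt (f k))^-1 <= 16^-1.
  rewrite lef_pV2 ?posrE ?sqrtr_gt0 ?log2_gt0 //.
  rewrite -[leLHS]ger0_norm // -sqrtr_sqr; apply: ler_wsqrtr.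
  by apply: le_trans (ltW kfk); lra.
have rt0 : 0 <= (Num.sqrt (f k))^-1 by rewrite invr_ge0 sqrtr_ge0.
rewrite zE pairingZl normrM ger0_norm // pairing_suml.
rewrite (big_nth 0) sk big_mkord.
apply: (@le_trans _ _ (16^-1 * (16 / a * (nmeet y n E + k%:R) +
    k%:R * (3 + D * expR a / (4 * k%:R))))).
  apply: ler_pM => //; apply: (le_trans (ler_norm_sum _ _ _)).
  apply: (le_trans (ler_sum _ (fun (i : 'I_k) _ => term i (ltn_ord i)))).
  rewrite big_split /= sumr_const card_ord -[_ *+ k]mulr_natl lerD2r -mulr_sumr.
  rewrite ler_wpM2l ?divr_ge0 ?(ltW a0) //.
  have := sum_nmeet n E (ris_block ry) ss.
  rewrite big_map size_map sk (big_nth 0) sk big_mkord => h; apply: (le_trans h).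
  by rewrite lerD2r nmS.
have -> : 16^-1 * (16 / a * (nmeet y n E + k%:R) +
    k%:R * (3 + D * expR a / (4 * k%:R))) =
  nmeet y n E / a + (k%:R / a + (k%:R * (3 / 16) + D * expR a / 64)).
  by field; rewrite !gt_eqF // ltr0n.
have h1 : 0 <= nmeet y n E / a by rewrite divr_ge0 ?nm0 // ltW.
have h2 : k%:R / a <= D.
  by apply: le_trans kD; rewrite ler_pdivrMr // ler_peMr.
have h3 : D * 2 <= D * expR a by rewrite ler_wpM2l //; lra.
rewrite -[8 * _ / a]mulrA; lra.
Qed.

End Stage.

(** The upper estimate: on a rapidly increasing sequence of [n] terms, the norm
behaves like that of Schlumprecht's space, as soon as no special functional of
length larger than [D] takes values larger than [D]. Optimizing over [a] gives the bound
[n / log n]; the family of affine bounds indexed by [a] is what propagates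
through the inductive definition of the norm. *)
Lemma ris_part_bound y M n (D : R) : ris j sigma y M -> 2 <= D ->
  (forall k N z E, K_of j k -> special_functional j sigma (P N) k z ->
     k%:R <= D \/ `|pairing z (part y n E)| <= D) ->
  forall E a, 1 <= a -> G (part y n E) <= 8 * nmeet y n E / a + D * expR a.
Proof.
move=> ry D2 Hsp E a a1; apply: norm_le => N.
elim: N E a a1 => [|N IH] E a a1; have a0 : 0 < a by lra.
all: have ea : 1 + a <= expR a by exact: expR_ge1Dx.
all: have nm : 0 <= 8 * nmeet y n E / a
  by rewrite divr_ge0 ?(ltW a0) // mulr_ge0 // nmeet_ge0.
all: have De1 : 2 * 1 <= D * expR a by rewrite ler_pM //; lra.
all: have coord i : `|part y n E i| <= 1
  by apply: part_coord (ris_block ry) ler01 _ => l;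
     apply: le_trans (solid_coord (norm_solid j sigma) _ _) (ris_norm l ry).
  by apply: sup_norm_le => [|i]; [|apply: (le_trans (coord i))]; lra.
apply: next_norm_le.
- by lra.
- by move=> i; apply: (le_trans (coord i)); lra.
- move=> m s m0 sm ss; rewrite -sm in m0 *.
  apply: (le_trans (stage_weighted ry D2 IH E m0 ss a1)).
  rewrite lerD2r ler_wpM2r ?invr_ge0 ?(ltW a0) // ler_wpM2l //.
  by apply: wcountS.
- move=> k z Kk zk; have [kD|zD] := Hsp k N z E Kk zk.
    exact: (stage_special ry D2 IH E Kk zk kD a1).
  apply: (le_trans zD).
  have : D * 1 <= D * expR a by rewrite ler_wpM2l //; lra.
  lra.
Qed.

End UpperEstimate.

(** * Rational functionals norming averages *)

Section NormingFunctionals.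
Variables (R : realType) (j : nat -> nat) (sigma : seq (c00 R) -> nat).

Local Notation f n := (log2p1 (n%:R : R)).
Local Notation P := (norm_stage j sigma).
Local Notation G := (gowers_norm j sigma).
Implicit Types (x y z : c00 R) (E F : set nat).

Lemma dual_ball_restr p E y : solid_norm p -> dual_ball p y ->
  dual_ball p (restr E y).
Proof.
move=> sp yp x; rewrite pairing_restr.
exact: le_trans (yp _) (solid_restr E x sp).
Qed.

Lemma dual_ball_dom p y z : solid_norm p -> dom z y -> dual_ball p y ->
  dual_ball p z.
Proof.
move=> sp zy yp x.
pose th i := usg (y i * (usg (z i * x i) * x i)) * usg (z i * x i).
have [n xn] := c00_finsupp x.
apply: (@le_trans _ _ `|pairing y (mulc th x)|); last first.
  apply: (le_trans (yp _)); apply: solid_dom => // i.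
  by rewrite mulcE normrM /th normrM !norm_usg !mul1r.
rewrite (pairing_ord _ xn) (@pairing_ord _ _ _ n) => [|i /xn e]; last first.
  by rewrite mulcE e mulr0.
apply: (le_trans (ler_norm_sum _ _ _)).
have e i : y i * mulc th x i = `|y i * x i|.
  rewrite mulcE /th -mulrA mulrCA usg_mul !normrM norm_usg mul1r.
  by rewrite -normrM.
rewrite ger0_norm; last by apply: sumr_ge0 => i _; rewrite e.
apply: ler_sum => i _; rewrite e !normrM ler_wpM2r //; exact: zy.
Qed.

Lemma dual_ballN p y : dual_ball p y -> dual_ball p (- y).
Proof. by move=> yp x; rewrite -scaleN1r pairingZl mulN1r normrN. Qed.

Lemma dual_ball_unit p i (t : R) : solid_norm p -> `|t| <= 1 ->
  dual_ball p (t *: unit_vec R i).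
Proof.
move=> sp t1 x; rewrite pairingZl pairingC pairing_unit normrM.
by apply: (le_trans _ (solid_coord sp x i)); rewrite ler_piMl.
Qed.

(** The functionals of finite support norm each stage, by induction: each
quantity in the supremum defining the next stage is approached by the values of
functionals in the dual ball of this stage. *)
Lemma stage_norming N x (e : R) : 0 < e ->
  exists2 y, dual_ball (P N) y & P N x - e <= pairing y x.
Proof.
elim: N x e => [|N IH] x e e0.
  have [_ [i _ <-] xi] : exists2 r, range (fun i => `|x i|) r & sup_norm x - e < r.
    apply: sup_adherent => //; split; first by exists `|x 0%N|; exists 0%N.
    by exists (l1 x) => _ [i _ <-]; exact: coord_l1.
  exists (usg (x i) *: unit_vec R i).
    by apply: dual_ball_unit (sup_norm_solid R) _; rewrite norm_usg.
  by rewrite pairingZl pairingC pairing_unit usg_mul ltW.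
have sN := stage_solid j sigma N; have sN1 := stage_solid j sigma N.+1.
apply: contrapT => /forall2NP none.
have low y : dual_ball (P N.+1) y -> pairing y x < P N.+1 x - e.
  by move=> yB; have [//|/negP] := none y; rewrite -ltNge.
have B0 : 0 <= P N.+1 x - e.
  have := low 0; rewrite pairing0l => h; apply/ltW/h => z.
  by rewrite pairing0l normr0 solid_ge0.
suff : P N.+1 x <= P N.+1 x - e by lra.
apply: next_norm_le => //.
- move=> i; rewrite -usg_mul -pairing_unit pairingC -pairingZl; apply/ltW/low.
  by apply: dual_ball_unit => //; rewrite norm_usg.
- move=> n s n0 sn ss; apply/ler_addgt0Pr => d d0.
  have s0 : 0 < n%:R :> R by rewrite ltr0n.
  have dn : 0 < d / n%:R by rewrite divr_gt0.
  have /choice[g gP] E : exists y, dual_ball (P N) y /\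
      P N (restr E x) - d / n%:R <= pairing y (restr E x).
    by have [y] := IH (restr E x) _ dn; exists y.
  have : pairing ((f n)^-1 *: \sum_(E <- s) restr E (g E)) x < P N.+1 x - e.
    apply: low => z; rewrite pairingZl normrM ger0_norm ?invr_ge0 ?log2_ge0 //.
    apply: le_trans (@next_norm_fst _ j sigma _ z _ _ sN n0 sn ss).
    rewrite ler_wpM2l ?invr_ge0 ?log2_ge0 // pairing_suml.
    apply: (le_trans (ler_norm_sum _ _ _)); apply: ler_sum => E _.
    by rewrite pairing_restr; exact: (gP E).1.
  rewrite pairingZl pairing_suml => h.
  have h2 : \sum_(E <- s) P N (restr E x) - d <=
            \sum_(E <- s) pairing (restr E (g E)) x.
    have -> : d = \sum_(E <- s) (d / n%:R).
      rewrite big_const_seq count_predT sn iter_addr_0.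
      by rewrite -[RHS]mulr_natr divfK // gt_eqF.
    rewrite -sumrB; apply: ler_sum => E _; rewrite pairing_restr.
    exact: (gP E).2.
  have fn1 := log2_ge1 R n0.
  have := ler_wpM2l (_ : 0 <= (f n)^-1) h2; rewrite invr_ge0 log2_ge0 => /(_ isT).
  rewrite mulrBr; have : (f n)^-1 * d <= d.
    by rewrite ler_piMl ?(ltW d0) //; have /andP[] := log2_inv_le1 R n.
  lra.
- move=> k z Kk zk; have zB : dual_ball (P N.+1) z.
    by move=> w; exact: next_norm_special Kk zk.
  rewrite ler_norml; have := low _ zB; have := low _ (dual_ballN zB).
  rewrite -scaleN1r pairingZl mulN1r => h1 h2; apply/andP; split; lra.
Qed.

Lemma rational_below (r e : R) : 0 < e -> r != 0 ->
  exists q : rat, [/\ `|ratr q : R| <= `|r|, `|r - ratr q| <= e & (ratr q : R) != 0].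
Proof.
move=> e0 r0.
have pos (t : R) : 0 < t -> exists q : rat,
    [/\ `|ratr q : R| <= `|t|, `|t - ratr q| <= e & (ratr q : R) != 0].
  move=> t0; have lt : Num.max 0 (t - e) < t by rewrite gt_max t0; lra.
  have [q] := rat_in_itvoo lt; rewrite in_itv /= gt_max => /andP[/andP[q0 qe] qt].
  exists q; split; last by rewrite gt_eqF.
    by rewrite (gtr0_norm q0) (gtr0_norm t0) ltW.
  by rewrite gtr0_norm ?subr_gt0 //; lra.
have [r1|r1] := ltP 0 r; first exact: pos.
have [|q [h1 h2 h3]] := pos (- r); first by rewrite oppr_gt0 lt_neqAle r0 r1.
exists (- q); rewrite rmorphN /= normrN oppr_eq0; split => //.
- by rewrite -(normrN r).
- by rewrite opprK -normrN opprD.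
Qed.

Lemma supp_scale (t : R) z : 0 < t -> supp (t *: z) = supp z.
Proof.
by move=> t0; apply/seteqP; split=> i; rewrite !suppE c00Z mulf_eq0 (gt_eqF t0).
Qed.

Lemma Astar_scale p m z (t : R) : solid_norm p -> 0 < t <= 1 ->
  Astar p m z -> Astar p m (t *: z).
Proof.
move=> sp /andP[t0 t1] [s [sm ss sB ->]]; exists (map ( *:%R t) s); split.
- by rewrite size_map.
- rewrite /successive -map_comp (@eq_map _ _ _ (@supp R)) // => y.
  exact: supp_scale.
- move=> _ /mapP[y ys ->]; apply/dual_ballP => // x; rewrite pairingZl normrM.
  have /dual_ballP -/(_ sp)/(_ x) yx := sB y ys.
  by apply: le_trans yx; rewrite ler_piMl // gtr0_norm.
- rewrite scalerA mulrC -scalerA; congr (_ *: _).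
  by rewrite big_map scaler_sumr.
Qed.

(** The rational functional in [Astar] matched with the average of [n] blocks:
norm the blocks on [A], rescale, and round the coordinates towards zero, which
keeps the functional in the dual ball by unconditionality. *)
Lemma matching_functional (A : set nat) (y : nat -> c00 R) (c : R) n :
  block_seq y -> 0 < c -> (0 < n)%N ->
  (forall l, c <= G (restr A (y l))) ->
  exists Z N, [/\ in_Q Z, Astar (P N) n Z,
    (forall i, Z i != 0 -> A i /\ exists2 l, (l < n)%N & y l i != 0) &
    n%:R / f n * (c / 2) <= pairing Z (\sum_(l < n) y l)].
Proof.
move=> yb c0 n0 yc; have fn1 := log2_ge1 R n0.
have fn0 : 0 < f n by lra.
have n0R : 0 < n%:R :> R by rewrite ltr0n.
have c8 : 0 < c / 8 by lra.
have /choice[Nl NlP] l : exists N, c - c / 8 < P N (restr A (y l)).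
  have [N hN] := @stage_near_norm _ j sigma (restr A (y l)) _ c8.
  by exists N; apply: le_lt_trans hN; rewrite lerD2r.
pose N := \max_(l < n) Nl l.
have sN := stage_solid j sigma N.
have PN l : (l < n)%N -> c - c / 8 < P N (restr A (y l)).
  move=> ln; apply: (lt_le_trans (NlP l)); apply: stage_le.
  exact: (@leq_bigmax _ (fun l : 'I_n => Nl l) (Ordinal ln)).
have /choice[g gP] l : exists w, [/\ dual_ball (P N) w,
    (forall i, w i != 0 -> A i /\ y l i != 0) &
    P N (restr A (y l)) - c / 8 <= pairing w (y l)].
  have [w wB wx] := stage_norming N (restr A (y l)) c8.
  exists (restr (A `&` supp (y l)) w); split.
  - exact: dual_ball_restr.
  - by move=> i; rewrite restrE; case: ifP => [|_ /eqP//]; rewrite inE => -[].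
  - rewrite pairing_restr; apply: (le_trans wx).
    rewrite -restrI (_ : restr (supp (y l)) (y l) = y l) //.
    by apply: restr_id.
pose Z0 := (f n)^-1 *: \sum_(l < n) g l.
pose x := \sum_(l < n) y l.
(* The rounding error allowed in each coordinate, small enough to cost at most
[n%:R / f n * (c / 4)] on [x]. *)
pose e := n%:R / f n * (c / 4) / (1 + l1 x).
have l1x : 0 < 1 + l1 x by have := l1_ge0 x; lra.
have nf0 : 0 < n%:R / f n by exact: divr_gt0.
have e0 : 0 < e by rewrite /e divr_gt0 // mulr_gt0 // divr_gt0.
have /choice[q qP] i : exists q : rat, [/\ `|ratr q : R| <= `|Z0 i|,
    `|Z0 i - ratr q| <= e & (Z0 i != 0) = ((ratr q : R) != 0)].
  have [z0|z0] := eqVneq (Z0 i) 0.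
    by exists 0; rewrite z0 rmorph0 subrr normr0 eqxx; split => //; exact: ltW.
  by have [q [h1 h2 h3]] := rational_below e0 z0; exists q; rewrite h3.
have Zfin : (fun i => ratr (q i) : R) \in @c00_pred R.
  have := c00_valP Z0; rewrite !inE; apply: sub_finite_set => i.
  by rewrite /support_of /=; have [_ _ <-] := qP i.
pose Z : c00 R := C00 Zfin.
have ZE i : Z i = ratr (q i) by [].
have ZZ0 : dom Z Z0 by move=> i; rewrite ZE; have [] := qP i.
have Z0supp i : Z0 i != 0 -> exists2 l : 'I_n, g l i != 0 & True.
  rewrite c00Z mulf_eq0 negb_or => /andP[_]; rewrite c00_sum => h.
  apply: contrapT => none; move/eqP: h; apply; apply: big1 => l _.
  by apply: contrapT => /eqP gl; apply: none; exists l.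
(* The norming functionals live on the blocks, hence are disjoint. *)
have gdisj l l' i : l != l' -> g l i != 0 -> g l' i = 0.
  move=> ll' gl; apply: contrapT => /eqP gl'.
  have [_ /(_ i gl)[_ yl] _] := gP l; have [_ /(_ i gl')[_ yl'] _] := gP l'.
  have [lt|lt|e1] := ltngtP l l'; last by rewrite e1 eqxx in ll'.
  - by have := yb _ _ _ _ lt yl yl'; rewrite ltnn.
  - by have := yb _ _ _ _ lt yl' yl; rewrite ltnn.
have Z0g (l : 'I_n) i : g l i != 0 -> Z0 i = (f n)^-1 * g l i.
  move=> gl; rewrite c00Z c00_sum (bigD1 l) //= big1 ?addr0 // => l' ll'.
  by apply: gdisj gl; rewrite eq_sym; move: ll'; rewrite -val_eqE.
(* The pieces showing that the rounded functional is still in [Astar]. *)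
pose w l := f n *: restr (supp (g l)) Z.
have wg (l : 'I_n) : dom (w l) (g l).
  move=> i; rewrite c00Z restrE; case: ifPn => [|_]; last by rewrite mulr0 normr0.
  rewrite inE => gl; rewrite normrM ger0_norm ?(ltW fn0) //.
  apply: (le_trans (ler_wpM2l (ltW fn0) (ZZ0 i))).
  by rewrite (Z0g l) // normrM ger0_norm ?invr_ge0 ?(ltW fn0) // mulVKf ?gt_eqF.
have wB (l : 'I_n) : dual_ball (P N) (w l).
  by apply: dual_ball_dom (wg l) _ => //; have [] := gP l.
have gne l : (l < n)%N -> exists i, g l i != 0.
  move=> ln; apply: contrapT => none.
  have [_ _] := gP l; have := PN l ln => h1 h2.
  have g0 : g l = 0.
    by apply: c00P => i; apply: contrapT => /eqP gi; apply: none; exists i.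
  by move: h2; rewrite g0 pairing0l; lra.
have wsupp l : (l < n)%N -> supp (w l) = supp (g l).
  move=> ln; apply/seteqP; split=> i; rewrite !suppE c00Z.
    by rewrite mulf_eq0 negb_or => /andP[_]; rewrite restrE; case: ifP => [|_ /eqP//]; rewrite inE.
  move=> gi; rewrite mulf_neq0 ?(gt_eqF fn0) // restrE mem_set //.
  have [_ _ <-] := qP i; rewrite (Z0g (Ordinal ln)) //.
  by rewrite mulf_neq0 // invr_neq0 // gt_eqF.
exists Z, N; split.
- move=> i; split; first by exists (q i).
  apply: (le_trans (ZZ0 i)); have [z0|/Z0supp[l gl _]] := eqVneq (Z0 i) 0.
    by rewrite z0 normr0.
  rewrite (Z0g l) // normrM; have /andP[fi0 fi1] := log2_inv_le1 R n.
  rewrite ger0_norm // mulr_ile1 //; apply: dual_ball_coord sN _.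
  by have [] := gP l.
- exists (mkseq w n); split.
  + by rewrite size_mkseq.
  + have nthE l : (l < n)%N ->
        nth set0 (map (@supp R) (mkseq w n)) l = supp (g l).
      by move=> ln; rewrite (nth_map 0) ?size_mkseq // nth_mkseq // wsupp.
    split=> i; rewrite size_map size_mkseq => ik.
      by rewrite nthE //; exact: gne.
    move=> a b; rewrite !nthE ?(ltnW ik) // => ga gb.
    have [_ /(_ a ga)[_ ya] _] := gP i; have [_ /(_ b gb)[_ yb'] _] := gP i.+1.
    exact: yb (ltnSn i) ya yb'.
  + move=> z /mapP[l]; rewrite mem_iota add0n => /andP[_ ln] ->.
    by apply/dual_ballP => //; exact: (wB (Ordinal ln)).
  + rewrite big_map.
    have -> : \sum_(l <- iota 0 n) w l = f n *: Z.
      rewrite (_ : iota 0 n = index_iota 0 n) ?big_mkord; last first.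
        by rewrite /index_iota subn0.
      apply: c00P => i; rewrite c00_sum c00Z.
      have [z0|z0] := eqVneq (Z i) 0.
        rewrite z0 mulr0 big1 // => l _; rewrite c00Z restrE z0.
        by rewrite if_same mulr0.
      have /Z0supp[l gl _] : Z0 i != 0 by have [_ _ ->] := qP i.
      rewrite (bigD1 l) // big1.
        by rewrite [LHS]addr0 c00Z restrE mem_set.
      move=> l' ll'; rewrite c00Z restrE memNset ?mulr0 // suppE => gl'.
      move/eqP: gl'; apply; apply: gdisj gl.
      by rewrite eq_sym; move: ll'; rewrite -val_eqE.
    by rewrite scalerA mulVf ?gt_eqF // scale1r.
- move=> i Zi; have /Z0supp[l gl _] : Z0 i != 0 by have [_ _ ->] := qP i.
  by have [_ /(_ i gl)[Ai yi] _] := gP l; split => //; exists l.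
- rewrite -/x; have gx l : (l < n)%N -> 3 / 4 * c <= pairing (g l) x.
    move=> ln; rewrite pairing_sumr (bigD1 (Ordinal ln)) //= big1 ?addr0.
      by have [_ _] := gP l; have := PN l ln; lra.
    move=> l' ll'; apply: eq_pairing => i.
    have [->|gi] := eqVneq (g l i) 0; first by rewrite mul0r.
    have [_ /(_ i gi)[_ yl] _] := gP l.
    have [->|yl'] := eqVneq (y l' i) 0; first by rewrite mulr0.
    have [lt|lt|e1] := ltngtP l l'.
    + by have := yb _ _ _ _ lt yl yl'; rewrite ltnn.
    + by have := yb _ _ _ _ lt yl' yl; rewrite ltnn.
    + by move: ll'; rewrite -val_eqE /= e1 eqxx.
  have h1 : n%:R / f n * (3 / 4 * c) <= pairing Z0 x.
    rewrite pairingZl mulrAC [_ * (f n)^-1]mulrC.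
    rewrite ler_wpM2l ?invr_ge0 ?(ltW fn0) // pairing_suml.
    apply: (@le_trans _ _ (\sum_(l < n) (3 / 4 * c))).
      by rewrite sumr_const card_ord -[leRHS]mulr_natl.
    by apply: ler_sum => l _; exact: gx.
  have h2 : `|pairing (Z0 - Z) x| <= n%:R / f n * (c / 4).
    have [m xm] := c00_finsupp x.
    rewrite (pairing_ord _ xm); apply: (le_trans (ler_norm_sum _ _ _)).
    apply: (@le_trans _ _ (e * l1 x)).
      rewrite (l1_ord xm) mulr_sumr; apply: ler_sum => i _; rewrite normrM.
      by rewrite ler_wpM2r // c00D c00N ZE; have [] := qP i.
    rewrite /e mulrAC ler_pdivrMr // ler_wpM2l ?lerDr //.
    apply: mulr_ge0; [exact: ltW|lra].
  have h3 : pairing (Z0 - Z) x = pairing Z0 x - pairing Z x.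
    by rewrite pairingDl -(scaleN1r Z) (pairingZl (-1)) mulN1r.
  move: h2; rewrite h3 ler_norml => /andP[_ h2].
  have h4 : n%:R / f n * (3 / 4 * c) = n%:R / f n * (c / 2) + n%:R / f n * (c / 4).
    by rewrite -mulrDr; congr (_ * _); field.
  lra.
Qed.

End NormingFunctionals.

(** * Dependent choice *)

Section DependentChoice.

(** Choice of a sequence each term of which satisfies a condition on the terms
before it; the hypothesis has to be met only for admissible beginnings. *)
Lemma dep_choice (T : Type) (x0 : T) (Rel : seq T -> T -> Prop) :
  (forall s, (forall i, (i < size s)%N -> Rel (take i s) (nth x0 s i)) ->
     exists z, Rel s z) ->
  exists Z : nat -> T, forall i, Rel (mkseq Z i) (Z i).
Proof.
move=> step.
pose good s := forall i, (i < size s)%N -> Rel (take i s) (nth x0 s i).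
have /choice[next nextP] s : exists z, good s -> Rel s z.
  have [/step[z sz]|ng] := pselect (good s); first by exists z.
  by exists x0.
pose build := fix build i := if i is i'.+1 then
  rcons (build i') (next (build i')) else [::].
pose Z i := next (build i).
have bE i : build i = mkseq Z i.
  by elim: i => // i IH; rewrite mkseqS -IH.
have bg i : good (build i).
  elim: i => [|i IH] // k.
  have -> : build i.+1 = rcons (build i) (next (build i)) by [].
  rewrite size_rcons ltnS leq_eqVlt => /orP[/eqP ->|ki].
    by rewrite nth_rcons ltnn eqxx -cats1 take_cat ltnn subnn cats0; exact: nextP.
  by rewrite nth_rcons ki -cats1 takel_cat ?(ltnW ki) //; exact: IH.
by exists Z => i; rewrite -bE; exact: nextP.
Qed.

End DependentChoice.

(** * Long averages *)

Section Averages.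
Variables (R : realType) (j : nat -> nat) (sigma : seq (c00 R) -> nat).
Hypotheses (hj : admissible_J R j) (hsigma : coding_function j sigma).

Local Notation f n := (log2p1 (n%:R : R)).
Local Notation P := (norm_stage j sigma).
Local Notation G := (gowers_norm j sigma).
Implicit Types (E F : set nat).

(** The numerical facts about lengths, with [a = ln n / 2], so that the choice
of this parameter in the upper estimate gives [n / log n]. *)
Lemma length_numeric n : 512 ^+ 2 <= f n ->
  [/\ 1 <= ln n%:R / 2 :> R, f n <= 8 * (ln n%:R / 2) &
      (f n) ^+ 3 * expR (ln n%:R / 2) <= n%:R].
Proof.
move=> fn; have nf : 512 ^+ 2 <= n%:R :> R by apply: le_trans fn (log2_le_nat _ _).
have n0 : 0 < n%:R :> R by lra.
set a := ln n%:R / 2.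
have h8 : f n <= 8 * a.
  rewrite ler_pdivrMr ?ln2_gt0 //.
  apply: (@le_trans _ _ (ln (n%:R ^+ 2))).
    have n1 : 0 < n%:R + 1 :> R by lra.
    rewrite ler_ln ?posrE ?exprn_gt0 //.
    by have := ler_wpM2l (ltW n0) nf; rewrite expr2; lra.
  rewrite lnXn // -[_ *+ 2]mulr_natl /a.
  have l0 : 0 <= ln n%:R :> R by rewrite ln_ge0 //; lra.
  have := ler_wpM2l l0 (ln2_ge2V R); lra.
have ab : 64 * 512 <= a by lra.
split => //; first by lra.
have e2 : n%:R = expR a * expR a.
  by rewrite -expRD /a -splitr lnK // posrE.
rewrite [leRHS]e2 ler_wpM2r ?expR_ge0 //.
have h3 : f n ^+ 3 <= (8 * a) ^+ 3 by rewrite lerXn2r ?nnegrE ?log2_ge0 //; lra.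
apply: (le_trans h3).
have a0 : 0 <= a by lra.
have := expR_ge1Dxn 3 a0; rewrite (_ : 4`! = 24)%N //.
have a3 : 0 <= a ^+ 3 by rewrite exprn_ge0.
have := ler_wpM2l a3 ab.
have -> : a ^+ 4 = a ^+ 3 * a by rewrite exprSr.
have -> : (8 * a) ^+ 3 = 512 * a ^+ 3 by rewrite exprMn; congr (_ * _); ring.
by move: a3; set b := a ^+ 3; set b' := b * a; lra.
Qed.

(** Lengths in [L] are not the first length, and the growth condition already
makes the second one large. *)
Lemma L_big n : L_of j n -> 512 ^+ 2 <= f n.
Proof.
move=> [a _ <-]; have [_ j0 _] := hj.
have h : 256 < (j 0%N)%:R :> R by apply: lt_le_trans j0 (log2_le_nat _ _).
have := J_growth hj (ex_intro2 _ _ 0%N I erefl) (ex_intro2 _ _ a.*2.+1 I erefl)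
   (j_mono hj (ltn0Sn _)).
apply: le_trans; have := ler_wpM2l (_ : 0 <= 256) (ltW h).
have h0 : 0 <= (j 0%N)%:R - 256 :> R by lra.
have := mulr_ge0 h0 h0 => h1 /(_ (ler0n _ _)) h2.
rewrite expr2; lra.
Qed.

Lemma ris_subseq y M (phi : nat -> nat) :
  (forall l l', (l < l')%N -> (phi l < phi l')%N) ->
  ris j sigma y M -> ris j sigma (y \o phi) (M \o phi).
Proof.
move=> mono [yb ya M0 Mm yl]; split => /=.
- by move=> l l' i k /mono; exact: yb.
- by move=> l; exact: ya.
- by [].
- by move=> l l'; rewrite leq_eqVlt => /orP[/eqP ->//|/mono/ltnW]; exact: Mm.
- have ge l : (l <= phi l)%N.
    by elim: l => // l IH; exact: leq_ltn_trans IH (mono _ _ (ltnSn l)).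
  move=> l; apply: (@le_trans _ _ (2 ^+ phi l * l1 (y (phi l)))).
    rewrite ler_wpM2r ?l1_ge0 // ler_weXn2l //; lra.
  apply: (le_trans (yl _)); apply/ler_wsqrtr/log2_mono/Mm.
  exact: mono.
Qed.

Lemma ris_shift y M q : ris j sigma y M ->
  ris j sigma (fun l => y (q + l)%N) (fun l => M (q + l)%N).
Proof.
by apply: (@ris_subseq y M (fun l => q + l)%N) => l l'; rewrite ltn_add2l.
Qed.

(** The upper estimate with [a = ln n / 2], where both terms are of the order
of magnitude of [n / f n] or smaller. *)
Lemma part_bound_J y M n E : ris j sigma y M -> 512 ^+ 2 <= f n ->
  (forall k N z F, K_of j k -> special_functional j sigma (P N) k z ->
     k%:R <= f n \/ `|pairing z (part y n F)| <= f n) ->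
  G (part y n E) <= 64 * nmeet y n E / f n + n%:R / f n ^+ 2.
Proof.
move=> ry fn Hsp; have [a1 fa fe] := length_numeric fn.
set a := ln n%:R / 2 in a1 fa fe.
have f0 : 0 < f n by lra.
have a0 : 0 < a by lra.
have f2 : 2 <= f n by lra.
apply: (le_trans (ris_part_bound hj hsigma ry f2 Hsp E a1)).
apply: lerD.
  have -> : 64 * nmeet y n E / f n = 8 * nmeet y n E * (8 / f n) by field; rewrite gt_eqF.
  rewrite ler_wpM2l ?mulr_ge0 ?nmeet_ge0 //.
  have f8 : 0 < f n / 8 by lra.
  by rewrite -[leRHS]invf_div lef_pV2 ?posrE //; lra.
rewrite ler_pdivlMr ?exprn_gt0 //; apply: le_trans fe.
rewrite (_ : f n * expR a * f n ^+ 2 = f n ^+ 3 * expR a) //; ring.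
Qed.

(** Normalized so that the matching functional takes a value of order 1, and so
that sums of parts are at most 1. *)
Definition avg n (y : nat -> c00 R) : c00 R :=
  (f n / (129 * n%:R)) *: \sum_(l < n) y l.

Lemma avg_coef n : 512 ^+ 2 <= f n -> 0 < f n / (129 * n%:R) <= 1.
Proof.
move=> fn; have nf := log2_le_nat R n.
have d0 : 0 < 129 * n%:R :> R by lra.
have f0 : 0 < f n by lra.
by rewrite divr_gt0 //= ler_pdivrMr // mul1r; lra.
Qed.

(** No special functional competes with an average whose length [n] is in [L]:
its length is in [K], hence either much smaller or much larger than [n]. *)
Lemma special_avg y M n k N z F : ris j sigma y M -> L_of j n ->
  K_of j k -> special_functional j sigma (P N) k z ->
  k%:R <= f n \/ `|pairing z (part y n F)| <= f n.
Proof.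
move=> ry Ln Kk zk; have fn := L_big Ln.
have [kn|nk|kn] := ltngtP k n.
- left; apply: le_trans (J_growth hj (K_sub_J Kk) (L_sub_J Ln) kn).
  have k1 : 1 <= k%:R :> R by rewrite ler1n; apply: (J_gt0 hj); exact: K_sub_J.
  have := ler_wpM2l (le_trans ler01 k1) k1; rewrite expr2; lra.
- right; apply: (@le_trans _ _ 4); last by lra.
  apply: (@long_special_part _ _ _ hj hsigma y M n F N k z ry Kk zk).
  apply: le_trans (J_growth hj (L_sub_J Ln) (K_sub_J Kk) nk).
  have : 0 <= n%:R ^+ 2 :> R by rewrite exprn_ge0.
  lra.
- by have := K_L_disjoint hj Kk Ln; rewrite kn eqxx.
Qed.

(** Averages of rapidly increasing sequences are long averages again: cutting
them into [f n] pieces loses only a constant, which the normalization absorbs.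
This allows the construction of rapidly increasing sequences of averages. *)
Lemma averaging_avg y M n : ris j sigma y M -> L_of j n ->
  averaging j sigma (Num.truncn (f n)) (avg n y).
Proof.
move=> ry Ln s /andP[s0 sM] ss; have fn := L_big Ln.
have f0 : 0 < f n by lra.
have nf := log2_le_nat R n.
have n0 : 0 < n%:R :> R by lra.
have sf : (size s)%:R <= f n by rewrite -truncn_ge_nat ?(ltW f0).
have sG := norm_solid j sigma.
have /andP[c0 c1] := avg_coef fn.
have -> : \sum_(E <- s) G (restr E (avg n y)) =
    f n / (129 * n%:R) * \sum_(E <- s) G (part y n E).
  rewrite mulr_sumr; apply: eq_bigr => E _.
  by rewrite /avg restrZ (solidZ sG) ger0_norm // ltW.
have h : \sum_(E <- s) G (part y n E) <=
    64 * (n%:R + (size s)%:R) / f n + (size s)%:R * (n%:R / f n ^+ 2).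
  apply: (@le_trans _ _ (\sum_(E <- s) (64 / f n * nmeet y n (E `&` setT) +
      n%:R / f n ^+ 2))).
    apply: ler_sum => E _; rewrite setIT mulrAC.
    apply: (part_bound_J E ry fn) => k N z F Kk zk.
    exact: (special_avg F ry Ln Kk zk).
  rewrite big_split /= -mulr_sumr big_const_seq count_predT iter_addr_0.
  rewrite -[_ *+ size s]mulr_natl lerD2r mulrAC ler_wpM2r ?invr_ge0 ?(ltW f0) //.
  rewrite ler_wpM2l //; apply: (le_trans (sum_nmeet n setT (ris_block ry) ss)).
  by rewrite lerD2r nmeet_le.
apply: (le_trans (ler_wpM2l (ltW c0) h)).
have -> : f n / (129 * n%:R) * (64 * (n%:R + (size s)%:R) / f n +
      (size s)%:R * (n%:R / f n ^+ 2)) =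
    (64 * (n%:R + (size s)%:R) + (size s)%:R * n%:R / f n) / (129 * n%:R).
  by field; rewrite !gt_eqF.
rewrite ler_pdivrMr ?mulr_gt0 // mul1r.
have h1 : (size s)%:R * n%:R / f n <= n%:R.
  by rewrite ler_pdivrMr // mulrC ler_wpM2l // ltW.
lra.
Qed.

(** The value of the coding function can be made large at will: a vector may be
replaced by its multiples by [p.+1 / p.+2], and the coding function, being
injective, takes infinitely many values on them. *)
Lemma coding_unbounded (s : seq (c00 R)) (Z : c00 R) i (B : nat) : Z i != 0 ->
  successive (rcons s Z) -> (forall z, z \in rcons s Z -> in_Q z) ->
  exists t : R, [/\ 1 / 2 <= t <= 1, in_Q (t *: Z) &
    (B <= sigma (map (@modulus R) (rcons s (t *: Z))))%N].
Proof.
move=> Zi ss sQ.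
pose t p : R := (p.+1%:R / p.+2%:R).
have p2 p : 0 < p.+2%:R :> R by rewrite ltr0n.
have t2 p : 1 / 2 <= t p.
  rewrite /t ler_pdivlMr //; have := ler0n R p.
  by rewrite -[p.+2%:R]natr1 -[p.+1%:R]natr1; lra.
have t1 p : t p <= 1 by rewrite /t ler_pdivrMr // mul1r ler_nat.
have t0 p : 0 < t p by have := t2 p; lra.
have tQ p : in_Q (t p *: Z).
  move=> k; have ZQ : in_Q Z by apply: sQ; rewrite mem_rcons in_cons eqxx.
  have [[q Zq] Z1] := ZQ k; rewrite c00Z; split.
    exists (p.+1%:Q / p.+2%:Q * q).
    by rewrite rmorphM fmorph_div /= !ratr_nat Zq.
  rewrite normrM gtr0_norm // mulr_ile1 //; exact: ltW.
have Qs p : Q_sequences (map (@modulus R) (rcons s (t p *: Z))).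
  apply: Q_sequences_modulus.
  - by case: (s).
  - move: ss; rewrite /successive !map_rcons.
    by rewrite (_ : supp (t p *: Z) = supp Z) //; exact: supp_scale.
  - move=> z; rewrite mem_rcons in_cons => /orP[/eqP ->//|zs].
    by apply: sQ; rewrite mem_rcons in_cons zs orbT.
pose g p := sigma (map (@modulus R) (rcons s (t p *: Z))).
have ginj : injective g.
  move=> p p' gpp; have [sinj _ _] := hsigma.
  have := sinj _ _ (mem_set (Qs p)) (mem_set (Qs p')) gpp.
  rewrite !map_rcons => /(congr1 (last 0)); rewrite !last_rcons.
  move=> /(congr1 (fun z : c00 R => z i)); rewrite !modulusE !c00Z (normrM (t p)) (normrM (t p')).
  have Z0 : `|Z i| != 0 by rewrite normr_eq0.
  move=> /(mulIf Z0); rewrite (gtr0_norm (t0 p)) (gtr0_norm (t0 p')).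
  have tE q : t q = 1 - (q.+2%:R)^-1.
    by rewrite /t; apply: (mulIf (lt0r_neq0 (p2 q)));
      rewrite divfK ?gt_eqF // mulrBl mulVf ?gt_eqF // mul1r -[q.+2%:R]natr1; ring.
  rewrite !tE => /addrI/oppr_inj/invr_inj h.
  apply/succn_inj/succn_inj/eqP; rewrite -(eqr_nat R); exact/eqP.
(* Otherwise [g] would map [B.+1] numbers injectively to [B] values. *)
have [p gp] : exists p, (B <= g p)%N.
  apply: contrapT => /forallNP none.
  have sub : {subset map g (iota 0 B.+1) <= iota 0 B}.
    move=> _ /mapP[p _ ->]; rewrite mem_iota add0n /=.
    by have := none p; move/negP; rewrite -ltnNge.
  have := uniq_leq_size _ sub; rewrite map_inj_uniq // iota_uniq => /(_ isT).
  by rewrite size_map !size_iota ltnn.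
by exists (t p); split => //; rewrite t2 t1.
Qed.

End Averages.

(** * The coding argument *)

Section Incomparability.
Variables (R : realType) (j : nat -> nat) (sigma : seq (c00 R) -> nat).
Hypotheses (hj : admissible_J R j) (hsigma : coding_function j sigma).

Local Notation f n := (log2p1 (n%:R : R)).
Local Notation P := (norm_stage j sigma).
Local Notation G := (gowers_norm j sigma).
Implicit Types (E F A : set nat).

(** A functional of one weight is nearly zero on an average of another
length: if the weight is smaller, the average is not affected by the cutting;
if it is larger, the weight wins against the normalization of the average. *)
Lemma mismatched_weight y M n m N z k F : ris j sigma y M -> L_of j n ->
  range j m -> m != n -> (0 < k)%N -> 4 * k%:R ^+ 2 <= f m ->
  4 * k%:R ^+ 2 <= f n -> Astar (P N) m z ->
  `|pairing z (restr F (avg n y))| <= k%:R ^- 2.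
Proof.
move=> ry Ln Jm mn k0 km kn zm; have sN := stage_solid j sigma N.
have sG := norm_solid j sigma.
have m0 : (0 < m)%N := J_gt0 hj Jm.
have kR : 1 <= k%:R :> R by rewrite ler1n.
have k2 : 0 < k%:R ^+ 2 :> R by rewrite exprn_gt0 //; lra.
have fm0 : 0 < f m by exact: log2_gt0.
have fn := L_big hj Ln; have f0 : 0 < f n by lra.
have nf := log2_le_nat R n.
have n0 : 0 < n%:R :> R by lra.
have [lt|lt|e] := ltngtP m n; last by rewrite e eqxx in mn.
- have [s [sm ss _ le]] := Astar_pairing_le (restr F (avg n y)) sN zm.
  apply: (le_trans le); apply: (@le_trans _ _ ((f m)^-1 * 1)).
    rewrite ler_wpM2l ?invr_ge0 ?(ltW fm0) //.
    apply: (@le_trans _ _ (\sum_(E <- s) G (restr E (restr F (avg n y))))).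
      by apply: ler_sum => E _; exact: stage_le_norm.
    have := averaging_restr F (averaging_avg hj hsigma ry Ln).
    apply => //; rewrite sm m0 /= truncn_ge_nat ?(ltW f0) //.
    have mR : 1 <= m%:R :> R by rewrite ler1n.
    have := J_growth hj Jm (L_sub_J Ln) lt.
    have := ler_wpM2l (le_trans ler01 mR) mR; rewrite expr2; lra.
  by rewrite mulr1 lef_pV2 ?posrE //; lra.
- have -> : restr F (avg n y) = (f n / (129 * n%:R)) *: part y n F.
    by rewrite /avg restrZ.
  rewrite pairingZr normrM.
  have /andP[c0 _] := avg_coef fn; rewrite (gtr0_norm c0).
  have [s [sm ss _ le]] := Astar_pairing_le (part y n F) sN zm.
  have le2 : `|pairing z (part y n F)| <= (f m)^-1 * n%:R + 3.
    apply: (le_trans le).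
    apply: (@le_trans _ _ ((f m)^-1 * \sum_(E <- s) G (restr E (part y n F)))).
      rewrite ler_wpM2l ?invr_ge0 ?(ltW fm0) //.
      by apply: ler_sum => E _; exact: stage_le_norm.
    rewrite -sm in m0 *; apply: (le_trans (weighted_part n F ry m0 ss)).
    by rewrite lerD2r ler_wpM2l ?invr_ge0 ?log2_ge0 // nmeet_le.
  apply: (le_trans (ler_wpM2l (ltW c0) le2)).
  have -> : f n / (129 * n%:R) * ((f m)^-1 * n%:R + 3) =
      (f n / f m + 3 * (f n / n%:R)) / 129.
    by field; rewrite !gt_eqF.
  have [_ _ fe] := length_numeric fn.
  have f1 : 1 <= f n by lra.
  have ff : f n * f n <= n%:R.
    apply: le_trans fe; set e := expR _.
    have e1 : 1 <= e.
      by rewrite /e -[leLHS]expR0 ler_expR divr_ge0 // ln_ge0 //; lra.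
    rewrite (_ : f n ^+ 3 * e = f n * f n * (f n * e)); last by ring.
    have ff0 : 0 <= f n * f n by apply: mulr_ge0; exact: ltW.
    rewrite ler_peMr //; apply: (le_trans f1).
    by rewrite ler_peMr // ltW.
  have h1 : f n / n%:R <= k%:R ^- 2.
    rewrite ler_pdivrMr // ler_pdivlMl //; apply: le_trans ff.
    by rewrite ler_wpM2r ?(ltW f0) //; lra.
  have h2 : f n / f m <= k%:R ^- 2.
    rewrite ler_pdivrMr // ler_pdivlMl //.
    apply: (@le_trans _ _ (n%:R ^+ 2)).
      by rewrite expr2 ler_pM // ?(ltW k2) ?(ltW f0) //; lra.
    apply: le_trans (J_growth hj (L_sub_J Ln) Jm lt).
    have : 0 <= n%:R ^+ 2 :> R by rewrite exprn_ge0.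
    lra.
  have : 0 <= k%:R ^- 2 :> R by rewrite invr_ge0 exprn_ge0.
  lra.
Qed.

Lemma first_failure (Q : nat -> Prop) k :
  exists2 t, (forall i, (i < t)%N -> Q i) & ((t < k)%N -> ~ Q t).
Proof.
elim: k => [|k [t Qt nQt]]; first by exists 0%N.
have [tk|kt] := ltnP t k; first by exists t => // _; exact: nQt.
have [Qk|nQk] := pselect (Q k).
  exists k.+1; last by rewrite ltnn.
  by move=> i; rewrite ltnS leq_eqVlt => /orP[/eqP ->//|ik]; apply/Qt/(leq_trans ik).
by exists k => // i ik; apply/Qt/(leq_trans ik).
Qed.

(** The coding argument. A special functional follows the functionals [Z] up to
some index, where it does not see vectors supported off [A]; at the first
deviation one term is seen at most once; afterwards, by injectivity of the
coding function, all weights are mismatched. *)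
Lemma coding_argument A k (x Z : nat -> c00 R) (n : nat -> nat) N w E :
  K_of j k ->
  (forall l i, Z l i != 0 -> A i) -> (forall l i, x l i != 0 -> ~ A i) ->
  (forall l, Q_sequences (map (@modulus R) (mkseq Z l.+1))) ->
  n 0%N = j k.*2.-1 ->
  (forall l, n l.+1 = sigma (map (@modulus R) (mkseq Z l.+1))) ->
  (forall l l', (l < l')%N -> (n l < n l')%N) ->
  (forall l m N z F, range j m -> m != n l -> 4 * k%:R ^+ 2 <= f m ->
     Astar (P N) m z -> `|pairing z (restr F (x l))| <= k%:R ^- 2) ->
  (forall l, G (x l) <= 1) ->
  special_functional j sigma (P N) k w -> `|pairing w (part x k E)| <= 2.
Proof.
move=> Kk ZA xA ZQ n0 nS nmono pair x1 wk.
have sG := norm_solid j sigma.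
have [s [m [[sk ss] sA mk [m0 mJ mS] wE]]] := special_weights hj hsigma Kk wk.
have k0 : (0 < k)%N by apply: (J_gt0 hj); exact: K_sub_J.
(* [t] is the first index where the functionals deviate from [Z], up to
moduli, if there is one; the weight at [t] is still that of [Z]. *)
have [t teq tne] := first_failure (fun i => modulus (nth 0 s i) = modulus (Z i)) k.
have kR : 1 <= k%:R :> R by rewrite ler1n.
have km2 : 0 <= k%:R ^- 2 :> R by rewrite invr_ge0 exprn_ge0.
have mweight i : (i < k)%N -> 4 * k%:R ^+ 2 <= f (m i) by move=> /mk[].
have meq i : (i <= t)%N -> (i < k)%N -> m i = n i.
  case: i => [|i] it ik; first by rewrite m0 n0.
  have [-> _ _] := mS i ik; rewrite nS; congr (sigma _).
  apply: (@eq_from_nth _ 0); first by rewrite !size_map size_iota size_take sk ik.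
  move=> l; rewrite size_map size_take sk ik => li.
  rewrite (nth_map 0) ?size_take ?sk ?ik // (nth_map 0) ?size_mkseq //.
  by rewrite nth_take // nth_mkseq // teq //; exact: leq_trans li it.
have mne i l : (i < k)%N -> (t <= i)%N -> (i == t) && (l == t) = false -> m i != n l.
  move=> ik; rewrite leq_eqVlt => /orP[/eqP e0|ti].
    rewrite -e0 in ik *; rewrite eqxx /= => lt; rewrite (meq _ (leqnn _) ik); apply/eqP => e.
    have [h|h|h] := ltngtP t l.
    - by have := nmono _ _ h; rewrite e ltnn.
    - by have := nmono _ _ h; rewrite e ltnn.
    - by rewrite h eqxx in lt.
  case: i ik ti => // i ik ti _; have [mE mQ mgt] := mS i ik.
  case: l => [|l]; first by rewrite n0 -m0 gtn_eqF.
  rewrite mE nS; have [sinj _ _] := hsigma.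
  apply/eqP => /(sinj _ _ (mem_set mQ) (mem_set (ZQ l))) e.
  have il : i = l.
    by move/(congr1 size): (e); rewrite !size_map size_take sk ik size_iota => -[].
  apply: (tne (leq_trans ti (ltnW ik))).
  move/(congr1 (fun r => nth 0 r t)): e.
  rewrite (nth_map 0) ?size_take ?sk ?ik // nth_take //.
  by rewrite (nth_map 0) ?size_mkseq -?il // nth_mkseq // -il.
(* Before [t] nothing is seen; at [t] the term of index [t] counts at most 1;
all other pairs of indices are mismatched, and there are at most [k ^ 2]. *)
have term i : (i < k)%N -> `|pairing (nth 0 s i) (part x k E)| <=
    (i == t)%:R + \sum_(l < k) k%:R ^- 2.
  move=> ik; have S0 : 0 <= \sum_(l < k) (k%:R ^- 2 : R) by exact: sumr_ge0.
  have [ti|it] := leqP t i; last first.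
    rewrite eq_pairing ?normr0 ?addr_ge0 // => c.
    have [->|sc] := eqVneq (nth 0 s i c) 0; first by rewrite mul0r.
    have Ac : A c.
      apply: (ZA i); rewrite -normr_eq0 -modulusE -teq // modulusE.
      by rewrite normr_eq0.
    rewrite (_ : part x k E c = 0) ?mulr0 // partE c00_sum big1 // => l _.
    rewrite restrE; case: ifP => // _; apply: contrapT => /eqP xc.
    exact: xA xc Ac.
  rewrite partE pairing_sumr; apply: (le_trans (ler_norm_sum _ _ _)).
  apply: (@le_trans _ _ (\sum_(l < k) (((i == t) && (val l == t))%:R + k%:R ^- 2))).
    apply: ler_sum => l _; case: (boolP ((i == t) && (val l == t))) => h.
      have [mi0 _] := mk i ik.
      apply: (@le_trans _ _ 1); last by rewrite lerDl.
      apply: (le_trans (Astar_dual_ball mi0 (sA i ik) _)).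
      apply: (le_trans (stage_le_norm _ _ _ _)).
      exact: le_trans (solid_restr E _ sG) (x1 l).
    rewrite add0r; apply: (pair l (m i) N) => //; [exact: mJ|..|exact: sA].
    - by apply: mne => //; exact/negbTE.
    - exact: mweight.
  rewrite big_split lerD2r; have [_|_] := eqVneq i t; last first.
    by rewrite big1 //.
  have [tk|kt] := ltnP t k.
    rewrite (bigD1 (Ordinal tk)) //= eqxx big1 ?addr0 // => l.
    by rewrite -val_eqE /= => /negbTE ->.
  rewrite big1 // => l _; case: eqP => // lt.
  by have := ltn_ord l; rewrite lt ltnNge kt.
have rt1 := log2_invsqrt_le1 R k; case/andP: rt1 => rt0 rt1.
rewrite wE pairingZl normrM ger0_norm // pairing_suml (big_nth 0) sk big_mkord.
apply: (@le_trans _ _ (1 * 2)); last by rewrite mul1r.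
apply: ler_pM => //; apply: (le_trans (ler_norm_sum _ _ _)).
apply: (le_trans (ler_sum _ (fun (i : 'I_k) _ => term i (ltn_ord i)))).
rewrite big_split /= !sumr_const !card_ord -mulrnA.
have -> : (k%:R ^- 2 : R) *+ (k * k) = 1.
  by rewrite -[LHS]mulr_natr natrM -expr2 mulVf // gt_eqF // exprn_gt0 //; lra.
rewrite [leRHS](_ : 2 = 1 + 1) // lerD2r.
have [tk|kt] := ltnP t k.
  rewrite (bigD1 (Ordinal tk)) //= eqxx big1 ?addr0 // => l.
  by rewrite -val_eqE /= => /negbTE ->.
rewrite big1 // => l _; case: eqP => // lt.
by have := ltn_ord l; rewrite lt ltnNge kt.
Qed.

End Incomparability.

(** * Combinations large on a set and small off it *)

Section UnbalancedCombination.
Variables (R : realType) (j : nat -> nat) (sigma : seq (c00 R) -> nat).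
Hypotheses (hj : admissible_J R j) (hsigma : coding_function j sigma).

Local Notation f n := (log2p1 (n%:R : R)).
Local Notation P := (norm_stage j sigma).
Local Notation G := (gowers_norm j sigma).
Implicit Types (E F : set nat).

Lemma take_mkseq (T : Type) (Z : nat -> T) i n : (i <= n)%N ->
  take i (mkseq Z n) = mkseq Z i.
Proof.
by move=> le; rewrite /mkseq -map_take take_iota; congr (map _ (iota _ _)); apply/minn_idPl.
Qed.

(** The vectors constructed are combinations of averages; they are rewritten as
combinations of the original sequence, because it is for the terms of the latter
that approximants in a given subspace are known. *)
Lemma flatten_combination (y : nat -> c00 R) (b : nat -> R) (n q : nat -> nat) k :
  q 0%N = 0%N -> (forall i, q i.+1 = (q i + n i)%N) ->
  (forall i, `|b i| <= 1) ->
  exists2 al : nat -> R, (forall l, `|al l| <= 1) &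
    \sum_(i < k) b i *: \sum_(l < n i) y (q i + l)%N =
    \sum_(l < q k) al l *: y l.
Proof.
move=> q0 qS b1; elim: k => [|k [al al1 IH]].
  by exists (fun=> 0); rewrite ?normr0 // big_ord0 q0 big_ord0.
exists (fun l => if (l < q k)%N then al l else b k).
  by move=> l; case: ifP.
rewrite big_ord_recr /= IH qS big_split_ord /=; congr (_ + _).
  by apply: eq_bigr => l _; rewrite ltn_ord.
rewrite scaler_sumr; apply: eq_bigr => l _.
by rewrite ltnNge leq_addr.
Qed.

Section Construction.
Variables (A : set nat) (y : nat -> c00 R) (M : nat -> nat) (c : R) (k : nat).
Hypotheses (ry : ris j sigma y M) (c0 : 0 < c).
Hypotheses (yc : forall l, c <= G (restr A (y l))).
Hypotheses (Kk : K_of j k).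

(* After the functionals [s] have been chosen, [len s] is the weight that the
coding function prescribes for the next one and the length of the average to be
matched with it, and [start s] the first term of this average. *)
Let len (s : seq (c00 R)) : nat :=
  if s is [::] then j k.*2.-1 else sigma (map (@modulus R) s).
Let start (s : seq (c00 R)) : nat := \sum_(i < size s) len (take i s).
Let average s : c00 R := avg (len s) (fun l => y (start s + l)%N).

Let matched (s : seq (c00 R)) (Z : c00 R) : Prop :=
  [/\ in_Q Z, (exists N, Astar (P N) (len s) Z),
      (forall i, Z i != 0 -> A i /\
         exists2 l, (start s <= l < start s + len s)%N & y l i != 0) &
      c / 516 <= pairing Z (average s)].

Let matched_seq (s : seq (c00 R)) : Prop :=
  forall i, (i < size s)%N -> matched (take i s) (nth 0 s i).

Lemma matched_neq0 s Z : matched s Z -> exists i, Z i != 0.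
Proof.
move=> [_ _ _ h]; apply: contrapT => none.
have Z0 : Z = 0.
  by apply: c00P => i; apply: contrapT => /eqP Zi; apply: none; exists i.
by move: h; rewrite Z0 pairing0l leNgt divr_gt0.
Qed.

Lemma start_take s i i' : (i < i')%N -> (i' <= size s)%N ->
  (start (take i s) + len (take i s) <= start (take i' s))%N.
Proof.
move=> ii' is'; rewrite /start.
have sz h : (h <= size s)%N -> size (take h s) = h by move=> hs; rewrite size_takel.
rewrite !sz //; last exact/ltnW/(leq_trans ii').
have -> : (\sum_(h < i) len (take h (take i s)) = \sum_(h < i) len (take h s))%N.
  by apply: eq_bigr => h _; rewrite take_takel // ltnW.
have -> : (\sum_(h < i') len (take h (take i' s)) = \sum_(h < i') len (take h s))%N.
  by apply: eq_bigr => h _; rewrite take_takel // ltnW.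
by rewrite -(subnKC ii') big_split_ord big_ord_recr /= leq_addr.
Qed.

Lemma matched_seq_successive s : matched_seq s -> successive s.
Proof.
move=> ms; have block := ris_block ry.
have nthE i : (i < size s)%N -> nth set0 (map (@supp R) s) i = supp (nth 0 s i).
  by move=> h; rewrite (nth_map 0).
split=> i; rewrite size_map => h; first by rewrite nthE //; exact: (matched_neq0 (ms i h)).
rewrite !nthE ?(ltnW h) // => a b sa sb.
have [_ _ /(_ a sa)[_ [l /andP[_ ll] yl]] _] := ms i (ltnW h).
have [_ _ /(_ b sb)[_ [l' /andP[ll' _] yl']] _] := ms i.+1 h.
apply: block yl yl'; apply: leq_trans ll _; apply: leq_trans ll'.
exact: (start_take (ltnSn i) (ltnW h)).
Qed.

Lemma matched_seq_in_Q s z : matched_seq s -> z \in s -> in_Q z.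
Proof. by move=> ms /(nthP 0)[i h <-]; have [] := ms i h. Qed.

Lemma len_L s : matched_seq s -> L_of j (len s).
Proof.
case: s => [_|z s ms].
  by apply: first_weight_L; apply: (J_gt0 hj); exact: K_sub_J.
have [_ sL _] := hsigma; apply/sL/Q_sequences_modulus => //.
- exact: matched_seq_successive.
- by move=> w; exact: matched_seq_in_Q.
Qed.

Lemma matched_seq_rcons s Z : matched_seq s -> matched s Z ->
  matched_seq (rcons s Z).
Proof.
move=> ms mZ i; rewrite size_rcons ltnS leq_eqVlt => /orP[/eqP ->|h].
  by rewrite nth_rcons ltnn eqxx -cats1 take_cat ltnn subnn cats0.
by rewrite nth_rcons h -cats1 takel_cat ?(ltnW h) //; exact: ms.
Qed.

(** The next functional: it norms the next average on [A], and is rescaled so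
that the weight it prescribes for its successor is large enough for the averages
to form a rapidly increasing sequence. *)
Lemma matched_exists s : matched_seq s ->
  exists Z, matched s Z /\ 2 ^+ size s * l1 (average s) <=
    Num.sqrt (f (Num.truncn (f (sigma (map (@modulus R) (rcons s Z)))))).
Proof.
move=> ms; have Ln := len_L ms; have fn := L_big hj Ln.
have n0 : (0 < len s)%N by apply: (J_gt0 hj); exact: L_sub_J.
have nR : 0 < (len s)%:R :> R by rewrite ltr0n.
have f0 : 0 < f (len s) by exact: log2_gt0.
have := matching_functional (ris_block (ris_shift (start s) ry)) c0 n0
  (fun l => yc (start s + l)%N).
move=> [Z0 [N [Z0Q Z0A Z0s Z0p]]].
have val t : pairing (t *: Z0) (average s) =
    t * (f (len s) / (129 * (len s)%:R) *
         pairing Z0 (\sum_(l < len s) y (start s + l)%N)).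
  by rewrite pairingZl pairingZr.
have low : c / 258 <= f (len s) / (129 * (len s)%:R) *
    pairing Z0 (\sum_(l < len s) y (start s + l)%N).
  have /andP[d0 _] := avg_coef fn.
  apply: le_trans (ler_wpM2l (ltW d0) Z0p).
  rewrite le_eqVlt; apply/orP; left; apply/eqP; field.
  by rewrite !gt_eqF.
have good t : 1 / 2 <= t <= 1 -> in_Q (t *: Z0) -> matched s (t *: Z0).
  move=> /andP[t2 t1] tQ; have t0 : 0 < t by lra.
  split => //.
  - by exists N; apply: Astar_scale => //; [exact: stage_solid|rewrite t0].
  - move=> i; rewrite c00Z mulf_eq0 (gt_eqF t0) => /Z0s[Ai [l ln yl]]; split => //.
    by exists (start s + l)%N => //; rewrite leq_addr ltn_add2l.
  - rewrite val (_ : c / 516 = 1 / 2 * (c / 258)); last by field.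
    by apply: ler_pM => //; rewrite divr_ge0 // ltW.
have mZ0 : matched s Z0.
  by rewrite -[Z0]scale1r; apply: good; rewrite ?scale1r //; lra.
have ms0 := matched_seq_rcons ms mZ0.
have [i Z0i] := matched_neq0 mZ0.
have [m hm] := log2_unbounded ((2 ^+ size s * l1 (average s)) ^+ 2).
have [B hB] := log2_unbounded (m%:R : R).
have [t [t12 tQ Bt]] := coding_unbounded hsigma B Z0i
  (matched_seq_successive ms0) (fun z => @matched_seq_in_Q _ z ms0).
exists (t *: Z0); split; first exact: good.
rewrite -[leLHS]ger0_norm ?mulr_ge0 ?exprn_ge0 ?l1_ge0 // -sqrtr_sqr.
apply: ler_wsqrtr; apply: hm; rewrite truncn_ge_nat ?log2_ge0 //.
exact: hB.
Qed.

(** One long special sequence: on the coordinates in [A] the special functional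
built along with the averages norms their sum, off [A] it cannot act, and the
upper estimate applies. *)
Lemma special_combination : 512 ^+ 2 <= f k ->
  exists (L : nat) (al : nat -> R) (z : c00 R),
    [/\ forall (l : nat), `|al l| <= 1, z = \sum_(l < L) al l *: y l,
        G (restr (~` A) z) <= 65 * k%:R / f k &
        c / 516 * k%:R / Num.sqrt (f k) <= G (restr A z)].
Proof.
move=> fk; have sG := norm_solid j sigma.
have k0 : (0 < k)%N by apply: (J_gt0 hj); exact: K_sub_J.
have kR : 1 <= k%:R :> R by rewrite ler1n.
have fk0 : 0 < f k by exact: log2_gt0.
have [Z ZP] := @dep_choice (c00 R) 0 (fun s Z => matched s Z /\
    2 ^+ size s * l1 (average s) <=
    Num.sqrt (f (Num.truncn (f (sigma (map (@modulus R) (rcons s Z)))))))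
  (fun s h => matched_exists (fun i hi => (h i hi).1)).
have ms m : matched_seq (mkseq Z m).
  move=> i; rewrite size_mkseq => im; rewrite take_mkseq ?(ltnW im) // nth_mkseq //.
  exact: (ZP i).1.
pose n i := len (mkseq Z i).
pose q i := start (mkseq Z i).
pose a i := average (mkseq Z i).
pose x i := restr (~` A) (a i).
have q0 : q 0%N = 0%N by rewrite /q /start big_ord0.
have qS i : q i.+1 = (q i + n i)%N.
  rewrite /q /start !size_mkseq big_ord_recr /= take_mkseq //; congr (_ + _)%N.
  apply: eq_bigr => h _; have hi := ltn_ord h.
  by rewrite !take_mkseq ?(ltnW hi) // ltnW // ltnW.
have Ln i : L_of j (n i) by exact: (len_L (ms i)).
have fn i : 512 ^+ 2 <= f (n i) by exact: (L_big hj (Ln i)).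
have nS i : n i.+1 = sigma (map (@modulus R) (mkseq Z i.+1)).
  by rewrite /n /len; case E: (mkseq Z i.+1) => //; have := size_mkseq Z i.+1; rewrite E.
have succ m := matched_seq_successive (ms m).
have inQ m z : z \in mkseq Z m -> in_Q z by exact: (matched_seq_in_Q (ms m)).
have nlt i : (n i < n i.+1)%N.
  rewrite nS; have [[_ [N ZA] _ _] _] := ZP i.
  apply: (coding_gt hj hsigma (stage_solid j sigma N) _ (succ _) (@inQ _) _ ZA).
    by apply: (J_gt0 hj); exact: (L_sub_J (Ln i)).
  by apply/mapP; exists i => //; rewrite mem_iota add0n leqnn.
have nmono l l' : (l < l')%N -> (n l < n l')%N.
  elim: l' => // l' IH; rewrite ltnS leq_eqVlt => /orP[/eqP ->//|/IH h].
  exact: (ltn_trans h (nlt l')).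
have qmono l l' : (l < l')%N -> (q l + n l <= q l')%N.
  elim: l' => // l' IH; rewrite ltnS leq_eqVlt => /orP[/eqP ->|/IH h].
    by rewrite qS.
  by rewrite qS; apply: leq_trans h (leq_addr _ _).
have rshift i := ris_shift (q i) ry.
have aE i : a i = avg (n i) (fun l => y (q i + l)%N) by [].
have asupp i t : a i t != 0 -> exists2 l, (q i <= l < q i + n i)%N & y l t != 0.
  rewrite aE c00Z mulf_eq0 negb_or => /andP[_]; rewrite c00_sum => h.
  apply: contrapT => none; move/eqP: h; apply; apply: big1 => l _.
  apply: contrapT => /eqP yl; apply: none; exists (q i + l)%N => //.
  by rewrite leq_addr ltn_add2l /=.
have ablock : block_seq a.
  move=> l l' i i' ll' /asupp[h /andP[_ hl] yh] /asupp[h' /andP[hl' _] yh'].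
  apply: (ris_block ry _ yh yh'); apply: leq_trans hl _.
  exact: (leq_trans (qmono _ _ ll') hl').
(* The parts off [A] of the averages form a rapidly increasing sequence, on
which no special functional can be large: those of another length by growth of
the lengths, those of length [k] by the coding argument. *)
have rx : ris j sigma x (fun i => Num.truncn (f (n i))).
  split.
  - exact: (block_seq_restr ablock).
  - by move=> i; apply: averaging_restr; exact: (averaging_avg hj hsigma (rshift i) (Ln i)).
  - by move=> i; rewrite truncn_gt0; apply: le_trans (fn i); lra.
  - move=> l l'; rewrite leq_eqVlt => /orP[/eqP ->//|/nmono/ltnW h].
    exact/le_truncn/log2_mono.
  - move=> i; have [_] := ZP i; rewrite size_mkseq -mkseqS -nS => h.
    by apply: le_trans h; rewrite ler_wpM2l ?exprn_ge0 //; exact/l1_dom/dom_restr.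
have xA l i : x l i != 0 -> ~ A i.
  by rewrite restrE; case: ifP => [|_ /eqP//]; rewrite inE.
have ZA l i : Z l i != 0 -> A i by have [[_ _ h _] _] := ZP l => /h[].
have km l : 4 * k%:R ^+ 2 <= f (n l).
  apply: (J_growth hj (K_sub_J Kk) (L_sub_J (Ln l))).
  apply: (leq_trans (K_lt_first_weight hj Kk)).
  have -> : j k.*2.-1 = n 0%N by [].
  by case: l => // l; apply: ltnW; exact: nmono.
have up : G (part x k setT) <= 65 * k%:R / f k.
  have Hsp k' N w F : K_of j k' -> special_functional j sigma (P N) k' w ->
      k'%:R <= f k \/ `|pairing w (part x k F)| <= f k.
    move=> Kk' wk'; have [lt|lt|e] := ltngtP k' k.
    - left; apply: le_trans (J_growth hj (K_sub_J Kk') (K_sub_J Kk) lt).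
      have k1 : 1 <= k'%:R :> R by rewrite ler1n; apply: (J_gt0 hj); exact: K_sub_J.
      have := ler_wpM2l (le_trans ler01 k1) k1; rewrite expr2; lra.
    - right; apply: (@le_trans _ _ 4); last by lra.
      apply: (@long_special_part _ _ _ hj hsigma x _ k F N k' w rx Kk' wk').
      apply: le_trans (J_growth hj (K_sub_J Kk) (K_sub_J Kk') lt).
      have : 0 <= k%:R ^+ 2 :> R by rewrite exprn_ge0.
      lra.
    - right; apply: (@le_trans _ _ 2); last by lra.
      rewrite e in wk'.
      apply: (coding_argument hj hsigma F Kk ZA xA _ _ nS nmono _ _ wk') => //.
      + move=> l; apply: Q_sequences_modulus; [|exact: succ|exact: inQ].
        by rewrite -size_eq0 size_mkseq.
      + move=> l m N' z F' Jm mn kfm zm; rewrite /x restrI aE.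
        exact: (mismatched_weight hj hsigma _ (rshift l) (Ln l) Jm mn k0 kfm (km l) zm).
      + by move=> l; exact: (ris_norm l rx).
  apply: (le_trans (part_bound_J hj hsigma setT rx fk Hsp)).
  have h1 : 64 * nmeet x k setT / f k <= 64 * (k%:R / f k).
    by rewrite -mulrA ler_wpM2l // ler_wpM2r ?invr_ge0 ?(ltW fk0) // nmeet_le.
  have h2 : k%:R / f k ^+ 2 <= k%:R / f k.
    rewrite ler_wpM2l // lef_pV2 ?posrE ?exprn_gt0 // expr2 ler_peMr ?(ltW fk0) //.
    lra.
  by rewrite -mulrA; lra.
have /choice[NN NNP] i : exists N, Astar (P N) (n i) (Z i).
  by have [[_ h _ _] _] := ZP i.
pose N := \max_(i < k) NN i.
have ZAst i : (i < k)%N -> Astar (P N) (n i) (Z i).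
  move=> ik; apply: Astar_mono (NNP i); [exact: stage_solid|exact: stage_solid|].
  move=> w; apply: stage_le.
  exact: (@leq_bigmax _ (fun l : 'I_k => NN l) (Ordinal ik)).
pose phi := (Num.sqrt (f k))^-1 *: \sum_(z <- mkseq Z k) z.
have phiS : special_functional j sigma (P N) k phi.
  exists (mkseq Z k); split => //.
  - by rewrite size_mkseq.
  - exact: inQ.
  - by rewrite nth_mkseq //; exact: (ZAst 0%N).
  - move=> i ik; rewrite take_mkseq ?(ltnW ik) // nth_mkseq // -nS; exact: ZAst.
have sumE (u : c00 R) : pairing phi u = (Num.sqrt (f k))^-1 * \sum_(i < k) pairing (Z i) u.
  rewrite pairingZl pairing_suml big_map; congr (_ * _).
  by rewrite (_ : iota 0 k = index_iota 0 k) ?big_mkord // /index_iota subn0.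
pose z := \sum_(i < k) a i.
have low : c / 516 * k%:R / Num.sqrt (f k) <= G (restr A z).
  apply: le_trans (norm_special (restr A z) Kk phiS).
  rewrite -pairing_restr (_ : restr A phi = phi); last first.
    apply: restr_id => t; rewrite c00Z mulf_eq0 negb_or => /andP[_].
    move=> /(@supp_sum_successive R (mkseq Z k) t)[i].
    rewrite size_map size_mkseq => ik; rewrite (nth_map 0) ?size_mkseq // nth_mkseq //.
    exact: ZA.
  rewrite sumE; apply: le_trans (ler_norm _).
  rewrite mulrC ler_wpM2l ?invr_ge0 ?sqrtr_ge0 //.
  have diag i : (i < k)%N -> c / 516 <= pairing (Z i) z.
    move=> ik; rewrite pairing_sumr (bigD1 (Ordinal ik)) //= big1 ?addr0.
      by have [[]] := ZP i.
    move=> i' ii'; apply: eq_pairing => t.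
    have [->|Zt] := eqVneq (Z i t) 0; first by rewrite mul0r.
    have [->|/asupp[l' /andP[l1' l2'] yl']] := eqVneq (a i' t) 0.
      by rewrite mulr0.
    have [[_ _ /(_ t Zt)[_ [l /andP[l1 l2] yl]] _] _] := ZP i.
    have [lt|lt|e] := ltngtP i i'.
    + have h := qmono _ _ lt.
      have := ris_block ry (leq_trans l2 (leq_trans h l1')) yl yl'.
      by rewrite ltnn.
    + have h := qmono _ _ lt.
      have := ris_block ry (leq_trans l2' (leq_trans h l1)) yl' yl.
      by rewrite ltnn.
    + by move: ii'; rewrite -val_eqE /= e eqxx.
  apply: (@le_trans _ _ (\sum_(i < k) (c / 516))).
    by rewrite sumr_const card_ord -[leRHS]mulr_natr.
  by apply: ler_sum => i _; exact: diag.
have b1 i : `|f (n i) / (129 * (n i)%:R)| <= 1.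
  by have /andP[h0 h1] := avg_coef (fn i); rewrite gtr0_norm.
have [al al1 alE] := flatten_combination y k q0 qS b1.
exists (q k), al, z; split => //.
suff -> : restr (~` A) z = part x k setT by [].
by rewrite partE restr_sum; apply: eq_bigr => i _; rewrite restrT.
Qed.

End Construction.

(** A rapidly increasing sequence not negligible on [A] has combinations that
are large on [A] and small off [A]: by the previous lemma with [k] large, their
norms there are of the orders [k / sqrt (f k)] and [k / f k]. *)
Lemma unbalanced_combination A y M (c e : R) : ris j sigma y M -> 0 < c ->
  (forall l, c <= G (restr A (y l))) -> 0 < e ->
  exists (L : nat) (al : nat -> R),
    [/\ forall l : nat, `|al l| <= 1,
        G (restr (~` A) (\sum_(l < L) al l *: y l)) <= e &
        1 <= G (restr A (\sum_(l < L) al l *: y l))].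
Proof.
move=> ry c0 yc e0; have sG := norm_solid j sigma.
pose d := c / 516; have d0 : 0 < d by rewrite divr_gt0.
(* The three lower bounds for [f k] serve the previous lemma, the bound of the
coefficients after normalization, and the smallness off [A]. *)
pose B := Num.max (512 ^+ 2) (Num.max (d^-1 ^+ 2) ((65 / (d * e)) ^+ 2)).
have [m hm] := log2_unbounded B.
pose k := j m.*2.
have Kk : K_of j k by exists m.
have fB : B <= f k.
  by apply/hm/(leq_trans _ (j_ge_id hj _)); rewrite -addnn leq_addr.
move: fB; rewrite !ge_max => /and3P[fk fd fde].
have k0 : (0 < k)%N by apply: (J_gt0 hj); exact: (K_sub_J Kk).
have kR : 0 < k%:R :> R by rewrite ltr0n.
have fk0 : 0 < f k by exact: log2_gt0.
have [L [al [z [al1 zE up low]]]] := special_combination ry c0 yc Kk fk.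
set r := Num.sqrt (f k) in low.
have r0 : 0 < r by rewrite sqrtr_gt0.
have rr : r * r = f k by rewrite -expr2 sqr_sqrtr // ltW.
have rd : d^-1 <= r.
  rewrite -[leLHS]ger0_norm ?invr_ge0 ?(ltW d0) // -sqrtr_sqr.
  exact: ler_wsqrtr.
have de0 : 0 < 65 / (d * e) by rewrite divr_gt0 // mulr_gt0.
have rde : 65 / (d * e) <= r.
  by rewrite -[leLHS]gtr0_norm // -sqrtr_sqr; exact: ler_wsqrtr.
pose la := r / (d * k%:R).
have dk0 : 0 < d * k%:R by rewrite mulr_gt0.
have la0 : 0 < la by rewrite divr_gt0.
have la1 : la <= 1.
  rewrite ler_pdivrMr // mul1r.
  apply: (@le_trans _ _ (d * (r * r))).
    rewrite mulrA ler_peMl ?(ltW r0) //.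
    by have := ler_wpM2l (ltW d0) rd; rewrite mulfV // gt_eqF.
  by rewrite ler_wpM2l ?(ltW d0) // rr log2_le_nat.
exists L, (fun l => la * al l).
have -> : \sum_(l < L) (la * al l) *: y l = la *: z.
  by rewrite zE scaler_sumr; apply: eq_bigr => l _; rewrite scalerA.
split.
- by move=> l; rewrite normrM gtr0_norm // mulr_ile1 // ltW.
- rewrite restrZ (solidZ sG) gtr0_norm //.
  apply: (le_trans (ler_wpM2l (ltW la0) up)).
  have -> : la * (65 * k%:R / f k) = 65 / d * r^-1.
    by rewrite -rr /la; field; rewrite !gt_eqF.
  rewrite ler_pdivrMr // -ler_pdivrMl //; apply: le_trans rde.
  by rewrite le_eqVlt; apply/orP; left; apply/eqP; field; rewrite !gt_eqF.
- rewrite restrZ (solidZ sG) gtr0_norm //.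
  apply: le_trans (ler_wpM2l (ltW la0) low).
  rewrite le_eqVlt; apply/orP; left; apply/eqP; rewrite -/d /la; field.
  by rewrite !gt_eqF.
Qed.

End UnbalancedCombination.

(** * A random matrix with many scales *)

Section RandomSigns.
Variables (R : realType) (I : finType).
Local Notation S := {ffun I -> bool}.

Lemma sum_sign_pair (i k : I) : i != k ->
  \sum_(e : S) (-1) ^+ e i * (-1) ^+ e k = 0 :> R.
Proof.
move=> ik; pose flip (e : S) : S := [ffun h => if h == i then ~~ e h else e h].
have flipK : involutive flip.
  by move=> e; apply/ffunP => h; rewrite !ffunE; case: eqP => // _; rewrite negbK.
set X := \sum_(e : S) _; suff : X = - X by lra.
rewrite {1}/X (reindex_inj (inv_inj flipK)) -sumrN; apply: eq_bigr => e _ /=.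
rewrite !ffunE eqxx eq_sym (negbTE ik) -mulNr; congr (_ * _).
by case: (e i); rewrite /= ?expr0 ?expr1 ?opprK.
Qed.

(** Orthogonality of the signs. *)
Lemma second_moment (b : I -> R) :
  \sum_(e : S) (\sum_i (-1) ^+ e i * b i) ^+ 2 = #|S|%:R * \sum_i b i ^+ 2.
Proof.
have sq (e : S) : (\sum_i (-1) ^+ e i * b i) ^+ 2 =
    \sum_i \sum_k (b i * b k) * ((-1) ^+ e i * (-1) ^+ e k).
  rewrite expr2 mulr_suml; apply: eq_bigr => i _; rewrite mulr_sumr.
  by apply: eq_bigr => k _; ring.
under eq_bigr do rewrite sq.
rewrite exchange_big mulr_sumr; apply: eq_bigr => i _.
rewrite exchange_big (bigD1 i) //= [X in _ + X]big1 => [|k ki]; last first.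
  by rewrite -mulr_sumr sum_sign_pair ?mulr0 // eq_sym.
rewrite addr0 -mulr_sumr (eq_bigr (fun=> 1)) => [|e _].
  by rewrite sumr_const -expr2 mulrC.
by rewrite -expr2 sqrr_sign.
Qed.

End RandomSigns.

Section ScaleSums.
Variable R : realType.

Lemma sum_scales_below (x : R) m : 0 <= x ->
  \sum_(s < m) (2 ^+ s < x)%R%:R * 2 ^+ s <= 2 * x :> R.
Proof.
move=> x0; suff : \sum_(s < m) (2 ^+ s < x)%R%:R * 2 ^+ s <= Num.min (2 ^+ m) (2 * x).
  by rewrite le_min => /andP[].
elim: m => [|m IH]; first by rewrite big_ord0 le_min exprn_ge0 // mulr_ge0.
rewrite big_ord_recr /=; move: IH; rewrite !le_min => /andP[h1 h2].
have p0 : 0 <= 2 ^+ m :> R by rewrite exprn_ge0.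
by rewrite exprS; case: ltP => h; rewrite ?mul1r ?mul0r; apply/andP; split; lra.
Qed.

Lemma sum_scales_above (x : R) m : 0 <= x ->
  \sum_(s < m) (x <= 2 ^+ s)%R%:R * (x ^+ 2 * 2 ^- s) <= 2 * x :> R.
Proof.
move=> x0; pose F (s : nat) : R := (x <= 2 ^+ s)%R%:R * (x ^+ 2 * 2 ^- s).
suff : \sum_(s < m) F s + (x <= 2 ^+ m)%R%:R * (x ^+ 2 * (2 * 2 ^- m)) <= 2 * x.
  apply: le_trans; rewrite lerDl.
  have h : 0 <= 2 * 2 ^- m :> R by rewrite mulr_ge0 ?invr_ge0 ?exprn_ge0.
  by rewrite mulr_ge0 // mulr_ge0 // exprn_ge0.
elim: m => [|m IH].
  rewrite big_ord0 add0r expr0 invr1 mulr1; case: (leP x 1) => h; rewrite ?mul1r ?mul0r; last first.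
    by rewrite mulr_ge0.
  by rewrite mulrC ler_wpM2l // expr2 ler_piMr.
rewrite big_ord_recr /=; set S := \sum_(s < m) F s in IH *.
have p0 : 0 < 2 ^+ m :> R by rewrite exprn_gt0.
have v : 2 * 2 ^- m.+1 = 2 ^- m :> R by rewrite exprS invfM mulrA divff ?mul1r.
rewrite v /F; move: IH; case: (leP x (2 ^+ m)) => h.
  have -> : x <= 2 ^+ m.+1 by apply: (le_trans h); rewrite exprS ler_peMl //; lra.
  rewrite !mul1r; lra.
rewrite !mul0r !addr0 => _.
have -> : S = 0.
  apply: big1 => s _; rewrite /F lt_geF ?mul0r //; apply: le_lt_trans h.
  by rewrite ler_weXn2l //; [lra|exact: ltnW].
rewrite add0r; case: (leP x (2 ^+ m.+1)) => h'; rewrite ?mul0r ?mul1r; last by rewrite mulr_ge0.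
rewrite expr2 -mulrA mulrC ler_wpM2r // ler_pdivrMr //.
by rewrite -exprS.
Qed.

End ScaleSums.

Section SpreadMatrix.
Variables (R : realType) (p M m : nat).
Hypotheses (m0 : (0 < m)%N) (mM : (m <= M)%N) (Mp : (2 ^ M <= p)%N).

Local Notation I := 'I_p.+1.
Local Notation S := {ffun I -> bool}.
Local Notation Om' := ('I_M * I * S)%type.
Local Notation Om := (I * 'I_m + Om')%type.

Let W : R := #|{: Om'}|%:R.
Let p1 : R := p.+1%:R.

(** Cyclic windows: every index lies in exactly [2 ^ s] windows of scale [s]. *)
Definition window (s : nat) (c i : I) : bool := ((i - c)%R < 2 ^ s)%N.

(** The [i]-th row on the windows: random signs on the windows containing [i],
of a size making the average over [i] of the moduli independent of the window. *)
Definition fluct (i : I) (om : Om') : R :=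
  let: (s, c, e) := om in
  (window s c i)%:R * (-1) ^+ e i * (p1 / 2 ^+ s / (4 * W)).

(** The [m] columns attached to [i] are for the lower bound of combinations of
the rows; the other columns carry [spread_w]. *)
Definition spread_v (i : I) (om : Om) : R := match om with
  | inl (i', _) => (i' == i)%:R / (4 * m%:R)
  | inr om' => fluct i om' end.

Definition spread_w (om : Om) : R := match om with
  | inl _ => 0 | inr _ => (4 * W)^-1 end.

Lemma M_gt0 : (0 < M)%N. Proof. exact: leq_trans m0 mM. Qed.

Lemma card_S_gt0 : 0 < #|{: S}|%:R :> R.
Proof. by rewrite ltr0n; apply/card_gt0P; exists [ffun=> true]. Qed.

Lemma W_E : W = M%:R * p1 * #|{: S}|%:R.
Proof. by rewrite /W !card_prod !card_ord !natrM. Qed.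

Lemma p1_gt0 : 0 < p1. Proof. by rewrite ltr0n. Qed.

Lemma W_gt0 : 0 < W.
Proof. by rewrite W_E !mulr_gt0 ?card_S_gt0 ?p1_gt0 // ltr0n M_gt0. Qed.

Lemma sum_window_i (s : 'I_M) (c : I) : \sum_(i : I) (window s c i)%:R = 2 ^+ s :> R.
Proof.
rewrite (reindex_inj (addIr c)) /=.
rewrite (eq_bigr (fun i : I => if (i < 2 ^ s)%N then 1 else 0)); last first.
  by move=> i _; rewrite /window addrK; case: ltnP.
rewrite -big_mkcond /=.
have sp : (2 ^ s <= p.+1)%N.
  by apply/leqW/(leq_trans _ Mp); rewrite leq_exp2l // ltnW.
have := @big_ord_widen R 0 +%R _ p.+1 (fun=> 1) sp; rewrite sumr_const card_ord.
by rewrite natrX => /esym.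
Qed.

Lemma sum_window_c (s : 'I_M) (i : I) : \sum_(c : I) (window s c i)%:R = 2 ^+ s :> R.
Proof.
rewrite -(sum_window_i s 0) (reindex_inj (inv_inj (fun x => subKr i x))) /=.
by apply: eq_bigr => c _; rewrite /window subr0 subKr.
Qed.

Lemma sum_Om' (F : Om' -> R) :
  \sum_om F om = \sum_s \sum_c \sum_e F (s, c, e).
Proof.
rewrite (pair_bigA _ (fun s c => \sum_e F (s, c, e))) /=.
rewrite (pair_bigA _ (fun sc e => F (sc.1, sc.2, e))) /=.
by apply: eq_bigr => -[[s c] e] _.
Qed.

Lemma sum_Om (F : Om -> R) :
  \sum_om F om = \sum_i \sum_(q < m) F (inl (i, q)) + \sum_om F (inr om).
Proof.
rewrite big_sumType /=; congr (_ + _).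
rewrite (pair_bigA _ (fun i q => F (inl (i, q)))) /=.
by apply: eq_bigr => -[i q] _.
Qed.

Lemma norm_fluct i s c e :
  `|fluct i (s, c, e)| = (window s c i)%:R * (p1 / 2 ^+ s / (4 * W)).
Proof.
rewrite /fluct normrM normrM normrX normrN1 expr1n mulr1 normr_nat.
rewrite ger0_norm // divr_ge0 ?divr_ge0 ?exprn_ge0 ?mulr_ge0 ?(ltW W_gt0) //.
Qed.

Lemma sum_fluct i : \sum_om `|fluct i om| = 1 / 4.
Proof.
rewrite sum_Om'; have W0 := W_gt0; have P0 := p1_gt0; have S0 := card_S_gt0.
transitivity (\sum_(s < M) (p1 / (4 * W) * #|{: S}|%:R)).
  apply: eq_bigr => s _; have s0 : 0 < 2 ^+ s :> R by rewrite exprn_gt0.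
  transitivity (\sum_(c : I) (window s c i)%:R * (p1 / 2 ^+ s / (4 * W) * #|{: S}|%:R)).
    apply: eq_bigr => c _; under eq_bigr do rewrite norm_fluct.
    by rewrite sumr_const -[LHS]mulr_natr -mulrA.
  rewrite -mulr_suml sum_window_c.
  by field; rewrite !gt_eqF.
rewrite sumr_const card_ord -[LHS]mulr_natr W_E.
field; rewrite !gt_eqF // ltr0n; exact: M_gt0.
Qed.

Lemma spread_v_sum i : \sum_om `|spread_v i om| = 1 / 2.
Proof.
have mR : 0 < m%:R :> R by rewrite ltr0n.
rewrite sum_Om /= sum_fluct.
have -> : \sum_i' \sum_(q < m) `|(i' == i)%:R / (4 * m%:R)| = 1 / 4 :> R.
  rewrite (bigD1 i) //= [X in _ + X]big1 => [|i' /negbTE ->]; last first.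
    by rewrite big1 // => q _; rewrite mul0r normr0.
  rewrite addr0 eqxx sumr_const card_ord -[LHS]mulr_natr ger0_norm; last first.
    by rewrite divr_ge0 // mulr_ge0.
  by rewrite mulr1n; field; rewrite gt_eqF.
by field.
Qed.

Lemma inv4m_ge (om : Om) : (4 * W)^-1 * p1 <= (4 * m%:R)^-1.
Proof.
have mR : 0 < m%:R :> R by rewrite ltr0n.
have W0 := W_gt0; have P0 := p1_gt0.
rewrite mulrC ler_pdivrMr ?mulr_gt0 // ler_pdivlMl ?mulr_gt0 // W_E.
have h : m%:R * 1 <= M%:R * #|{: S}|%:R :> R.
  rewrite ler_pM // ?ler_nat //; rewrite ler1n.
  by apply/card_gt0P; exists [ffun=> true].
have := ler_wpM2l (ltW P0) h; lra.
Qed.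

Lemma spread_v_le i om : `|spread_v i om| <= (4 * m%:R)^-1.
Proof.
have mR : 0 < m%:R :> R by rewrite ltr0n.
have W0 := W_gt0; have P0 := p1_gt0.
have m4 : 0 <= (4 * m%:R)^-1 :> R by rewrite invr_ge0 mulr_ge0.
case: om => [[i' q]|[[s c] e]] /=.
  rewrite normrM (ger0_norm m4) normr_nat.
  by case: (i' == i); rewrite ?mul1r ?mul0r.
rewrite norm_fluct; apply: le_trans (inv4m_ge (inr (s, c, e))).
have s1 : 1 <= 2 ^+ s :> R by rewrite exprn_ege1 //; lra.
have h : p1 / 2 ^+ s / (4 * W) <= (4 * W)^-1 * p1.
  rewrite mulrC ler_wpM2l ?invr_ge0 ?mulr_ge0 ?(ltW W0) //.
  by rewrite ler_pdivrMr ?ler_peMr ?(ltW P0) // (lt_le_trans _ s1).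
apply: le_trans h; rewrite ler_piMl //; last by case: window.
by rewrite divr_ge0 ?divr_ge0 ?exprn_ge0 ?mulr_ge0 ?(ltW W0) ?(ltW P0).
Qed.

Lemma spread_w_ge0 om : 0 <= spread_w om.
Proof.
by case: om => //= _; rewrite invr_ge0 mulr_ge0 // ltW // W_gt0.
Qed.

Lemma spread_w_sum : \sum_om spread_w om = 1 / 4.
Proof.
rewrite sum_Om /= big1 ?add0r => [|i _]; last by rewrite big1.
rewrite sumr_const -[LHS]mulr_natr -/W; have W0 := W_gt0.
by field; rewrite gt_eqF.
Qed.

Lemma spread_w_le om : spread_w om <= (4 * m%:R)^-1.
Proof.
have mR : 0 < m%:R :> R by rewrite ltr0n.
have W0 := W_gt0.
have := inv4m_ge om; case: om => [_ _|om] /=; first by rewrite invr_ge0 mulr_ge0.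
apply: le_trans; rewrite ler_peMr ?invr_ge0 ?mulr_ge0 ?(ltW W0) //.
by rewrite ler1n.
Qed.

Lemma spread_w_le_avg om : spread_w om <= p1^-1 * \sum_i `|spread_v i om|.
Proof.
have W0 := W_gt0; have P0 := p1_gt0.
case: om => [om|[[s c] e]] /=.
  by rewrite mulr_ge0 ?invr_ge0 ?(ltW P0) // sumr_ge0.
under eq_bigr do rewrite norm_fluct.
rewrite -mulr_suml sum_window_i le_eqVlt; apply/orP; left; apply/eqP.
have s0 : 0 < 2 ^+ s :> R by rewrite exprn_gt0.
by field; rewrite !gt_eqF.
Qed.

Lemma spread_lower (a : I -> R) :
  1 / 4 * \sum_i `|a i| <= \sum_om `|\sum_i a i * spread_v i om|.
Proof.
have mR : 0 < m%:R :> R by rewrite ltr0n.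
rewrite sum_Om.
apply: (@le_trans _ _ (\sum_i \sum_(q < m)
    `|\sum_k a k * spread_v k (inl (i, q))|)); last first.
  by rewrite lerDl sumr_ge0.
rewrite mulr_sumr; apply: ler_sum => i _.
have E (q : 'I_m) : \sum_k a k * spread_v k (inl (i, q)) = a i / (4 * m%:R).
  rewrite (bigD1 i) //= eqxx mul1r [X in _ + X]big1 ?addr0 // => k /negbTE ki.
  by rewrite eq_sym ki mul0r mulr0.
under eq_bigr do rewrite E.
rewrite sumr_const card_ord -[leRHS]mulr_natr normrM.
rewrite (@ger0_norm _ (4 * m%:R)^-1) ?invr_ge0 ?mulr_ge0 //.
by rewrite le_eqVlt; apply/orP; left; apply/eqP; field; rewrite gt_eqF.
Qed.

Definition large (a : I -> R) (om : Om) : bool :=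
  spread_w om < 2 * `|\sum_i a i * spread_v i om|.

(** A combination of the rows with bounded sum of coefficients is small compared
with [w] on most columns. In the normalization where [w] is 1, an index with
coefficient [x] contributes on windows of scale [s] about [x / 2 ^ s]. If
[x <= 2 ^ s] this is controlled by the second moment over the random signs, and
the sum over the scales is of order [x]; if [x > 2 ^ s] all windows containing
the index are given up, which again costs at most [2 * x] in all. So the total
cost does not depend on the number [M] of scales, while the total weight of the
columns is proportional to it. *)
Lemma large_small (a : I -> R) :
  \sum_(om | large a om) spread_w om <= 10 / (4 * M%:R) * \sum_i `|a i|.
Proof.
have W0 := W_gt0; have P0 := p1_gt0; have S0 := card_S_gt0.
have MR : 0 < M%:R :> R by rewrite ltr0n M_gt0.
pose al i := `|p1 * a i|.
pose small s i := (al i <= 2 ^+ s)%R.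
pose Y (s : 'I_M) (c : I) (e : S) := \sum_i (-1) ^+ e i *
  ((window s c i && small s i)%:R * (p1 * a i)).
have al0 i : 0 <= al i by exact: normr_ge0.
(* Either the window contains an index whose coefficient is large for its
scale, or Chebyshev's inequality applies to the sum over the window. *)
have pt s c e : (large a (inr (s, c, e)))%:R <=
    \sum_i (window s c i && ~~ small s i)%:R + 4 * 2 ^- s * 2 ^- s * Y s c e ^+ 2 :> R.
  have s0 : 0 < 2 ^+ s :> R by rewrite exprn_gt0.
  have Y0 : 0 <= 4 * 2 ^- s * 2 ^- s * Y s c e ^+ 2.
    by rewrite mulr_ge0 ?sqr_ge0 // !mulr_ge0 // invr_ge0 ltW.
  have [[i0 hi0]|none] := pselect (exists i, window s c i && ~~ small s i).
    rewrite (bigD1 i0) //= hi0 mulr1n.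
    have : 0 <= \sum_(i | i != i0) (window s c i && ~~ small s i)%:R :> R by rewrite sumr_ge0.
    have : (large a (inr (s, c, e)))%:R <= 1 :> R by case: large.
    lra.
  rewrite big1 ?add0r => [|i _]; last first.
    by case: (boolP (_ && _)) => // h; exfalso; apply: none; exists i.
  rewrite /large; case: ltP => // lg /=.
  have E : \sum_i a i * fluct i (s, c, e) = Y s c e * (2 ^- s / (4 * W)).
    rewrite mulr_suml; apply: eq_bigr => i _; rewrite /fluct.
    have -> : window s c i && small s i = window s c i.
      apply/andb_idr => wi; apply: contrapT => /negP ns; apply: none.
      by exists i; rewrite wi.
    ring.
  move: lg; rewrite /= E normrM (@ger0_norm _ (2 ^- s / _)); last first.
    by rewrite divr_ge0 ?invr_ge0 ?mulr_ge0 // ltW.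
  move=> lg; have W4 : 0 < (4 * W)^-1 by rewrite invr_gt0 mulr_gt0.
  pose u := 2 * `|Y s c e| * 2 ^- s.
  have lgu : (4 * W)^-1 < u * (4 * W)^-1 by move: lg; rewrite /u !mulrA.
  have u1 : 1 < u by rewrite -(ltr_pM2r W4) mul1r.
  have -> : 4 * 2 ^- s * 2 ^- s * Y s c e ^+ 2 = u ^+ 2.
    by rewrite -[Y s c e ^+ 2]real_normK ?num_real // /u; ring.
  by rewrite exprn_ege1 // ltW.
have step1 : \sum_(om | large a om) spread_w om =
    (4 * W)^-1 * \sum_s \sum_c \sum_e (large a (inr (s, c, e)))%:R.
  rewrite big_mkcond sum_Om [X in X + _]big1 ?add0r => [|i _]; last first.
    by rewrite big1 // => q _; case: ifP.
  rewrite -(sum_Om' (fun om => (large a (inr om))%:R)) mulr_sumr.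
  by apply: eq_bigr => om _ /=; case: large; rewrite ?mulr1 ?mulr0.
rewrite step1.
have step2 s : \sum_c \sum_e (large a (inr (s, c, e)))%:R <=
    #|{: S}|%:R * \sum_i ((2 ^+ s < al i)%R%:R * 2 ^+ s +
      4 * ((al i <= 2 ^+ s)%R%:R * (al i ^+ 2 * 2 ^- s))).
  have s0 : 0 < 2 ^+ s :> R by rewrite exprn_gt0.
  pose K i := (~~ small s i)%:R + 4 * 2 ^- s * 2 ^- s * ((small s i)%:R * al i ^+ 2).
  apply: (@le_trans _ _ (\sum_c (#|{: S}|%:R * \sum_i (window s c i)%:R * K i))).
    apply: ler_sum => c _.
    apply: (le_trans (ler_sum _ (fun e _ => pt s c e))).
    rewrite big_split /= sumr_const -mulr_sumr second_moment -[_ *+ _]mulr_natl.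
    rewrite mulrCA -mulrDr ler_wpM2l // le_eqVlt; apply/orP; left; apply/eqP.
    rewrite mulr_sumr -big_split; apply: eq_bigr => i _ /=.
    rewrite /K exprMn -[(p1 * a i) ^+ 2]real_normK ?num_real // -/(al i).
    by case: (window s c i); case: (small s i) => /=; ring.
  rewrite -mulr_sumr ler_wpM2l // exchange_big; apply: ler_sum => i _ /=.
  rewrite -mulr_suml sum_window_c /K /small -real_ltNge ?num_real //.
  by rewrite le_eqVlt; apply/orP; left; apply/eqP; field; rewrite gt_eqF.
have step3 : \sum_s \sum_c \sum_e (large a (inr (s, c, e)))%:R <=
    #|{: S}|%:R * (10 * (p1 * \sum_i `|a i|)).
  apply: (le_trans (ler_sum _ (fun s _ => step2 s))).
  rewrite -mulr_sumr ler_wpM2l // exchange_big /= !mulr_sumr.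
  apply: ler_sum => i _; rewrite big_split /= -mulr_sumr.
  have h1 := sum_scales_below M (al0 i); have h2 := sum_scales_above M (al0 i).
  have -> : p1 * `|a i| = al i by rewrite /al normrM (gtr0_norm P0).
  lra.
apply: (@le_trans _ _ ((4 * W)^-1 * (#|{: S}|%:R * (10 * (p1 * \sum_i `|a i|))))).
  by rewrite ler_wpM2l // invr_ge0 mulr_ge0 // ltW.
rewrite le_eqVlt; apply/orP; left; apply/eqP; rewrite W_E.
by field; rewrite !gt_eqF.
Qed.

End SpreadMatrix.

(** * Extension by density *)

Section DenseExtension.
Variables (R : realType) (E : normedModType R) (F : completeNormedModType R).

Lemma closure_normP (V : set E) v :
  closure V v <-> forall e : R, 0 < e -> exists2 v0, V v0 & `|v - v0| < e.
Proof.
split=> [cv e e0|H B /nbhs_ballP[e /= e0 eB]].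
  have [v0 [Vv0]] := cv _ (nbhsx_ballx v e e0).
  by rewrite -ball_normE /=; exists v0.
have [v0 Vv0 h] := H e e0; exists v0; split => //; apply: eB.
by rewrite -ball_normE.
Qed.

Lemma subspace_closure (V : set E) : Defs.subspace V -> closed_subspace (closure V).
Proof.
move=> [V0 Vl]; split; last exact: closed_closure.
split; first exact: subset_closure.
move=> a u v /closure_normP cu /closure_normP cv; apply/closure_normP => e e0.
have a1 : 0 < 1 + `|a| by have := normr_ge0 a; lra.
have a0 : 0 < e / 2 / (1 + `|a|) by rewrite !divr_gt0.
have [u0 Vu0 hu] := cu _ a0; have [|v0 Vv0 hv] := cv (e / 2); first by lra.
exists (a *: u0 + v0); first exact: Vl.
have -> : a *: u + v - (a *: u0 + v0) = a *: (u - u0) + (v - v0).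
  by rewrite scalerBr opprD addrACA.
apply: (le_lt_trans (ler_normD _ _)); rewrite normrZ.
suff : `|a| * `|u - u0| <= e / 2 by lra.
apply: (@le_trans _ _ ((1 + `|a|) * (e / 2 / (1 + `|a|)))).
  by apply: ler_pM => //; [lra|exact: ltW].
by rewrite mulrC divfK // gt_eqF.
Qed.

(** The value of the extension at a limit point [v] is the point [t] for which
[(v, t)] is in the closure of the graph; completeness gives its existence, the
bound its uniqueness. *)
Lemma extend_operator (V : set E) (T0 : E -> F) (C : R) : Defs.subspace V -> 0 <= C ->
  (forall (a : R) u v, V u -> V v -> T0 (a *: u + v) = a *: T0 u + T0 v) ->
  (forall u, V u -> `|T0 u| <= C * `|u|) ->
  exists T : E -> F, [/\ forall v, V v -> T v = T0 v,
    (forall (a : R) u v, closure V u -> closure V v ->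
       T (a *: u + v) = a *: T u + T v) &
    forall v, closure V v -> `|T v| <= C * `|v|].
Proof.
move=> [V0 Vl] C0 Tl Tb.
pose A v t := forall e : R, 0 < e ->
  exists v0, [/\ V v0, `|v - v0| < e & `|t - T0 v0| < e].
have Tsub u v : V u -> V v -> T0 (u - v) = T0 u - T0 v.
  by move=> Vu Vv; rewrite addrC -scaleN1r Tl // scaleN1r addrC.
have Vsub u v : V u -> V v -> V (u - v).
  by move=> Vu Vv; rewrite addrC -scaleN1r; exact: Vl.
have Aex v : closure V v -> exists t, A v t.
  move=> /closure_normP cv.
  have /choice[u uP] n : exists u, V u /\ `|v - u| < n.+1%:R^-1.
    by have [|u Vu h] := cv (n.+1%:R^-1); rewrite ?invr_gt0 //; exists u.
  have : cauchy (T0 (u n) @[n --> \oo]).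
    apply: cauchy_exP => e e0.
    have [N hN] : exists N : nat, (2 * C + 1) / e < N.+1%:R.
      exists (Num.bound ((2 * C + 1) / e)).
      apply: (lt_le_trans (archi_boundP _)); last by rewrite ler_nat.
      by rewrite divr_ge0 ?(ltW e0) //; lra.
    exists (T0 (u N)), N => // n /= Nn; rewrite -ball_normE /=.
    rewrite -Tsub ?(uP _).1 //; try exact: (uP _).1.
    apply: (le_lt_trans (Tb _ (Vsub _ _ (uP _).1 (uP _).1))).
    have N0 : 0 < N.+1%:R :> R by rewrite ltr0n.
    have h1 : `|u N - u n| <= 2 / N.+1%:R.
      have -> : u N - u n = (v - u n) - (v - u N).
        by rewrite opprB [RHS]addrC [RHS]addrA subrK.
      apply: (le_trans (ler_normB _ _)).
      have h2 : n.+1%:R^-1 <= N.+1%:R^-1 :> R by rewrite lef_pV2 ?posrE // ler_nat.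
      rewrite [2 / _]mulr_natl mulr2n; apply: lerD; last exact/ltW/(uP N).2.
      exact: (le_trans (ltW (uP n).2) h2).
    apply: (le_lt_trans (ler_wpM2l C0 h1)).
    move: hN; rewrite ltr_pdivrMr // => hN.
    rewrite mulrA ltr_pdivrMr //; lra.
  move/cauchy_cvg => /cvg_ex[t /cvgrPdist_lt tP]; exists t => e e0.
  have [N1 _ h1] := tP e e0.
  have [N2 hN2] : exists N : nat, e^-1 < N.+1%:R.
    exists (Num.bound e^-1).
    apply: (lt_le_trans (archi_boundP _)); last by rewrite ler_nat.
    by rewrite invr_ge0 ltW.
  exists (u (maxn N1 N2)); split; first exact: (uP _).1.
    apply: (lt_le_trans (uP _).2); rewrite invf_ple ?posrE //.
    by apply: (le_trans (ltW hN2)); rewrite ler_nat ltnS leq_maxr.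
  by apply: h1 => /=; rewrite leq_maxl.
have Alin (a : R) u v s t : A u s -> A v t -> A (a *: u + v) (a *: s + t).
  move=> Aus Avt e e0.
  have a1 : 0 < 1 + `|a| by have := normr_ge0 a; lra.
  have a0 : 0 < e / 2 / (1 + `|a|) by rewrite !divr_gt0.
  have [u0 [Vu0 h1 h2]] := Aus _ a0.
  have [|v0 [Vv0 h3 h4]] := Avt (e / 2); first by lra.
  have small (r : R) : 0 <= r -> r < e / 2 / (1 + `|a|) -> `|a| * r <= e / 2.
    move=> r0 rs; apply: (@le_trans _ _ ((1 + `|a|) * (e / 2 / (1 + `|a|)))).
      by apply: ler_pM => //; [lra|exact: ltW].
    by rewrite mulrC divfK // gt_eqF.
  exists (a *: u0 + v0); split; first exact: Vl.
  - rewrite opprD addrACA -scalerBr; apply: (le_lt_trans (ler_normD _ _)).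
    rewrite normrZ; have := small _ (normr_ge0 _) h1; lra.
  - rewrite Tl // opprD addrACA -scalerBr; apply: (le_lt_trans (ler_normD _ _)).
    rewrite normrZ; have := small _ (normr_ge0 _) h2; lra.
have Abound v t : A v t -> `|t| <= C * `|v|.
  move=> Avt; apply/ler_addgt0Pr => e e0.
  have d0 : 0 < e / (1 + C) by rewrite divr_gt0 //; lra.
  have [v0 [Vv0 h1 h2]] := Avt _ d0.
  have ht : `|t| <= `|T0 v0| + `|t - T0 v0|.
    by rewrite -[in leLHS](subrK (T0 v0) t) addrC ler_normD.
  have hv : `|v0| <= `|v| + `|v - v0|.
    by rewrite -[in leLHS](subKr v v0) ler_normB.
  have := Tb v0 Vv0; have := ler_wpM2l C0 hv; have := ler_wpM2l C0 (ltW h1).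
  have : (1 + C) * (e / (1 + C)) = e.
    by rewrite mulrC divfK //; apply/eqP => h; lra.
  rewrite mulrDl mul1r mulrDr; lra.
have Auniq v s t : A v s -> A v t -> s = t.
  move=> As At; have := Alin (-1) _ _ _ _ As At.
  rewrite !scaleN1r ![- _ + _]addrC subrr => /Abound.
  by rewrite normr0 mulr0 normr_le0 subr_eq0 => /eqP.
have /choice[T TP] v : exists t, closure V v -> A v t.
  by have [/Aex[t h]|h] := pselect (closure V v); [exists t|exists 0].
have [_ cl] := (subspace_closure (conj V0 Vl)).1.
exists T; split.
- move=> v Vv; apply: Auniq (TP v (subset_closure Vv)) _ => e e0.
  by exists v; rewrite !subrr !normr0.
- move=> a u v cu cv; apply: Auniq (TP _ (cl a u v cu cv)) _.
  by apply: Alin; exact: TP.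
- by move=> v cv; apply: Abound; exact: TP.
Qed.

End DenseExtension.

(** * Finite dimensional subspaces *)

Section FiniteDimension.
Variables (R : realType) (E : normedModType R).

Lemma subspace_sum (V : set E) (I : Type) (r : seq I) (Q : pred I) (a : I -> R)
    (v : I -> E) : Defs.subspace V -> (forall i, Q i -> V (v i)) ->
  V (\sum_(i <- r | Q i) a i *: v i).
Proof.
move=> [V0 Vl] Vv; elim/big_rec: _ => // i x Qi Vx.
by apply: Vl => //; exact: Vv.
Qed.

Lemma subspaceZ (V : set E) (a : R) v : Defs.subspace V -> V v -> V (a *: v).
Proof. by move=> [V0 Vl] Vv; rewrite -[_ *: _]addr0; exact: Vl. Qed.

(** Induction on the number of functionals: a vector on which the last one does
not vanish splits off, and the others separate the points of its kernel. *)
Lemma separated_finite_dimensional q (phi : nat -> E -> R) (V : set E) :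
  Defs.subspace V ->
  (forall i (a : R) u v, phi i (a *: u + v) = a * phi i u + phi i v) ->
  (forall v, V v -> (forall i, (i < q)%N -> phi i v = 0) -> v = 0) ->
  finite_dimensional V.
Proof.
move=> sV lin; elim: q V sV => [|q IH] V sV sep.
  exists 0%N, (fun=> 0); split; first by case.
  by move=> x Vx; exists (fun=> 0); rewrite big_ord0; apply: sep.
have phi0 i : phi i 0 = 0.
  by have := lin i (-1) 0 0; rewrite scaler0 addr0 mulN1r addNr.
have phiZ i (a : R) v : phi i (a *: v) = a * phi i v.
  by have := lin i a v 0; rewrite addr0 phi0 addr0.
have [[x0 [Vx0 x0q]]|none] := pselect (exists x, V x /\ phi q x != 0); last first.
  apply: IH => // v Vv h; apply: sep => // i; rewrite ltnS leq_eqVlt.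
  move=> /orP[/eqP ->|]; last exact: h.
  by apply: contrapT => /eqP vq; apply: none; exists v.
pose V' := [set v | V v /\ phi q v = 0].
have sV' : Defs.subspace V'.
  split; first by split; [case: sV|exact: phi0].
  move=> a u v [Vu u0] [Vv v0]; split; first by case: sV => _; apply.
  by rewrite lin u0 v0 mulr0 addr0.
have [|n [w [Vw span]]] := IH V' sV'.
  move=> v [Vv vq] h; apply: sep => // i; rewrite ltnS leq_eqVlt.
  by move=> /orP[/eqP ->//|]; exact: h.
pose w' (i : 'I_n.+1) := if unlift ord_max i is Some k then w k else x0.
exists n.+1, w'; split.
  by move=> i; rewrite /w'; case: unliftP => // k _; exact: (Vw k).1.
move=> x Vx; pose b := phi q x / phi q x0.
have Vy : V' ((- b) *: x0 + x).
  split; first by case: sV => _; apply.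
  by rewrite lin mulNr /b divfK // addNr.
have [c cE] := span _ Vy.
exists (fun i => if unlift ord_max i is Some k then c k else b).
rewrite big_ord_recr /= /w' unlift_none.
have -> : x = ((- b) *: x0 + x) + b *: x0.
  by rewrite addrAC -scalerDl addNr scale0r add0r.
rewrite cE; congr (_ + _); apply: eq_bigr => i _.
have -> : widen_ord (leqnSn n) i = lift ord_max i.
  by apply: val_inj; rewrite /= /bump leqNgt ltn_ord.
by rewrite liftK.
Qed.

Lemma finite_dimensional_relation (V : set E) (z : nat -> E) :
  finite_dimensional V -> (forall i, V (z i)) ->
  exists n (c : nat -> R), (exists2 i, (i < n)%N & c i != 0) /\
    \sum_(i < n) c i *: z i = 0.
Proof.
move=> [n [v [Vv span]]] Vz.
have /choice[c cP] (i : nat) : exists c : 'I_n -> R, z i = \sum_(k < n) c k *: v k.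
  exact: span (Vz i).
pose A : 'M[R]_(n.+1, n) := \matrix_(i, k) c i k.
have : kermx A != 0.
  rewrite -mxrank_eq0 mxrank_ker subn_eq0 -ltnNge ltnS.
  exact: rank_leq_col.
move=> /rowV0Pn[u /sub_kermxP uA u0].
have /rV0Pn[i0 ui0] := u0.
exists n.+1, (fun i => if (i < n.+1)%N =P true is ReflectT h then u 0 (Ordinal h) else 0).
have uE (i : 'I_n.+1) :
    (if (i < n.+1)%N =P true is ReflectT h then u 0 (Ordinal h) else 0) = u 0 i.
  case: eqP => [h|/negP]; last by rewrite ltn_ord.
  by congr (u 0 _); exact: val_inj.
split; first by exists i0; [exact: ltn_ord|rewrite uE].
under eq_bigr do rewrite uE cP scaler_sumr.
rewrite exchange_big big1 // => k _ /=.
under eq_bigr do rewrite scalerA.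
rewrite -scaler_suml.
have := congr1 (fun B : 'rV_n => B 0 k) uA; rewrite !mxE => h.
rewrite (eq_bigr (fun i => u 0 i * A i k)) ?h ?scale0r // => i _.
by rewrite mxE.
Qed.

End FiniteDimension.

(** * Long almost additive block sequences near a subspace *)

Section BlocksOfSubspace.
Variables (R : realType) (j : nat -> nat) (sigma : seq (c00 R) -> nat).
Variables (XU : completeNormedModType R) (iota : {linear c00 R -> XU}).
Hypothesis hXU : is_completion (gowers_norm j sigma) iota.
Variable X : set XU.
Hypotheses (hX : closed_subspace X) (hXinf : ~ finite_dimensional X).

Local Notation f n := (log2p1 (n%:R : R)).
Local Notation G := (gowers_norm j sigma).

Let sG : solid_norm G := norm_solid j sigma.

Lemma iota_norm x : `|iota x| = G x. Proof. by have [] := hXU. Qed.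

Lemma iota_dense u (e : R) : 0 < e -> exists x, `|u - iota x| < e.
Proof.
move=> e0; have [_ cl] := hXU.
have : closure (range iota) u by rewrite cl.
by move=> /closure_normP /(_ e e0)[_ [x _ <-]]; exists x.
Qed.

(** The coordinates extend to the completion, as norm one functionals. *)
Lemma coordinate_functional i : exists phi : XU -> R,
  [/\ forall x, phi (iota x) = x i,
      (forall (a : R) u v, phi (a *: u + v) = a * phi u + phi v) &
      forall u, `|phi u| <= `|u| ].
Proof.
have inj x y : iota x = iota y -> x = y.
  move=> /eqP; rewrite -subr_eq0 -linearB -normr_le0 iota_norm => h.
  apply: c00P => t; apply/eqP; rewrite -subr_eq0 -normr_le0.
  by apply: le_trans h; exact: (solid_coord sG (x - y)).
pose T0 (u : XU) : R^o := (xget 0 [set x | iota x = u]) i.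
have T0E x : T0 (iota x) = x i.
  rewrite /T0; suff -> : xget 0 [set y | iota y = iota x] = x by [].
  apply: inj.
  exact: (@xgetPex _ 0 [set y | iota y = iota x] (ex_intro _ x erefl)).
have sub : Defs.subspace (range iota).
  split; first by exists 0 => //; rewrite linear0.
  move=> a _ _ [x _ <-] [y _ <-]; exists (a *: x + y) => //.
  by rewrite linearP.
have [||T [TE Tl Tb]] := @extend_operator R XU R^o _ T0 1 sub ler01.
- by move=> a _ _ [x _ <-] [y _ <-]; rewrite -linearP !T0E.
- by move=> _ [x _ <-]; rewrite mul1r T0E iota_norm; exact: solid_coord.
have [_ cl] := hXU; exists T; split.
- by move=> x; rewrite TE ?T0E //; exists x.
- by move=> a u v; rewrite Tl ?cl.
- by move=> u; have := Tb u; rewrite cl mul1r; apply.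
Qed.

(** An infinite dimensional subspace contains a vector with vanishing first [p]
coordinates; it is approximated by a finitely supported vector, from which the
few remaining small coordinates are removed. *)
Lemma hump p (e : R) : 0 < e -> exists (u : XU) (x : c00 R), [/\ X u,
  forall i, (i < p)%N -> x i = 0, G x = 1 & `|u - iota x| <= e].
Proof.
move=> e0; have [sX cX] := hX.
have /choice[phi phiP] i := coordinate_functional i.
have [v [Xv vp v0]] : exists v, [/\ X v, forall i, (i < p)%N -> phi i v = 0 & v != 0].
  apply: contrapT => none; apply: hXinf.
  apply: (@separated_finite_dimensional _ _ p phi X sX).
    by move=> i a u w; have [_ h _] := phiP i; exact: h.
  move=> v Xv vp; apply: contrapT => /eqP v0; apply: none.
  by exists v.
have vn : 0 < `|v| by rewrite normr_gt0.
pose u := `|v|^-1 *: v.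
have u1 : `|u| = 1 by rewrite normrZ normfV normr_id mulVf // gt_eqF.
have Xu : X u by exact: subspaceZ.
have up i : (i < p)%N -> phi i u = 0.
  move=> ip; have [_ h _] := phiP i; have := h `|v|^-1 v 0.
  have p0 : phi i 0 = 0.
    by have := h (-1) 0 0; rewrite scaler0 addr0 mulN1r addNr.
  by rewrite addr0 vp // p0 mulr0 addr0.
pose eta := Num.min (1 / 2) (e / 2).
have eta0 : 0 < eta by rewrite lt_min; apply/andP; split; lra.
have [etah etae] : eta <= 1 / 2 /\ eta <= e / 2.
  by split; rewrite ge_min lexx ?orbT.
have p1 : 0 < p.+1%:R :> R by rewrite ltr0n.
have [x' hx'] := iota_dense u (divr_gt0 eta0 p1).
have x'p i : (i < p)%N -> `|x' i| <= eta / p.+1%:R.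
  move=> ip; have [E h b] := phiP i.
  have -> : x' i = phi i (iota x' - u).
    by rewrite addrC -scaleN1r h up // mulr0 add0r E.
  by apply: (le_trans (b _)); rewrite distrC ltW.
pose x := restr [set i | (p <= i)%N] x'.
pose y := restr [set i | (i < p)%N] x'.
have xy : x' = y + x.
  rewrite [LHS](restr_setC [set i | (i < p)%N]) /x; congr (_ + restr _ _).
  by apply/seteqP; split=> i /=; [move/negP; rewrite -leqNgt|rewrite leqNgt => /negP].
have yE : G y <= p%:R * (eta / p.+1%:R).
  apply: (le_trans (solid_l1 sG y)).
  rewrite (@l1_ord _ _ p) => [|i pi]; last by rewrite restrE memNset //= ltnNge pi.
  apply: (@le_trans _ _ (\sum_(i < p) (eta / p.+1%:R))).
    apply: ler_sum => i _; rewrite restrE; case: ifP => _; first exact: x'p.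
    by rewrite normr0 divr_ge0 // ltW.
  by rewrite sumr_const card_ord -[leLHS]mulr_natl.
have ux : `|u - iota x| <= eta.
  have -> : u - iota x = (u - iota x') + iota y.
    by rewrite xy linearD opprD addrA addrAC subrK.
  apply: (le_trans (ler_normD _ _)); rewrite iota_norm.
  have -> : eta = eta / p.+1%:R + p%:R * (eta / p.+1%:R).
    by rewrite -[X in _ = X + _]mul1r -mulrDl (addrC 1) natr1 mulrC divfK // gt_eqF.
  by apply: lerD => //; exact: ltW.
have Gx : 1 - eta <= G x.
  rewrite -iota_norm -u1 lerBlDr -[in leLHS](subrK (iota x) u) addrC.
  by apply: (le_trans (ler_normD _ _)); rewrite lerD2l.
have Gx0 : 0 < G x by lra.
exists ((G x)^-1 *: u), ((G x)^-1 *: x); split.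
- exact: subspaceZ.
- move=> i ip; rewrite c00Z restrE memNset ?mulr0 //=.
  by apply/negP; rewrite -ltnNge.
- by rewrite solidZ // gtr0_norm ?invr_gt0 // mulVf // gt_eqF.
- rewrite [iota _]linearZ /= -scalerBr normrZ gtr0_norm ?invr_gt0 //.
  rewrite ler_pdivrMl //; apply: (le_trans ux).
  have := ler_wpM2r (ltW e0) (_ : 1 / 2 <= G x); lra.
Qed.

Lemma seq_finsupp (s : seq (c00 R)) p : exists2 q, (p <= q)%N &
  forall k i, (q <= i)%N -> nth 0 s k i = 0.
Proof.
elim: s => [|x s [q pq qP]]; first by exists p => // k i _; rewrite nth_nil.
have [n xn] := c00_finsupp x; exists (maxn q n); first exact: leq_trans pq (leq_maxl _ _).
by move=> [|k] i; rewrite geq_max => /andP[qi ni] /=; [exact: xn|exact: qP].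
Qed.

Lemma hump_seq p (d : R) : 0 < d -> exists (x : nat -> c00 R) (u : nat -> XU),
  [/\ block_seq x, forall k, X (u k) /\ G (x k) = 1,
      forall k i, (i < p)%N -> x k i = 0 &
      forall k, `|u k - iota (x k)| <= d * 2^-1 ^+ k.+1].
Proof.
move=> d0.
have step (s : seq (c00 R * XU)) : exists z : c00 R * XU,
  [/\ X z.2 /\ G z.1 = 1, forall i, (i < p)%N -> z.1 i = 0,
      (forall k i i', (k < size s)%N -> (nth (0, 0) s k).1 i != 0 ->
         z.1 i' != 0 -> (i < i')%N) &
      `|z.2 - iota z.1| <= d * 2^-1 ^+ (size s).+1].
  have [q pq qP] := seq_finsupp (map fst s) p.
  have e0 : 0 < d * 2^-1 ^+ (size s).+1 by rewrite mulr_gt0 ?exprn_gt0.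
  have [u [x [Xu xq x1 ux]]] := hump q e0; exists (x, u); split => //=.
    by move=> i ip; apply: xq; exact: leq_trans ip pq.
  move=> k i i' ks ki xi'.
  have iq : (i < q)%N.
    rewrite ltnNge; apply/negP => /(qP k); rewrite (nth_map (0, 0)) // => h.
    by rewrite h eqxx in ki.
  apply: (leq_trans iq); rewrite leqNgt; apply/negP => /xq h.
  by rewrite h eqxx in xi'.
have [Z ZP] := @dep_choice (c00 R * XU)%type (0, 0) _ (fun s _ => step s).
exists (fun k => (Z k).1), (fun k => (Z k).2); split.
- move=> l l' i k ll' Zl Zl'; have [_ _ h _] := ZP l'.
  by apply: (h l i k); rewrite ?size_mkseq ?nth_mkseq.
- by move=> k; have [[]] := ZP k.
- by move=> k; have [_ h _ _] := ZP k.
- by move=> k; have [_ _ _] := ZP k; rewrite size_mkseq.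
Qed.

(** At most one block is nonzero at a given coordinate, the same for all
combinations. *)
Lemma block_seq_coord (b : nat -> c00 R) n i : block_seq b ->
  (exists2 l0, (l0 < n)%N &
     forall c : nat -> R, (\sum_(l < n) c l *: b l) i = c l0 * b l0 i) \/
  (forall c : nat -> R, (\sum_(l < n) c l *: b l) i = 0).
Proof.
move=> bb; have [[l0 bl0]|none] := pselect (exists l : 'I_n, b l i != 0).
  left; exists l0 => // c; rewrite c00_sum (bigD1 l0) // big1 => [|l ll0].
    by rewrite [LHS]addr0 c00Z.
  rewrite c00Z (_ : b l i = 0) ?mulr0 //; apply: contrapT => /eqP bl.
  have [h|h|/val_inj h] := ltngtP l l0; last by rewrite h eqxx in ll0.
  - by have := bb _ _ _ _ h bl bl0; rewrite ltnn.
  - by have := bb _ _ _ _ h bl0 bl; rewrite ltnn.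
right=> c; rewrite c00_sum big1 // => l _; rewrite c00Z (_ : b l i = 0) ?mulr0 //.
by apply: contrapT => /eqP bl; apply: none; exists l.
Qed.

Lemma block_seq_dom (b : nat -> c00 R) n (c c' : nat -> R) : block_seq b ->
  (forall l, (l < n)%N -> `|c l| <= `|c' l|) ->
  dom (\sum_(l < n) c l *: b l) (\sum_(l < n) c' l *: b l).
Proof.
move=> bb cc' i; have [[l0 h e]|e] := block_seq_coord n i bb.
  by rewrite !e !normrM ler_wpM2r // cc'.
by rewrite !e.
Qed.

Lemma bernoulli (h : R) k : 0 <= h -> 1 + k%:R * h <= (1 + h) ^+ k.
Proof.
move=> h0; elim: k => [|k IH]; first by rewrite mul0r addr0 expr0.
rewrite exprS; have h1 : 0 <= 1 + h by lra.
apply: le_trans (ler_wpM2l h1 IH); rewrite -natr1.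
have : 0 <= k%:R * h * h by rewrite !mulr_ge0.
lra.
Qed.

Lemma log2_pow (N r : nat) : (0 < r)%N -> f (N ^ r) <= r%:R * f N.
Proof.
move=> r0; rewrite mulrA ler_wpM2r ?invr_ge0 ?(ltW (ln2_gt0 R)) //.
have N0 : 0 <= N%:R :> R by [].
rewrite mulr_natl -lnXn ?ltr_wpDl // ler_ln ?posrE ?exprn_gt0 ?ltr_wpDl //.
case: r r0 => // r _; elim: r => [|r IH]; first by rewrite expn1 expr1.
rewrite expnS natrM exprS.
have h1 : 0 <= N%:R + 1 :> R by lra.
have := ler_wpM2l h1 IH; rewrite mulrDr mulr1.
have : 0 <= (N ^ r.+1)%:R :> R by [].
lra.
Qed.

(** Blocks on which the norm is equivalent, up to a factor 2, to the sum of the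
moduli of the coefficients. Group humps by [N] repeatedly. If the norm lost the
factor [th / N < 1] at each of [r] successive groupings, a sum of [N ^ r] humps
would have norm at most [th ^ r]; but it is at least [N ^ r / f (N ^ r)], where
[f (N ^ r)] grows only linearly in [r]. So some [N] blocks, normalized, have a
sum of norm at least [th = N - 1/2], and by unconditionality the estimate for
this sum gives one for all combinations. *)
Lemma l1_blocks_ge2 N p (d : R) : (1 < N)%N -> 0 < d ->
  exists (b : nat -> c00 R) (u : nat -> XU),
  [/\ block_seq b, forall l, X (u l) /\ G (b l) <= 1,
      forall l i, (i < p)%N -> b l i = 0,
      forall l, `|u l - iota (b l)| <= d &
      forall c : nat -> R, 1 / 2 * \sum_(l < N) `|c l| <= G (\sum_(l < N) c l *: b l)].
Proof.
move=> N1 d0; have [sX _] := hX.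
have NR : 2 <= N%:R :> R by rewrite ler_nat.
have N0 : (0 < N)%N by exact: ltnW.
have [x [u [xb xP xp xu]]] := hump_seq p d0.
pose th : R := N%:R - 1 / 2; have th1 : 1 <= th by rewrite /th; lra.
have thr r : 1 <= th ^+ r by exact: exprn_ege1.
have thr0 r : 0 < th ^+ r by apply: lt_le_trans (thr r).
(* The [q]-th sum of humps after [r] groupings, the normalized blocks with
their approximants in the subspace. *)
pose g r q := \sum_(i < N ^ r) x (q * N ^ r + i)%N.
pose b r q l := (th ^+ r)^-1 *: g r (q * N + l)%N.
pose v r q l := (th ^+ r)^-1 *: \sum_(i < N ^ r) u ((q * N + l) * N ^ r + i)%N.
have gS r q : g r.+1 q = \sum_(l < N) g r (q * N + l)%N.
  have split_sum m : \sum_(i < m * N ^ r) x (q * N ^ r.+1 + i)%N =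
      \sum_(l < m) g r (q * N + l)%N.
    elim: m => [|m IH]; first by rewrite mul0n !big_ord0.
    rewrite big_ord_recr /= -IH mulSnr big_split_ord /=; congr (_ + _).
    by apply: eq_bigr => i _; congr x; rewrite expnS; lia.
  by rewrite -split_sum -expnS.
have gcoord r q i : g r q i != 0 -> exists2 h, (q * N ^ r <= h < q.+1 * N ^ r)%N & x h i != 0.
  rewrite c00_sum => h; apply: contrapT => none; move/eqP: h; apply.
  apply: big1 => k _; apply: contrapT => /eqP xk; apply: none.
  by exists (q * N ^ r + k)%N => //; rewrite leq_addr mulSnr ltn_add2l /=.
have gblock r : block_seq (g r).
  move=> q q' i k qq' /gcoord[h /andP[_ h2] xh] /gcoord[h' /andP[h1' _] xh'].
  apply: (xb _ _ _ _ _ xh xh'); apply: (leq_trans h2); apply: leq_trans h1'.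
  by rewrite leq_mul2r qq' orbT.
have [[r [q [big gq]]]|none] := pselect (exists r q,
    th <= G (\sum_(l < N) b r q l) /\ forall l, (l < N)%N -> G (b r q l) <= 1).
- pose bb l : c00 R := if (l < N)%N then b r q l else 0.
  have bbb : block_seq bb.
    move=> l l' i k ll'; rewrite /bb; case: ifP => [_|_ /eqP//]; case: ifP => [_|_ _ /eqP//].
    rewrite !c00Z !mulf_eq0 !negb_or => /andP[_ gl] /andP[_ gl'].
    by apply: (gblock r _ _ _ _ _ gl gl'); rewrite ltn_add2l.
  exists bb, (fun l => if (l < N)%N then v r q l else 0); split => //.
  + move=> l; rewrite /bb; case: ifP => lN; last by rewrite solid0 // ler01; split=> //; case: sX.
    split; last exact: gq.
    rewrite /v; apply: subspaceZ => //; elim/big_rec: _ => [|i w _ Xw]; first by case: sX.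
    by rewrite -[u _]scale1r; case: sX => _; apply => //; exact: (xP _).1.
  + move=> l i ip; rewrite /bb; case: ifP => // _; rewrite c00Z c00_sum big1 ?mulr0 // => k _.
    exact: xp.
  + move=> l; rewrite /bb; case: ifP => _; last by rewrite linear0 subrr normr0 ltW.
    rewrite /v /b [iota _]linearZ /= -scalerBr normrZ gtr0_norm ?invr_gt0 //.
    have le1 : (th ^+ r)^-1 <= 1 by rewrite invf_le1.
    apply: (@le_trans _ _ (1 * d)); last by rewrite mul1r.
    apply: ler_pM => //; first by rewrite invr_ge0 ltW.
    rewrite linear_sum -sumrB; apply: (le_trans (ler_norm_sum _ _ _)).
    apply: (le_trans (ler_sum _ (fun i _ => xu _))).
    set q' := ((q * N + l) * N ^ r)%N.
    rewrite -mulr_sumr ler_piMr ?(ltW d0) //.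
    have geo m : \sum_(i < m) (2^-1 : R) ^+ (q' + i).+1 <= 1 - 2^-1 ^+ m.
      elim: m => [|m IH]; first by rewrite big_ord0 expr0 subrr.
      rewrite big_ord_recr /=.
      have : (2^-1 : R) ^+ (q' + m).+1 <= 2^-1 ^+ m.+1.
        by rewrite ler_wiXn2l ?invr_ge0 ?invf_le1 // ?ler1n // ltnS leq_addl.
      rewrite [_ ^+ m.+1]exprS; lra.
    apply: (le_trans (geo _)); have : 0 <= 2^-1 ^+ (N ^ r) :> R by rewrite exprn_ge0.
    lra.
  + move=> c.
    set m := \sum_(l < N) `|c l|.
    have cm l : (l < N)%N -> `|c l| <= m.
      by move=> lN; rewrite /m (bigD1 (Ordinal lN)) //= lerDl sumr_ge0.
    have m0 : 0 <= m by exact: sumr_ge0.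
    have e : m *: \sum_(l < N) b r q l = \sum_(l < N) `|c l| *: bb l +
        \sum_(l < N) (m - `|c l|) *: bb l.
      rewrite -big_split scaler_sumr; apply: eq_bigr => l _ /=.
      by rewrite /bb ltn_ord -scalerDl addrC subrK.
    have h1 : G (\sum_(l < N) `|c l| *: bb l) <= G (\sum_(l < N) c l *: bb l).
      apply: (solid_dom sG).
      apply: (@block_seq_dom bb N (fun l => `|c l|) c bbb) => l _.
      by rewrite normr_id.
    have h2 : G (\sum_(l < N) (m - `|c l|) *: bb l) <= m * N%:R - m.
      apply: (le_trans (solid_sum _ _ _ sG)).
      apply: (@le_trans _ _ (\sum_(l < N) (m - `|c l|))).
        apply: ler_sum => l _; rewrite solidZ // ger0_norm ?subr_ge0 ?cm //.
        by rewrite ler_piMr ?subr_ge0 ?cm // /bb ltn_ord gq.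
      by rewrite sumrB sumr_const card_ord -[m *+ N]mulr_natr.
    have h3 : m * th <= G (\sum_(l < N) `|c l| *: bb l) +
        G (\sum_(l < N) (m - `|c l|) *: bb l).
      apply: le_trans (solidD sG _ _); rewrite -e solidZ // ger0_norm //.
      by rewrite ler_wpM2l.
    move: h3; rewrite /th mulrBr; lra.
exfalso.
have gle r q : G (g r q) <= th ^+ r.
  elim: r q => [|r IH] q; first by rewrite /g expn0 big_ord1 expr0 (xP _).2.
  rewrite leNgt; apply/negP => lt; apply: none; exists r, q.
  have sb : \sum_(l < N) b r q l = (th ^+ r)^-1 *: g r.+1 q.
    by rewrite gS scaler_sumr.
  split.
    rewrite sb solidZ // gtr0_norm ?invr_gt0 // ler_pdivlMl //.
    by rewrite -exprSr ltW.
  by move=> l _; rewrite solidZ // gtr0_norm ?invr_gt0 // ler_pdivrMl // mulr1.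
have low r : (0 < r)%N -> N%:R ^+ r <= th ^+ r * (r%:R * f N).
  move=> r0; have Nr0 : (0 < N ^ r)%N by rewrite expn_gt0 N0.
  apply: (@le_trans _ _ (th ^+ r * f (N ^ r))); last first.
    by rewrite ler_wpM2l ?(ltW (thr0 r)) // log2_pow.
  have fr0 : 0 < f (N ^ r) by exact: log2_gt0.
  rewrite -ler_pdivrMr //; apply: le_trans (gle r 0%N).
  pose s := mkseq (fun i => supp (x i)) (N ^ r).
  have ss : successive_sets s.
    split=> i; rewrite size_mkseq => h.
      rewrite nth_mkseq //; apply: contrapT => none'.
      have x0 : x i = 0.
        apply: c00P => t; apply: contrapT => /eqP xt; apply: none'; by exists t.
      by have := (xP i).2; rewrite x0 solid0 // => /eqP; rewrite eq_sym oner_eq0.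
    by rewrite !nth_mkseq ?(ltnW h) // => a c xa xc; exact: (xb _ _ _ _ (ltnSn i) xa xc).
  have := norm_fst j sigma (g r 0%N) Nr0 (size_mkseq _ _) ss.
  have -> : \sum_(E <- s) G (restr E (g r 0%N)) = N%:R ^+ r.
    rewrite big_map (_ : seq.iota 0 (N ^ r) = index_iota 0 (N ^ r)); last first.
      by rewrite /index_iota subn0.
    rewrite big_mkord (eq_bigr (fun=> 1)); first by rewrite sumr_const card_ord natrX.
    move=> i _; rewrite (_ : restr _ _ = x i) ?(xP _).2 //.
    apply: c00P => t; rewrite restrE; case: ifPn => [|]; last first.
      by rewrite notin_setE suppE => /negP; rewrite negbK => /eqP.
    rewrite inE suppE => xt; rewrite c00_sum (bigD1 i) // big1.
      by rewrite [LHS]addr0 mul0n add0n.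
    move=> l li; rewrite mul0n add0n; apply: contrapT => /eqP xlt.
    have [h|h|/val_inj h] := ltngtP l i; last by rewrite h eqxx in li.
    - by have := xb _ _ _ _ h xlt xt; rewrite ltnn.
    - by have := xb _ _ _ _ h xt xlt; rewrite ltnn.
  by rewrite mulrC.
pose h : R := 1 / 2 / th.
have th0 : 0 < th by lra.
have h0 : 0 < h by rewrite !divr_gt0.
have Nth : N%:R = th * (1 + h).
  by rewrite mulrDr mulr1 /h mulrCA mulfV ?gt_eqF // mulr1 /th subrK.
have low2 r : (0 < r)%N -> (1 + h) ^+ r <= r%:R * f N.
  move=> /low; rewrite Nth exprMn ler_pM2l //.
have fN : 0 < f N by exact: log2_gt0.
(* The square of Bernoulli's inequality beats a linear bound. *)
have [k k0 kb] : exists2 k, (0 < k)%N & 2 * f N / h ^+ 2 < k%:R.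
  exists (Num.bound (2 * f N / h ^+ 2)).+1 => //.
  apply: (lt_le_trans (archi_boundP _)); last by rewrite ler_nat.
  have a0 : 0 <= 2 * f N by lra.
  exact: divr_ge0 a0 (sqr_ge0 h).
have kR : 0 < k%:R :> R by rewrite ltr0n.
have := low2 (k * 2)%N; rewrite muln_gt0 k0 => /(_ isT); rewrite exprM natrM.
have h1 : (k%:R * h) ^+ 2 <= ((1 + h) ^+ k) ^+ 2.
  have kh0 : 0 <= k%:R * h by rewrite mulr_ge0 ?(ltW h0).
  have kh : k%:R * h <= (1 + h) ^+ k by have := bernoulli k (ltW h0); lra.
  rewrite ler_pXn2r ?nnegrE //; exact: le_trans kh0 kh.
move=> h2; have := le_trans h1 h2; rewrite exprMn expr2.
move: kb; rewrite ltr_pdivrMr ?exprn_gt0 // => kb.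
move=> h3.
have : k%:R * (2 * f N) < k%:R * (k%:R * h ^+ 2) by rewrite ltr_pM2l.
lra.
Qed.

Lemma l1_blocks N p (d : R) : 0 < d ->
  exists (b : nat -> c00 R) (u : nat -> XU),
  [/\ block_seq b, forall l, X (u l) /\ G (b l) <= 1,
      forall l i, (i < p)%N -> b l i = 0,
      forall l, `|u l - iota (b l)| <= d &
      forall c : nat -> R, 1 / 2 * \sum_(l < N) `|c l| <= G (\sum_(l < N) c l *: b l)].
Proof.
move=> d0; have [b [u [bb bP bp bu bl]]] := @l1_blocks_ge2 N.+2 p d isT d0.
exists b, u; split => // c.
have := bl (fun l => if (l < N)%N then c l else 0).
rewrite !big_ord_recr /= ltnn ltnNge leqnSn /= normr0 !scale0r !addr0.
rewrite (eq_bigr (fun l : 'I_N => `|c l|)) => [|l _]; last by rewrite ltn_ord.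
by rewrite [X in G X](eq_bigr (fun l : 'I_N => c l *: b l)) => [//|l _]; rewrite ltn_ord.
Qed.

End BlocksOfSubspace.

(** * Spread systems *)

Section SpreadSystems.
Variables (R : realType) (j : nat -> nat) (sigma : seq (c00 R) -> nat).
Variables (XU : completeNormedModType R) (iota : {linear c00 R -> XU}).
Hypothesis hXU : is_completion (gowers_norm j sigma) iota.
Variable X : set XU.
Hypotheses (hX : closed_subspace X) (hXinf : ~ finite_dimensional X).

Local Notation G := (gowers_norm j sigma).

Let sG : solid_norm G := norm_solid j sigma.

Lemma sum_enum_val (V : nmodType) (I : finType) (F : I -> V) :
  \sum_om F om = \sum_(k < #|I|) F (enum_val k).
Proof. by rewrite (reindex _ (onW_bij _ (@enum_val_bij I))). Qed.

(** A combination of many blocks with small coefficients is an average: cutting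
it into [m] pieces divides at most [m] blocks, whose coefficients do not add up
to more than 1/4. *)
Lemma averaging_small_coefs (b : nat -> c00 R) N m (c : nat -> R) :
  (0 < m)%N -> block_seq b -> (forall l, G (b l) <= 1) ->
  (forall l, `|c l| <= (4 * m%:R)^-1) -> \sum_(l < N) `|c l| <= 1 / 2 ->
  averaging j sigma m (\sum_(l < N) c l *: b l).
Proof.
move=> m0 bb b1 cm c2 s /andP[s0 sm] ss.
have mR : 0 < m%:R :> R by rewrite ltr0n.
have m4 : 0 <= (4 * m%:R)^-1 :> R by rewrite invr_ge0 mulr_ge0.
have cc l : 0 <= `|c l| <= (4 * m%:R)^-1 by rewrite normr_ge0 cm.
have wc := sum_wcount N bb m4 cc ss.
have wb := wcount_le_sum b N (seq_union s) (fun l => normr_ge0 (c l)).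
have h : \sum_(F <- s) G (restr F (\sum_(l < N) c l *: b l)) <=
    \sum_(F <- s) wcount (fun l => `|c l|) b N F.
  apply: ler_sum => F _; rewrite restr_sum.
  apply: (le_trans (solid_sum _ _ _ sG)); apply: ler_sum => l _.
  rewrite restrZ solidZ // ler_wpM2l //.
  case: (boolP (meets F (b l))) => [_|/restr_meets ->]; last by rewrite solid0.
  exact: le_trans (solid_restr _ _ sG) (b1 l).
have h2 : (4 * m%:R)^-1 * (size s)%:R <= 1 / 4 :> R.
  rewrite mulrC ler_pdivrMr ?mulr_gt0 //.
  have : (size s)%:R <= m%:R :> R by rewrite ler_nat.
  lra.
lra.
Qed.

Lemma l1_family (I : finType) p m (d : R) : (0 < m)%N -> 0 < d ->
  exists (b : I -> c00 R) (u : I -> XU),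
  [/\ forall om t (c : I -> R), b om t != 0 -> (\sum_om c om *: b om) t = c om * b om t,
      forall om, X (u om) /\ G (b om) <= 1,
      forall om i, (i < p)%N -> b om i = 0,
      forall om, `|u om - iota (b om)| <= d &
      (forall c : I -> R, 1 / 2 * \sum_om `|c om| <= G (\sum_om c om *: b om)) /\
      (forall c : I -> R, (forall om, `|c om| <= (4 * m%:R)^-1) ->
        \sum_om `|c om| <= 1 / 2 -> averaging j sigma m (\sum_om c om *: b om))].
Proof.
move=> m0 d0; have [b [u [bb bP bp bu bl]]] := l1_blocks hXU hX hXinf #|I| p d0.
pose cn (c : I -> R) l := if insub l is Some k then c (@enum_val I I k) else 0.
have cnE c (k : 'I_#|I|) : cn c k = c (enum_val k) by rewrite /cn valK.
pose bI (om : I) := b (enum_rank om).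
have sumE c : \sum_om c om *: bI om = \sum_(l < #|I|) cn c l *: b l.
  by rewrite sum_enum_val; apply: eq_bigr => k _; rewrite /bI enum_valK cnE.
have sumN c : \sum_om `|c om| = \sum_(l < #|I|) `|cn c l|.
  by rewrite sum_enum_val; apply: eq_bigr => k _; rewrite cnE.
exists bI, (fun om : I => u (enum_rank om)); split=> [i0 t c bot | om | om i | om | ].
- rewrite sumE.
  have [[l0 l0N e]|e] := block_seq_coord #|I| t bb; last first.
    have := e (cn (fun i0' => (i0' == i0)%:R)); rewrite -sumE c00_sum (bigD1 i0) //=.
    rewrite big1 => [|i0' /negbTE h]; last by rewrite h scale0r.
    by rewrite [LHS]addr0 eqxx scale1r => h; rewrite h eqxx in bot.
  have := e (cn (fun i0' => (i0' == i0)%:R)); rewrite -sumE c00_sum (bigD1 i0) //=.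
  rewrite big1 => [|i0' /negbTE h]; last by rewrite h scale0r.
  rewrite [LHS]addr0 eqxx scale1r => h.
  have [l0E|ne] := eqVneq l0 (enum_rank i0); first by rewrite e l0E cnE enum_rankK.
  case/negP: bot; rewrite h -[l0]/(val (Ordinal l0N)) cnE.
  rewrite (_ : (_ == i0) = false) ?mul0r //; apply/negbTE/negP => /eqP h'.
  by case/negP: ne; rewrite -h' enum_valK.
- exact: bP.
- exact: bp.
- exact: bu.
split; first by move=> c; rewrite sumE sumN.
move=> c cm c2; rewrite sumE; apply: averaging_small_coefs => //.
- by move=> l; exact: (bP l).2.
- move=> l; rewrite /cn; case: insub => [k|]; first exact: cm.
  by rewrite normr0 invr_ge0 mulr_ge0.
- by rewrite -sumN.
Qed.

(** The vectors of the subspace need not have finite support, whence the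
approximants [sys_wt] and [sys_vt]; only the first [sys_dim] values of [sys_v]
and [sys_vt] belong to the system. *)
Record system := System {
  sys_dim : nat ; sys_w : c00 R ; sys_v : nat -> c00 R ;
  sys_wt : XU ; sys_vt : nat -> XU }.

Definition sys_comb (S : system) (b : R) (a : nat -> R) : c00 R :=
  b *: sys_w S + \sum_(k < sys_dim S) a k *: sys_v S k.

(** The property for which the systems are made is the last one: in a combination
of the system, [w] is either dominated pointwise by the combination or has a
negligible contribution. This holds although [w] lies below the average of the
moduli of the [v k], so that no diagonal operator annihilates the [v k] and
keeps [w]. *)
Record spread_system (p m : nat) (e d : R) (S : system) : Prop := SpreadSystem {
  sys_w_low : forall i, (i < p)%N -> sys_w S i = 0 ;
  sys_v_low : forall k i, (k < sys_dim S)%N -> (i < p)%N -> sys_v S k i = 0 ;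
  sys_w_approx : X (sys_wt S) /\ `|sys_wt S - iota (sys_w S)| <= d ;
  sys_v_approx : forall k, (k < sys_dim S)%N ->
    X (sys_vt S k) /\ `|sys_vt S k - iota (sys_v S k)| <= d ;
  sys_w_avg : averaging j sigma m (sys_w S) ;
  sys_v_avg : forall k, (k < sys_dim S)%N -> averaging j sigma m (sys_v S k) ;
  sys_w_ge : 1 / 8 <= G (sys_w S) ;
  sys_dim_gt0 : (0 < sys_dim S)%N ;
  sys_w_le : forall t, `|sys_w S t| <=
    (sys_dim S)%:R^-1 * \sum_(k < sys_dim S) `|sys_v S k t| ;
  sys_control : forall (b : R) (a : nat -> R), exists B : set nat,
    [/\ forall t, B t -> `|b * sys_w S t| <= 2 * `|sys_comb S b a t|,
        `|b| * G (restr (~` B) (sys_w S)) <= e * G (sys_comb S b a) &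
        `|b| + \sum_(k < sys_dim S) `|a k| <= 72 * G (sys_comb S b a)] }.

(** The vectors of the system are combinations of blocks on which the norm is
nearly the sum of the moduli of the coefficients, the rows of the random matrix
serving as coefficients. If the coefficients of the [v k] dominate, [w] is
negligible; otherwise the combination of the [v k] is small compared with [w]
on most of the blocks, and [w] is dominated by the combination there. *)
Lemma spread_system_exists p m (e d : R) : (0 < m)%N -> 0 < e -> e <= 1 -> 0 < d ->
  exists S, spread_system p m e d S.
Proof.
move=> m0 e0 e1 d0; have [sX _] := hX.
(* [C] is the ratio of coefficients beyond which the [v k] alone control the
norm. *)
have [C Ce C3] : exists2 C : R, (C - 1) * e = 2 & 3 <= C.
  exists (1 + 2 / e); first by rewrite addrAC subrr add0r divfK // gt_eqF.
  have : 2 <= 2 / e by rewrite ler_pdivlMr //; lra.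
  lra.
have [M mM MC] : exists2 M, (m <= M)%N & 80 * C / e <= M%:R.
  exists (m + Num.bound (80 * C / e))%N; first exact: leq_addr.
  apply: (@le_trans _ _ (Num.bound (80 * C / e))%:R).
    by apply/ltW/archi_boundP; rewrite divr_ge0 ?(ltW e0) //; lra.
  by rewrite ler_nat leq_addl.
have M0 : (0 < M)%N by exact: leq_trans m0 mM.
have MR : 0 < M%:R :> R by rewrite ltr0n.
have [q Mq] : exists q, (2 ^ M <= q)%N by exists (2 ^ M)%N.
pose Om : finType :=
  ('I_q.+1 * 'I_m + 'I_M * 'I_q.+1 * {ffun 'I_q.+1 -> bool})%type.
have [b [u [bE bP bp bu [bl bavg]]]] := l1_family Om p m0 d0.
pose W : Om -> R := @spread_w R q M m.
pose V : 'I_q.+1 -> Om -> R := @spread_v R q M m.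
pose w : c00 R := \sum_om W om *: b om.
pose v (k : nat) : c00 R := \sum_om V (inord k) om *: b om.
pose wt : XU := \sum_om W om *: u om.
pose vt (k : nat) : XU := \sum_om V (inord k) om *: u om.
have W0 om : 0 <= W om by exact: spread_w_ge0.
have Wabs om : `|W om| = W om by rewrite ger0_norm.
have Wsum : \sum_om W om = 1 / 4 by exact: spread_w_sum.
have Wsum' : \sum_om `|W om| = 1 / 4 by under eq_bigr do rewrite Wabs.
have Vsum k : \sum_om `|V k om| = 1 / 2 by exact: spread_v_sum.
have approx (c : Om -> R) : \sum_om `|c om| <= 1 ->
    X (\sum_om c om *: u om) /\ `|\sum_om c om *: u om - iota (\sum_om c om *: b om)| <= d.
  move=> c1; split; first by apply: subspace_sum => // om _; exact: (bP om).1.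
  rewrite linear_sum -sumrB; apply: (le_trans (ler_norm_sum _ _ _)).
  apply: (@le_trans _ _ (\sum_om `|c om| * d)).
    apply: ler_sum => om _; rewrite [iota _]linearZ /= -scalerBr normrZ.
    by rewrite ler_wpM2l.
  by rewrite -mulr_suml ler_piMl // ltW.
have upper (c : Om -> R) : G (\sum_om c om *: b om) <= \sum_om `|c om|.
  apply: (le_trans (solid_sum _ _ _ sG)); apply: ler_sum => om _.
  by rewrite solidZ // ler_piMr // (bP om).2.
have out (c : Om -> R) t : (forall om, b om t = 0) -> (\sum_om c om *: b om) t = 0.
  by move=> h; rewrite c00_sum big1 // => om _; rewrite c00Z h mulr0.
exists (System q.+1 w v wt vt); split => //=.
- by move=> i ip; apply: out => om; exact: bp.
- by move=> k i _ ip; apply: out => om; exact: bp.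
- by apply: approx; rewrite Wsum'; lra.
- by move=> k _; apply: approx; rewrite Vsum; lra.
- apply: bavg; last by rewrite Wsum'; lra.
  by move=> om; rewrite Wabs; exact: spread_w_le.
- move=> k _; apply: bavg; last by rewrite Vsum.
  by move=> om; exact: spread_v_le.
- by apply: le_trans (bl W); rewrite Wsum'; lra.
- move=> t; have [[om ot]|none] := pselect (exists om, b om t != 0); last first.
    rewrite /w out ?normr0 => [|om]; last first.
      by apply: contrapT => /eqP h; apply: none; exists om.
    by rewrite mulr_ge0 ?invr_ge0 // sumr_ge0.
  rewrite (bE _ _ _ ot) normrM Wabs.
  under eq_bigr do rewrite /v (bE _ _ _ ot) normrM inord_val.
  rewrite -mulr_suml mulrA ler_wpM2r //.
  exact: spread_w_le_avg.
move=> c a; set Z := sys_comb _ _ _.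
pose r om := \sum_(k < q.+1) a k * V k om.
have ZE : Z = \sum_om (c * W om + r om) *: b om.
  rewrite /Z /sys_comb /= /w scaler_sumr.
  under [in X in _ + X]eq_bigr do rewrite /v scaler_sumr.
  rewrite exchange_big -big_split; apply: eq_bigr => om _ /=.
  rewrite scalerDl scalerA; congr (_ + _); rewrite /r scaler_suml.
  by apply: eq_bigr => k _; rewrite scalerA inord_val.
pose A := \sum_(k < q.+1) `|a k|.
have A0 : 0 <= A by exact: sumr_ge0.
have rA : 1 / 4 * A <= \sum_om `|r om| by exact: spread_lower.
have ZA : (A - `|c|) / 8 <= G Z.
  rewrite ZE; apply: le_trans (bl _).
  suff : 1 / 4 * A - 1 / 4 * `|c| <= \sum_om `|c * W om + r om| by lra.
  apply: (@le_trans _ _ (\sum_om (`|r om| - `|c * W om|))).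
    rewrite sumrB lerB //; under eq_bigr do rewrite normrM Wabs.
    by rewrite -mulr_sumr Wsum mulrC.
  apply: ler_sum => om _; rewrite lerBlDr.
  by rewrite -[in leLHS](addrK (c * W om) (r om)) [r om + _]addrC ler_normB.
have Z0 : 0 <= G Z by exact: solid_ge0.
have w1 : G w <= 1 / 4 by rewrite -Wsum' upper.
have [AC|AC] := lerP (C * `|c|) A.
  exists set0; split => //.
    rewrite setC0 restrT; apply: (@le_trans _ _ (`|c| / 4)).
      by rewrite ler_wpM2l //; lra.
    have h : (C - 1) * `|c| / 8 <= G Z by lra.
    have := ler_wpM2r (ltW e0) h.
    have -> : (C - 1) * `|c| / 8 * e = ((C - 1) * e) * `|c| / 8 by ring.
    rewrite Ce; lra.
  have : 3 * `|c| <= A by apply: le_trans AC; rewrite ler_wpM2r.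
  rewrite -/A; lra.
have c0 : 0 < `|c|.
  by rewrite lt_neqAle normr_ge0 andbT; apply/eqP => h; move: AC; rewrite -h mulr0; lra.
have cne : c != 0 by rewrite -normr_gt0.
pose a' k := a k / c.
pose L (om : Om) := large (fun k : 'I_q.+1 => a' k) om.
have r'E om : \sum_(k < q.+1) a' k * V k om = r om / c.
  by rewrite mulr_suml; apply: eq_bigr => k _; rewrite /a' mulrAC.
have Lsmall : \sum_(om | L om) W om <= e / 32.
  apply: (le_trans (large_small m0 mM Mq _)).
  have -> : \sum_(k < q.+1) `|a' k| = A / `|c|.
    by rewrite mulr_suml; apply: eq_bigr => k _; rewrite normrM normfV.
  have h : A / `|c| <= C by rewrite ler_pdivrMr // ltW.
  have M4 : 0 <= 10 / (4 * M%:R) :> R by rewrite divr_ge0 ?mulr_ge0.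
  apply: (le_trans (ler_wpM2l M4 h)).
  rewrite mulrAC ler_pdivrMr ?mulr_gt0 //.
  have : 80 * C <= M%:R * e by rewrite -ler_pdivrMr.
  lra.
have notL om : ~~ L om -> `|r om| <= `|c| * W om / 2.
  rewrite /L /large -leNgt r'E normrM normfV mulrA ler_pdivrMr // -/(W om).
  lra.
have half om : ~~ L om -> `|c * W om| <= 2 * `|c * W om + r om|.
  move=> /notL h; have := ler_normB (c * W om + r om) (r om).
  rewrite addrK normrM Wabs; lra.
have Zc : `|c| / 32 <= G Z.
  rewrite ZE; apply: le_trans (bl _).
  have : `|c| * (1 / 4 - e / 32) <= 2 * \sum_om `|c * W om + r om|.
    rewrite mulr_sumr (bigID L) /=; apply: (@le_trans _ _ (\sum_(om | ~~ L om) `|c| * W om)).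
      rewrite -mulr_sumr ler_wpM2l //.
      by move: Wsum; rewrite (bigID L) /=; lra.
    apply: (@le_trans _ _ (\sum_(om | ~~ L om) 2 * `|c * W om + r om|)).
      by apply: ler_sum => om /half; rewrite normrM Wabs.
    by rewrite lerDr sumr_ge0 // => om _; rewrite mulr_ge0.
  have : `|c| * (1 / 8) <= `|c| * (1 / 4 - e / 32) by rewrite ler_wpM2l //; lra.
  lra.
pose B := [set t | exists2 om, ~~ L om & b om t != 0].
exists B; split.
- move=> t [om Lo ot]; rewrite -[(_ + _) t]/(Z t) ZE !(bE _ _ _ ot).
  by rewrite mulrA !normrM mulrA ler_wpM2r // -normrM half.
- have h : G (restr (~` B) w) <= e / 32.
    apply: (@le_trans _ _ (G (\sum_om (if L om then W om else 0) *: b om))).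
      apply: (solid_dom sG) => t; rewrite restrE; case: ifPn => [|_]; last by rewrite normr0.
      rewrite inE /= => tB.
      have [[om ot]|none] := pselect (exists om, b om t != 0); last first.
        rewrite /w out ?normr0 // => om.
        by apply: contrapT => /eqP h; apply: none; exists om.
      rewrite !(bE _ _ _ ot); case: ifPn => // Lo; exfalso; apply: tB; by exists om.
    apply: (le_trans (upper _)); apply: le_trans Lsmall; rewrite [leRHS]big_mkcond.
    by apply: ler_sum => om _; case: ifP => _; rewrite ?Wabs ?normr0.
  have := ler_wpM2l (ltW c0) h; have := ler_wpM2l (ltW e0) Zc; lra.
- rewrite -/A; lra.
Qed.

End SpreadSystems.

(** * The operator on the span of a sequence of systems *)

Section OperatorOnSpan.
Variables (R : realType) (j : nat -> nat) (sigma : seq (c00 R) -> nat).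
Variables (XU : completeNormedModType R) (iota : {linear c00 R -> XU}).
Hypothesis hXU : is_completion (gowers_norm j sigma) iota.
Variable X : set XU.
Hypotheses (hX : closed_subspace X) (hXinf : ~ finite_dimensional X).

Local Notation f n := (log2p1 (n%:R : R)).
Local Notation G := (gowers_norm j sigma).
Local Notation system := (system XU).

Let sG : solid_norm G := norm_solid j sigma.

Lemma common_bound (P : nat -> nat -> Prop) N :
  (forall k p q, (p <= q)%N -> P k p -> P k q) -> (forall k, exists p, P k p) ->
  exists p, forall k, (k < N)%N -> P k p.
Proof.
move=> mono ex; elim: N => [|N [p pP]]; first by exists 0%N.
have [q qP] := ex N; exists (maxn p q) => k; rewrite ltnS leq_eqVlt.
move=> /orP[/eqP ->|kN]; first exact: mono (leq_maxr p q) qP.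
exact: mono (leq_maxl p q) (pP k kN).
Qed.

Definition sys_vec (S : system) k := if k is k'.+1 then sys_v S k' else sys_w S.
Definition sys_vect (S : system) k := if k is k'.+1 then sys_vt S k' else sys_wt S.

Definition tol (n : nat) : R := 2^-1 ^+ n.+1.

(** The system [S n] lives between [p n] and [p n.+1], and the vectors, however
one is chosen from each system, form a rapidly increasing sequence. *)
Record system_seq (S : nat -> system) (p m : nat -> nat) : Prop := SystemSeq {
  seq_spread : forall n, spread_system j sigma iota X (p n) (m n) (tol n) (tol n / 144) (S n) ;
  seq_start : forall n n', (n <= n')%N -> (p n <= p n')%N ;
  seq_end : forall n n' k i, (n < n')%N -> (k <= sys_dim (S n))%N -> (p n' <= i)%N ->
    sys_vec (S n) k i = 0 ;
  seq_m_gt0 : forall n, (0 < m n)%N ;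
  seq_m_mono : forall n n', (n <= n')%N -> (m n <= m n')%N ;
  seq_l1 : forall n k, (k <= sys_dim (S n))%N ->
    2 ^+ n * l1 (sys_vec (S n) k) <= Num.sqrt (f (m n.+1)) }.

Lemma tol_gt0 n : 0 < tol n. Proof. by rewrite exprn_gt0. Qed.

Lemma tol_sum N : \sum_(n < N) tol n <= 1.
Proof.
suff : \sum_(n < N) tol n = 1 - 2^-1 ^+ N.
  by move=> ->; rewrite gerBl exprn_ge0.
elim: N => [|N IH]; first by rewrite big_ord0 expr0 subrr.
by rewrite big_ord_recr /= IH /tol exprS; lra.
Qed.

Lemma system_seq_exists : exists S p m, system_seq S p m.
Proof.
pose T := (system * (nat * nat))%type.
pose x0 : T := (System 0 0 (fun=> 0) 0 (fun=> 0), (0, 0)%N).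
pose Rel (s : seq T) (z : T) :=
  [/\ spread_system j sigma iota X z.2.1 z.2.2 (tol (size s)) (tol (size s) / 144) z.1,
      (0 < z.2.2)%N &
      forall n, (n < size s)%N -> [/\ ((nth x0 s n).2.1 <= z.2.1)%N,
        ((nth x0 s n).2.2 <= z.2.2)%N &
        forall k, (k <= sys_dim (nth x0 s n).1)%N ->
          (forall i, (z.2.1 <= i)%N -> sys_vec (nth x0 s n).1 k i = 0) /\
          2 ^+ n * l1 (sys_vec (nth x0 s n).1 k) <= Num.sqrt (f z.2.2)]].
have step s : exists z, Rel s z.
  have [p pP] : exists p, forall n, (n < size s)%N -> ((nth x0 s n).2.1 <= p)%N /\
      forall k, (k < (sys_dim (nth x0 s n).1).+1)%N ->
        forall i, (p <= i)%N -> sys_vec (nth x0 s n).1 k i = 0.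
    apply: common_bound => [n p q pq [h1 h2]|n].
      split; first exact: leq_trans pq.
      by move=> k kd i qi; apply: h2 => //; exact: leq_trans qi.
    have [p pP] : exists p, forall k, (k < (sys_dim (nth x0 s n).1).+1)%N ->
        forall i, (p <= i)%N -> sys_vec (nth x0 s n).1 k i = 0.
      apply: common_bound => [k p q pq h i qi|k]; last exact: c00_finsupp.
      by apply: h; exact: leq_trans qi.
    exists (maxn p (nth x0 s n).2.1); split; first exact: leq_maxr.
    by move=> k kd i; rewrite geq_max => /andP[pi _]; exact: pP.
  have [m mP] : exists m, forall n, (n < size s)%N -> ((nth x0 s n).2.2 <= m)%N /\
      forall k, (k < (sys_dim (nth x0 s n).1).+1)%N ->
        2 ^+ n * l1 (sys_vec (nth x0 s n).1 k) <= Num.sqrt (f m).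
    apply: common_bound => [n m q mq [h1 h2]|n].
      split; first exact: leq_trans mq.
      move=> k kd; apply: (le_trans (h2 k kd)); rewrite ler_wsqrtr //.
      exact: log2_mono.
    have [m mP] : exists m, forall k, (k < (sys_dim (nth x0 s n).1).+1)%N ->
        2 ^+ n * l1 (sys_vec (nth x0 s n).1 k) <= Num.sqrt (f m).
      apply: common_bound => [k m q mq h|k].
        by apply: (le_trans h); rewrite ler_wsqrtr // log2_mono.
      set a := 2 ^+ n * _; have a0 : 0 <= a by rewrite mulr_ge0 ?exprn_ge0 ?l1_ge0.
      have [m mP] := log2_unbounded (a ^+ 2).
      exists m; rewrite -(ger0_norm a0) -sqrtr_sqr ler_wsqrtr //.
      exact: mP.
    exists (maxn m (nth x0 s n).2.2); split; first exact: leq_maxr.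
    move=> k kd; apply: (le_trans (mP k kd)); rewrite ler_wsqrtr //.
    by apply: log2_mono; exact: leq_maxl.
  have t0 := tol_gt0 (size s).
  have t1 : tol (size s) <= 1 by rewrite /tol exprn_ile1 // invf_le1 // ler1n.
  have t2 : 0 < tol (size s) / 144 by exact: divr_gt0.
  have [S SP] := spread_system_exists hXU hX hXinf p (ltn0Sn m) t0 t1 t2.
  exists (S, (p, m.+1)); split => // n ns; have [h1 h2] := pP n ns; have [h3 h4] := mP n ns.
  split => //=; first exact: leqW.
  move=> k kd; split; first exact: h2.
  by apply: (le_trans (h4 k kd)); rewrite ler_wsqrtr // log2_mono.
have [Z ZP] := @dep_choice T x0 Rel (fun s _ => step s).
have ZR n n' : (n < n')%N -> [/\ ((Z n).2.1 <= (Z n').2.1)%N,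
    ((Z n).2.2 <= (Z n').2.2)%N &
    forall k, (k <= sys_dim (Z n).1)%N ->
      (forall i, ((Z n').2.1 <= i)%N -> sys_vec (Z n).1 k i = 0) /\
      2 ^+ n * l1 (sys_vec (Z n).1 k) <= Num.sqrt (f (Z n').2.2)].
  by move=> nn; have [_ _ /(_ n)] := ZP n'; rewrite size_mkseq nth_mkseq //; apply.
exists (fun n => (Z n).1), (fun n => (Z n).2.1), (fun n => (Z n).2.2); split.
- by move=> n; have [h _ _] := ZP n; rewrite size_mkseq in h.
- move=> n n'; rewrite leq_eqVlt => /orP[/eqP ->//|nn]; by have [] := ZR n n' nn.
- by move=> n n' k i nn kd; have [_ _ /(_ k kd)[h _]] := ZR n n' nn; exact: h.
- by move=> n; have [_ h _] := ZP n.
- move=> n n'; rewrite leq_eqVlt => /orP[/eqP ->//|nn]; by have [] := ZR n n' nn.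
- by move=> n k kd; have [_ _ /(_ k kd)[]] := ZR n n.+1 (ltnSn n).
Qed.

Section Span.
Variables (S : nat -> system) (p m : nat -> nat).
Hypothesis SS : system_seq S p m.

Let spread n := seq_spread SS n.

Definition zone n : set nat := [set i | (p n <= i < p n.+1)%N].

Lemma zone_inj n n' i : zone n i -> zone n' i -> n = n'.
Proof.
move=> /andP[h1 h2] /andP[h3 h4]; case: (ltngtP n n') => // lt.
- by have := leq_trans (seq_start SS lt) h3; rewrite leqNgt h2.
- by have := leq_trans (seq_start SS lt) h1; rewrite leqNgt h4.
Qed.

Lemma sys_vec_zone n k i : (k <= sys_dim (S n))%N -> sys_vec (S n) k i != 0 -> zone n i.
Proof.
move=> kd nz; rewrite /zone /=; apply/andP; split.
  rewrite leqNgt; apply/negP => lt; case/eqP: nz.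
  case: k kd => [_|k kd]; first exact: (sys_w_low (spread n)).
  exact: (sys_v_low (spread n)).
rewrite ltnNge; apply/negP => le; case/eqP: nz.
exact: (seq_end SS (ltnSn n) kd le).
Qed.

Lemma sys_comb_zone n b a i : ~ zone n i -> sys_comb (S n) b a i = 0.
Proof.
move=> nz; rewrite c00D c00Z c00_sum big1 => [|k _].
  rewrite addr0; apply: contrapT => /eqP; rewrite mulf_eq0 negb_or => /andP[_ h].
  exact/nz/(@sys_vec_zone n 0%N).
rewrite c00Z; apply: contrapT => /eqP; rewrite mulf_eq0 negb_or => /andP[_ h].
by apply: nz; apply: (@sys_vec_zone n k.+1).
Qed.

Lemma zone_sum (F : nat -> c00 R) N n i : (forall n i, ~ zone n i -> F n i = 0) ->
  (n < N)%N -> zone n i -> (\sum_(n < N) F n) i = F n i.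
Proof.
move=> Fz nN zi; rewrite c00_sum (bigD1 (Ordinal nN)) //= big1 => [|n' ne].
  by rewrite addr0.
apply: Fz => zi'; case/negP: ne; apply/eqP/val_inj => /=.
exact: zone_inj zi' zi.
Qed.

Lemma zone_sum_out (F : nat -> c00 R) N i : (forall n i, ~ zone n i -> F n i = 0) ->
  (forall n, (n < N)%N -> ~ zone n i) -> (\sum_(n < N) F n) i = 0.
Proof. by move=> Fz no; rewrite c00_sum big1 // => n _; apply: Fz; exact: no. Qed.

Definition span_c00 N (b : nat -> R) (a : nat -> nat -> R) : c00 R :=
  \sum_(n < N) sys_comb (S n) (b n) (a n).

Definition sys_combt (Z : system) (b : R) (a : nat -> R) : XU :=
  b *: sys_wt Z + \sum_(k < sys_dim Z) a k *: sys_vt Z k.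

Definition span_XU N (b : nat -> R) (a : nat -> nat -> R) : XU :=
  \sum_(n < N) sys_combt (S n) (b n) (a n).

Lemma sys_comb_le N (b : nat -> R) (a : nat -> nat -> R) n : (n < N)%N ->
  G (sys_comb (S n) (b n) (a n)) <= G (span_c00 N b a).
Proof.
move=> nN; apply: (solid_dom sG) => i.
have [zi|zi] := pselect (zone n i); last by rewrite sys_comb_zone ?normr0.
by rewrite (zone_sum (F := fun n => sys_comb (S n) (b n) (a n)) _ nN zi) // => n' i';
  exact: sys_comb_zone.
Qed.

Lemma tol_comb_sum N (b : nat -> R) (a : nat -> nat -> R) :
  \sum_(n < N) tol n * G (sys_comb (S n) (b n) (a n)) <= G (span_c00 N b a).
Proof.
have g0 := solid_ge0 sG (span_c00 N b a).
apply: (@le_trans _ _ (\sum_(n < N) tol n * G (span_c00 N b a))).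
  by apply: ler_sum => n _; rewrite ler_wpM2l ?(ltW (tol_gt0 _)) // sys_comb_le.
by rewrite -mulr_suml ler_piMl // tol_sum.
Qed.

(** The coefficients of the systems are controlled by the norm of the whole
combination; the denominator 144 is twice the constant of [sys_control]. *)
Lemma coef_sum N (b : nat -> R) (a : nat -> nat -> R) :
  \sum_(n < N) (`|b n| + \sum_(k < sys_dim (S n)) `|a n k|) * (tol n / 144)
    <= 1 / 2 * G (span_c00 N b a).
Proof.
apply: (@le_trans _ _ (\sum_(n < N) 1 / 2 * (tol n * G (sys_comb (S n) (b n) (a n))))).
  apply: ler_sum => n _; have [B [_ _ h]] := sys_control (spread n) (b n) (a n).
  have := ler_wpM2r (ltW (tol_gt0 n)) h; lra.
by rewrite -mulr_sumr ler_wpM2l // tol_comb_sum.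
Qed.

Lemma span_approx N (b : nat -> R) (a : nat -> nat -> R) :
  `|span_XU N b a - iota (span_c00 N b a)| <= 1 / 2 * G (span_c00 N b a).
Proof.
apply: le_trans (coef_sum N b a).
rewrite linear_sum -sumrB; apply: (le_trans (ler_norm_sum _ _ _)).
apply: ler_sum => n _; rewrite mulrDl mulr_suml.
rewrite [iota _]linearD /= opprD addrACA [iota (_ *: _)]linearZ /= -scalerBr.
apply: (le_trans (ler_normD _ _)); apply: lerD.
  by rewrite normrZ ler_wpM2l //; have [_] := sys_w_approx (spread n).
rewrite linear_sum -sumrB; apply: (le_trans (ler_norm_sum _ _ _)).
apply: ler_sum => k _; rewrite [iota _]linearZ /= -scalerBr normrZ ler_wpM2l //.
by have [_] := sys_v_approx (spread n) (ltn_ord k).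
Qed.

(** The projection onto the first vectors is bounded: on the union of the sets
given by [sys_control] they are dominated by twice the combination, and the
contributions off these sets are summable. *)
Lemma span_w_le N (b : nat -> R) (a : nat -> nat -> R) :
  G (\sum_(n < N) b n *: sys_w (S n)) <= 3 * G (span_c00 N b a).
Proof.
have /choice[B BP] n := sys_control (spread n) (b n) (a n).
have zw n i : ~ zone n i -> (b n *: sys_w (S n)) i = 0.
  move=> nz; rewrite c00Z (_ : sys_w (S n) i = 0) ?mulr0 //.
  by apply: contrapT => /eqP h; apply/nz/(@sys_vec_zone n 0%N).
have zc n i : ~ zone n i -> sys_comb (S n) (b n) (a n) i = 0 by exact: sys_comb_zone.
pose A := [set i | exists2 n, zone n i & B n i].
set Y := \sum_(n < N) _; set V := span_c00 N b a.
have h1 : G (restr A Y) <= 2 * G V.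
  have -> : 2 * G V = G (2 *: V) by rewrite solidZ // ger0_norm.
  apply: (solid_dom sG) => i; rewrite restrE; case: ifPn => [|_]; last by rewrite normr0.
  rewrite inE => -[n zi Bi]; rewrite c00Z normrM ger0_norm //.
  have [nN|Nn] := ltnP n N.
    rewrite (zone_sum zw nN zi) (zone_sum zc nN zi).
    by have [+ _ _] := BP n; exact.
  rewrite (zone_sum_out (F := fun n => b n *: sys_w (S n)) zw) ?normr0 ?mulr_ge0 // => n' n'N zi'.
  by have := leq_trans n'N Nn; rewrite (zone_inj zi' zi) ltnn.
have h2 : G (restr (~` A) Y) <= G V.
  rewrite restr_sum; apply: (le_trans (solid_sum _ _ _ sG)).
  apply: le_trans (tol_comb_sum N b a); apply: ler_sum => n _.
  have [_ h _] := BP n; apply: le_trans h.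
  rewrite restrZ solidZ // ler_wpM2l //; apply: (solid_dom sG) => i.
  rewrite !restrE; case: ifPn => [|_]; last by rewrite normr0.
  rewrite inE => nA; case: ifPn => //; rewrite notin_setE => nB.
  rewrite (_ : sys_w (S n) i = 0) //; apply: contrapT => /eqP h.
  apply: nA; exists n; first exact: (@sys_vec_zone n 0%N).
  exact: contrapT.
have := solid_setC A Y sG; lra.
Qed.

Lemma span_bound N (b : nat -> R) (a : nat -> nat -> R) :
  `|\sum_(n < N) b n *: sys_wt (S n)| <= 7 * `|span_XU N b a|.
Proof.
have h1 := span_w_le N b a; have h2 := span_approx N b a; have h3 := coef_sum N b a.
set V := span_c00 N b a in h1 h2 h3 *.
have h4 : G V <= 2 * `|span_XU N b a|.
  have := ler_normB (span_XU N b a) (span_XU N b a - iota V).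
  rewrite subKr (iota_norm hXU); lra.
set Y := \sum_(n < N) b n *: sys_w (S n) in h1.
have h5 : `|\sum_(n < N) b n *: sys_wt (S n) - iota Y| <= 1 / 2 * G V.
  apply: le_trans h3; rewrite linear_sum -sumrB; apply: (le_trans (ler_norm_sum _ _ _)).
  apply: ler_sum => n _; rewrite [iota _]linearZ /= -scalerBr normrZ.
  have [_ h] := sys_w_approx (spread n).
  apply: ler_pM => //; first by rewrite lerDl sumr_ge0.
have := ler_normD (\sum_(n < N) b n *: sys_wt (S n) - iota Y) (iota Y).
rewrite subrK (iota_norm hXU); lra.
Qed.

(** The projection is defined as a relation: its values do not depend on the
representation of [u] because of the bound. *)
Definition graph (u t : XU) : Prop := exists N b a,
  u = span_XU N b a /\ t = \sum_(n < N) b n *: sys_wt (S n).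

Lemma span_XU_cut N N' (b : nat -> R) (a : nat -> nat -> R) : (N <= N')%N -> span_XU N b a =
  span_XU N' (fun n => if (n < N)%N then b n else 0)
    (fun n k => if (n < N)%N then a n k else 0).
Proof.
move=> NN; rewrite /span_XU (big_ord_widen N' (fun n => sys_combt (S n) (b n) (a n))) //.
rewrite big_mkcond; apply: eq_bigr => n _ /=; case: ifP => // _.
by rewrite /sys_combt scale0r big1 ?addr0 // => k _; rewrite scale0r.
Qed.

Lemma w_cut N N' (b : nat -> R) : (N <= N')%N -> \sum_(n < N) b n *: sys_wt (S n) =
  \sum_(n < N') (if (n < N)%N then b n else 0) *: sys_wt (S n).
Proof.
move=> NN; rewrite (big_ord_widen N' (fun n => b n *: sys_wt (S n))) //.
by rewrite big_mkcond; apply: eq_bigr => n _ /=; case: ifP => //; rewrite scale0r.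
Qed.

Lemma graph_linear (c : R) u t u' t' :
  graph u t -> graph u' t' -> graph (c *: u + u') (c *: t + t').
Proof.
move=> [N [b [a [-> ->]]]] [N' [b' [a' [-> ->]]]].
have l1 := leq_maxl N N'; have l2 := leq_maxr N N'.
rewrite (span_XU_cut _ _ l1) (span_XU_cut _ _ l2) (w_cut _ l1) (w_cut _ l2).
set M := maxn N N'; set b1 := fun n => _; set a1 := fun n k => _.
set b2 := fun n => _; set a2 := fun n k => _.
exists M, (fun n => c * b1 n + b2 n), (fun n k => c * a1 n k + a2 n k); split.
  rewrite scaler_sumr -big_split; apply: eq_bigr => n _ /=.
  rewrite /sys_combt scalerDr addrACA scalerA -scalerDl; congr (_ + _).
  rewrite scaler_sumr -big_split; apply: eq_bigr => k _ /=.
  by rewrite scalerA -scalerDl.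
rewrite scaler_sumr -big_split; apply: eq_bigr => n _ /=.
by rewrite scalerA -scalerDl.
Qed.

Lemma graph_bound u t : graph u t -> `|t| <= 7 * `|u|.
Proof. by move=> [N [b [a [-> ->]]]]; exact: span_bound. Qed.

Lemma graph_w n : graph (sys_wt (S n)) (sys_wt (S n)).
Proof.
exists n.+1, (fun l => (l == n)%:R), (fun _ _ => 0); split.
  rewrite /span_XU big_ord_recr big1 => [|l _] /=.
    by rewrite add0r /sys_combt eqxx scale1r big1 ?addr0 // => k _; rewrite scale0r.
  rewrite /sys_combt (ltn_eqF (ltn_ord l)) scale0r big1 ?addr0 // => k _.
  by rewrite scale0r.
rewrite big_ord_recr big1 => [|l _] /=; first by rewrite add0r eqxx scale1r.
by rewrite (ltn_eqF (ltn_ord l)) scale0r.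
Qed.

Lemma graph_v n k : (k < sys_dim (S n))%N -> graph (sys_vt (S n) k) 0.
Proof.
move=> kd; exists n.+1, (fun=> 0), (fun l i => ((l == n) && (i == k))%:R); split.
  rewrite /span_XU big_ord_recr big1 => [|l _] /=.
    rewrite add0r /sys_combt eqxx scale0r add0r (bigD1 (Ordinal kd)) //= eqxx scale1r.
    rewrite big1 ?addr0 // => i ne; rewrite (_ : (i == k :> nat) = false) ?scale0r //.
    by apply: contraNF ne => /eqP h; apply/eqP/val_inj.
  rewrite /sys_combt (ltn_eqF (ltn_ord l)) scale0r big1 ?addr0 // => i _.
  by rewrite scale0r.
by rewrite big1 // => n' _; rewrite scale0r.
Qed.

Lemma graph_X u t : graph u t -> X u.
Proof.
have [sX _] := hX; move=> [N [b [a [-> _]]]].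
have [X0 XD] := sX; rewrite /span_XU; elim/big_rec: _ => // n x _ Xx.
rewrite -[sys_combt _ _ _]scale1r; apply: (XD) => //; apply: (XD).
  by have [] := sys_w_approx (spread n).
by apply: subspace_sum => // k _; have [] := sys_v_approx (spread n) (ltn_ord k).
Qed.

Lemma operator_on_span : exists (W : set XU) (T : XU -> XU),
  [/\ closed_subspace W, W `<=` X, bounded_operator W T,
      forall n, W (sys_wt (S n)) /\ T (sys_wt (S n)) = sys_wt (S n) &
      forall n k, (k < sys_dim (S n))%N -> W (sys_vt (S n) k) /\ T (sys_vt (S n) k) = 0].
Proof.
pose V u := exists t, graph u t.
pose T0 u := xget 0 [set t | graph u t].
have T0P u : V u -> graph u (T0 u).
  by move=> Vu; exact: (@xgetPex _ 0 [set t | graph u t]).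
have uniq u t t' : graph u t -> graph u t' -> t = t'.
  move=> gt gt'; have := graph_bound (graph_linear (-1) gt' gt).
  by rewrite !scaleN1r ![- _ + _]addrC !subrr normr0 mulr0 normr_le0 subr_eq0 => /eqP.
have T0E u t : graph u t -> T0 u = t.
  by move=> g; apply: (@uniq u) => //; apply: T0P; exists t.
have sV : Defs.subspace V.
  split; first by exists 0, 0%N, (fun=> 0), (fun _ _ => 0); rewrite /span_XU !big_ord0.
  by move=> c u v [t gt] [t' gt']; exists (c *: t + t'); exact: graph_linear.
have [||T [TE Tl Tb]] := @extend_operator R XU XU V T0 7 sV (ler0n _ 7).
- move=> c u v Vu Vv; apply: T0E; apply: graph_linear; exact: T0P.
- by move=> u Vu; apply: graph_bound; exact: T0P.
have cV := subspace_closure sV.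
exists (closure V), T; split=> //.
- have [_ cX] := hX; rewrite (closure_id X).1 //.
  by apply: closureS => u [t]; exact: graph_X.
- by split=> //; exists 7.
- move=> n; have g := graph_w n; have Vw : V (sys_wt (S n)) by exists (sys_wt (S n)).
  by split; [exact: subset_closure|rewrite TE // (T0E _ _ g)].
- move=> n k kd; have g := graph_v kd; have Vw : V (sys_vt (S n) k) by exists 0.
  by split; [exact: subset_closure|rewrite TE // (T0E _ _ g)].
Qed.

End Span.

End OperatorOnSpan.

(** * Operators bounded below *)

Section BoundedBelow.
Variables (R : realType) (E F : normedModType R).

Lemma bounded_below_isomorphism (V : set E) (S : E -> F) (c : R) :
  Defs.subspace V -> bounded_operator V S -> 0 < c ->
  (forall v, V v -> c * `|v| <= `|S v|) -> isomorphism_onto_image V S.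
Proof.
move=> [V0 Vl] bS c0 low; have [Sl _] := bS; split=> //.
have inj v v' : V v -> V v' -> S v = S v' -> v = v'.
  move=> Vv Vv' e; have Vd : V (-1 *: v' + v) by exact: Vl.
  have := low _ Vd; rewrite Sl // e !scaleN1r addNr normr0 pmulr_rle0 // normr_le0.
  by rewrite addrC subr_eq0 => /eqP.
pose H w := xget 0 [set v | V v /\ S v = w].
have HE v : V v -> H (S v) = v.
  move=> Vv; have [h1 h2] := @xgetPex _ 0 [set v' | V v' /\ S v' = S v]
    (ex_intro _ v (conj Vv erefl)).
  exact: inj.
exists H; split; last exact: HE.
split; first by move=> a _ _ [v Vv <-] [v' Vv' <-]; rewrite -Sl // !HE //; exact: Vl.
exists c^-1 => _ [v Vv <-]; rewrite HE // ler_pdivlMl //; exact: low.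
Qed.

Lemma bounded_below_closure (V : set E) (S : E -> F) (c : R) : Defs.subspace V ->
  bounded_operator (closure V) S -> 0 <= c ->
  (forall v, V v -> c * `|v| <= `|S v|) ->
  forall v, closure V v -> c * `|v| <= `|S v|.
Proof.
move=> sV [Sl [C Sb]] c0 low v cv; have [[_ cl] _] := subspace_closure sV.
apply/ler_addgt0Pr => e e0.
have C1 : 0 < c + `|C| + 1 by have := normr_ge0 C; lra.
have [v0 Vv0 vv0] := (closure_normP _ _).1 cv _ (divr_gt0 e0 C1).
have cv0 : closure V v0 by exact: subset_closure.
have cd : closure V (-1 *: v0 + v) by exact: cl.
have Sd : S v0 = S v - S (-1 *: v0 + v).
  by rewrite Sl // scaleN1r opprD opprK [RHS]addrCA subrr addr0.
have := low _ Vv0; rewrite Sd => h.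
have h1 := ler_normB (S v) (S (-1 *: v0 + v)).
have h2 : `|v| <= `|v0| + `|v - v0|.
  by rewrite -[in leLHS](subrK v0 v) addrC ler_normD.
have h3 : `|S (-1 *: v0 + v)| <= `|C| * `|v - v0|.
  apply: (le_trans (Sb _ cd)); rewrite scaleN1r [- v0 + v]addrC ler_wpM2r //.
  exact: ler_norm.
have h4 : (c + `|C|) * `|v - v0| <= e.
  apply: (@le_trans _ _ ((c + `|C| + 1) * (e / (c + `|C| + 1)))).
    by apply: ler_pM => //; [have := normr_ge0 C; lra|lra|exact: ltW].
  by rewrite mulrC divfK // gt_eqF.
have := ler_wpM2l c0 h2; lra.
Qed.

End BoundedBelow.

(** * Multipliers that are not strictly singular *)

Section StrictSingularityFails.
Variables (R : realType) (j : nat -> nat) (sigma : seq (c00 R) -> nat).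
Hypotheses (hj : admissible_J R j) (hsigma : coding_function j sigma).
Variables (XU : completeNormedModType R) (iota : {linear c00 R -> XU}).
Hypothesis hXU : is_completion (gowers_norm j sigma) iota.

Local Notation G := (gowers_norm j sigma).

Let sG : solid_norm G := norm_solid j sigma.

(** Let [S] be, up to small errors, a multiplier bounded below on a set [A], on
a rapidly increasing sequence that is not negligible on [A]. Then there are
successive combinations [z q], large on [A] and with summable norms off [A]. The
norm of a combination of them is equivalent to that of its part on [A], which
the multiplier cannot make small, so that [S] is an isomorphism on the closed
span of their approximants. *)
Lemma not_strictly_singular (W : set XU) (S : XU -> XU) (A : set nat) (mu : nat -> R)
    (y : nat -> c00 R) (M : nat -> nat) (yt : nat -> XU) (c K : R) :
  closed_subspace W -> bounded_operator W S ->
  (forall i, A i -> 1 / 2 <= `|mu i|) -> ris j sigma y M -> 0 < c ->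
  (forall l, c <= G (restr A (y l))) -> 0 <= K ->
  (forall l, [/\ W (yt l), `|yt l - iota (y l)| <= tol R l &
     `|S (yt l) - iota (mulc mu (y l))| <= K * tol R l]) ->
  ~ strictly_singular W S.
Proof.
move=> [[W0 Wl] Wc] bS muA ry c0 yc K0 yP SSW; have [Sl [C Sb]] := bS.
(* The errors add up to at most [1 / (4 * (1 + K))], so that they remain small
after multiplication by [K]. *)
pose ep q : R := tol R q / (4 * (1 + K)).
have K4 : 0 < 4 * (1 + K) by lra.
have ep0 q : 0 < ep q by rewrite divr_gt0 // tol_gt0.
have ep_sum N : \sum_(q < N) ep q <= (4 * (1 + K))^-1.
  by rewrite -mulr_suml ler_piMl ?invr_ge0 ?(ltW K4) // tol_sum.
(* A triple [(l0, L, al)] stands for the combination with coefficients [al] of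
the [L] terms from [l0] on. *)
pose comb (d : nat * nat * (nat -> R)) : c00 R :=
  \sum_(l < d.1.2) d.2 l *: y (d.1.1 + l)%N.
pose combt (d : nat * nat * (nat -> R)) : XU :=
  \sum_(l < d.1.2) d.2 l *: yt (d.1.1 + l)%N.
pose d0 : nat * nat * (nat -> R) := (0%N, 0%N, fun=> 0).
pose Rel (s : seq (nat * nat * (nat -> R))) d :=
  [/\ forall l, `|d.2 l| <= 1, G (restr (~` A) (comb d)) <= ep (size s),
      1 <= G (restr A (comb d)), tol R d.1.1 <= ep (size s) / 2 &
      forall q, (q < size s)%N ->
        let d' := nth d0 s q in (d'.1.1 + d'.1.2 <= d.1.1)%N].
have step s : exists d, Rel s d.
  have [l0 l0P] : exists l0, forall q, (q < size s)%N ->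
      let d' := nth d0 s q in (d'.1.1 + d'.1.2 <= l0)%N.
    apply: common_bound => [q l l' ll' h|q]; first exact: leq_trans ll'.
    by eexists; exact: leqnn.
  have [l1 l1P] : exists l1, tol R l1 <= ep (size s) / 2.
    pose x := ep (size s) / 2; have x0 : 0 < x by exact: divr_gt0.
    exists (Num.bound x^-1); rewrite /tol exprVn -[leRHS]invrK lef_pV2 ?posrE ?invr_gt0 ?exprn_gt0 //.
    apply: (@le_trans _ _ (Num.bound x^-1)%:R).
      by apply/ltW/archi_boundP; rewrite invr_ge0 ltW.
    rewrite -natrX ler_nat; apply: ltnW; apply: (ltn_trans (ltn_expl _ (ltnSn 1))).
    by rewrite ltn_exp2l.
  pose l2 := maxn l0 l1.
  have [L [al [al1 h1 h2]]] := unbalanced_combination hj hsigma (ris_shift l2 ry) c0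
    (fun l => yc (l2 + l)%N) (ep0 (size s)).
  exists (l2, L, al); split => //=.
    apply: le_trans l1P; rewrite /tol ler_wiXn2l ?invr_ge0 ?invf_le1 // ?ler1n //.
    by rewrite ltnS leq_maxr.
  by move=> q qs; apply: leq_trans (l0P q qs) (leq_maxl _ _).
have [Z ZP] := @dep_choice _ d0 Rel (fun s _ => step s).
pose z q := comb (Z q); pose zt q := combt (Z q).
have Zlt q q' : (q < q')%N -> ((Z q).1.1 + (Z q).1.2 <= (Z q').1.1)%N.
  by move=> qq; have [_ _ _ _ /(_ q)] := ZP q'; rewrite size_mkseq nth_mkseq //; apply.
have zA q : G (restr (~` A) (z q)) <= ep q by have [_] := ZP q; rewrite size_mkseq.
have z1 q : 1 <= G (restr A (z q)) by have [] := ZP q.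
have ztW q : W (zt q) by apply: subspace_sum => // l _; have [] := yP ((Z q).1.1 + l)%N.
have tail l0 L : \sum_(l < L) tol R (l0 + l) <= 2 * tol R l0.
  apply: (@le_trans _ _ (\sum_(l < L) (2 * tol R l0) * tol R l)).
    apply: ler_sum => l _; rewrite /tol !exprS exprD.
    by rewrite le_eqVlt; apply/orP; left; apply/eqP; field.
  by rewrite -mulr_sumr ler_piMr ?mulr_ge0 ?(ltW (tol_gt0 _ _)) // tol_sum.
have Ssum (I : Type) (r : seq I) (P : pred I) (a : I -> R) (v : I -> XU) :
    (forall i, W (v i)) ->
    S (\sum_(i <- r | P i) a i *: v i) = \sum_(i <- r | P i) a i *: S (v i).
  move=> Wv; have S0 : S 0 = 0.
    by have := Sl (-1) 0 0 W0 W0; rewrite scaler0 addr0 scaleN1r addNr.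
  elim: r => [|i r IH]; first by rewrite !big_nil.
  rewrite !big_cons; case: ifP => // _; rewrite Sl ?IH //.
  by apply: subspace_sum.
have tailZ q : 2 * tol R (Z q).1.1 <= ep q.
  by have [_ _ _ + _] := ZP q; rewrite size_mkseq; lra.
have zt_approx q : `|zt q - iota (z q)| <= ep q.
  apply: le_trans (tailZ q); apply: le_trans (tail _ (Z q).1.2).
  rewrite linear_sum -sumrB; apply: (le_trans (ler_norm_sum _ _ _)).
  apply: ler_sum => l _; rewrite [iota _]linearZ /= -scalerBr normrZ.
  have [al1 _ _ _ _] := ZP q; have [_ h _] := yP ((Z q).1.1 + l)%N.
  by rewrite -[leRHS]mul1r; apply: ler_pM.
have Szt_approx q : `|S (zt q) - iota (mulc mu (z q))| <= K * ep q.
  apply: le_trans (ler_wpM2l K0 (tailZ q)).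
  apply: le_trans (ler_wpM2l K0 (tail _ (Z q).1.2)).
  rewrite Ssum => [|l]; last by have [] := yP ((Z q).1.1 + l)%N.
  rewrite mulc_sum linear_sum -sumrB; apply: (le_trans (ler_norm_sum _ _ _)).
  rewrite mulr_sumr; apply: ler_sum => l _.
  rewrite mulcZ [iota _]linearZ /= -scalerBr normrZ.
  have [al1 _ _ _ _] := ZP q; have [_ _ h] := yP ((Z q).1.1 + l)%N.
  by rewrite -[leRHS]mul1r; apply: ler_pM.
have zblock : block_seq z.
  have supp_z q i : z q i != 0 ->
      exists2 l, ((Z q).1.1 <= l < (Z q).1.1 + (Z q).1.2)%N & y l i != 0.
    rewrite c00_sum => h; apply: contrapT => none; move/eqP: h; apply.
    apply: big1 => l _; rewrite c00Z; apply: contrapT => /eqP.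
    rewrite mulf_eq0 negb_or => /andP[_ yl]; apply: none.
    by exists ((Z q).1.1 + l)%N => //; rewrite leq_addr ltn_add2l /=.
  move=> q q' i k qq' /supp_z[l /andP[_ h1] yl] /supp_z[l' /andP[h2 _] yl'].
  apply: (ris_block ry _ yl yl'); apply: (leq_trans h1); apply: leq_trans h2.
  exact: Zlt.
(* The norm on [A], to which everything is compared; it bounds each of the
coefficients because the [z q] are disjoint and have norm at least 1 on [A]. *)
pose g N (b : nat -> R) := G (restr A (\sum_(q < N) b q *: z q)).
have g0 N b : 0 <= g N b by exact: solid_ge0.
have coef N (b : nat -> R) q : (q < N)%N -> `|b q| <= g N b.
  move=> qN; apply: (@le_trans _ _ (G (restr A (b q *: z q)))).
    by rewrite restrZ solidZ // ler_peMr.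
  apply: (solid_dom sG) => i; rewrite !restrE; case: ifP => // _.
  have [[q0 q0N e]|e] := block_seq_coord N i zblock; last first.
    have := e (fun l => if l == q then b q else 0).
    rewrite c00_sum (bigD1 (Ordinal qN)) //= eqxx big1 => [|l /negbTE ne].
      by rewrite [LHS]addr0 => ->; rewrite normr0.
    by rewrite (_ : (l == q :> nat) = false) ?scale0r //; exact: ne.
  rewrite e; have := e (fun l => if l == q then b q else 0).
  rewrite c00_sum (bigD1 (Ordinal qN)) //= eqxx big1 => [|l /negbTE ne].
    rewrite [LHS]addr0 => ->; case: eqP => [->//|_].
    by rewrite mul0r normr0.
  by rewrite (_ : (l == q :> nat) = false) ?scale0r //; exact: ne.
have coef_sum N (b : nat -> R) : \sum_(q < N) `|b q| * ep q <= g N b * (4 * (1 + K))^-1.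
  apply: (@le_trans _ _ (\sum_(q < N) g N b * ep q)).
    by apply: ler_sum => q _; rewrite ler_wpM2r ?(ltW (ep0 _)) // coef.
  by rewrite -mulr_sumr ler_wpM2l.
have K4le : (4 * (1 + K))^-1 <= 1 / 4.
  by rewrite mul1r lef_pV2 ?posrE //; lra.
have KK4 : K * (4 * (1 + K))^-1 <= 1 / 4.
  rewrite ler_pdivrMr //; lra.
pose X0 N (b : nat -> R) := \sum_(q < N) b q *: z q.
pose Xt N (b : nat -> R) := \sum_(q < N) b q *: zt q.
have XtW N b : W (Xt N b) by apply: subspace_sum.
have approx N b : `|Xt N b - iota (X0 N b)| <= 1 / 4 * g N b.
  apply: (@le_trans _ _ (g N b * (4 * (1 + K))^-1)); last first.
    by rewrite mulrC ler_wpM2r.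
  apply: le_trans (coef_sum N b); rewrite linear_sum -sumrB.
  apply: (le_trans (ler_norm_sum _ _ _)); apply: ler_sum => q _.
  by rewrite [iota _]linearZ /= -scalerBr normrZ ler_wpM2l.
have Sapprox N b : `|S (Xt N b) - iota (mulc mu (X0 N b))| <= 1 / 4 * g N b.
  apply: (@le_trans _ _ (K * (g N b * (4 * (1 + K))^-1))); last first.
    by rewrite mulrCA [leRHS]mulrC ler_wpM2l.
  apply: le_trans (ler_wpM2l K0 (coef_sum N b)).
  rewrite Ssum // mulc_sum linear_sum -sumrB mulr_sumr.
  apply: (le_trans (ler_norm_sum _ _ _)); apply: ler_sum => q _.
  by rewrite mulcZ [iota _]linearZ /= -scalerBr normrZ mulrCA ler_wpM2l.
have offA N b : G (restr (~` A) (X0 N b)) <= 1 / 4 * g N b.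
  apply: (@le_trans _ _ (g N b * (4 * (1 + K))^-1)); last first.
    by rewrite mulrC ler_wpM2r.
  apply: le_trans (coef_sum N b); rewrite restr_sum.
  apply: (le_trans (solid_sum _ _ _ sG)); apply: ler_sum => q _.
  by rewrite restrZ solidZ // ler_wpM2l.
have upper N b : `|Xt N b| <= 2 * g N b.
  have := ler_normD (Xt N b - iota (X0 N b)) (iota (X0 N b)).
  rewrite subrK (iota_norm hXU); have := solid_setC A (X0 N b) sG.
  rewrite -/(g N b) => h1 h2; have := approx N b; have := offA N b.
  have := g0 N b; lra.
have lower N b : 1 / 4 * g N b <= `|Xt N b|.
  have := ler_normB (Xt N b) (Xt N b - iota (X0 N b)).
  rewrite subKr (iota_norm hXU); have := solid_restr A (X0 N b) sG.
  have := approx N b; rewrite -/(g N b); have := g0 N b; lra.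
have Slower N b : 1 / 4 * g N b <= `|S (Xt N b)|.
  have := ler_normB (S (Xt N b)) (S (Xt N b) - iota (mulc mu (X0 N b))).
  rewrite subKr (iota_norm hXU).
  have : 1 / 2 * g N b <= G (mulc mu (X0 N b)).
    have half : `|1 / 2| = 1 / 2 :> R by rewrite ger0_norm.
    rewrite -[leLHS]/(1 / 2 * G _) -half -solidZ //.
    apply: (solid_dom sG) => i; rewrite c00Z restrE mulcE; case: ifPn => [|_].
      rewrite inE => /muA h; rewrite [leLHS]normrM [leRHS]normrM half.
      exact: ler_wpM2r.
    by rewrite mulr0 normr0.
  have := Sapprox N b; lra.
pose V u := exists N b, u = Xt N b.
have Xt_cut N N' b : (N <= N')%N ->
    Xt N b = Xt N' (fun q => if (q < N)%N then b q else 0).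
  move=> NN; rewrite /Xt (big_ord_widen N' (fun q => b q *: zt q)) //.
  by rewrite big_mkcond; apply: eq_bigr => n _ /=; case: ifP => //; rewrite scale0r.
have sV : Defs.subspace V.
  split; first by exists 0%N, (fun=> 0); rewrite /Xt big_ord0.
  move=> a _ _ [N [b ->]] [N' [b' ->]].
  rewrite (Xt_cut _ _ b (leq_maxl N N')) (Xt_cut _ _ b' (leq_maxr N N')).
  set b1 := fun q => _; set b2 := fun q => _.
  exists (maxn N N'), (fun q => a * b1 q + b2 q).
  rewrite /Xt scaler_sumr -big_split; apply: eq_bigr => q _ /=.
  by rewrite scalerA -scalerDl.
have cVW : closure V `<=` W.
  by rewrite (closure_id W).1 //; apply: closureS => _ [N [b ->]].
have bSV : bounded_operator (closure V) S.
  split; first by move=> a u v /cVW Wu /cVW Wv; exact: Sl.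
  by exists C => u /cVW; exact: Sb.
apply: (SSW (closure V) cVW (subspace_closure sV)).
  move=> /(finite_dimensional_relation (z := zt)) [q|N [b [[q qN bq] rel]]].
    apply: subset_closure; exists q.+1, (fun l => (l == q)%:R).
    rewrite /Xt big_ord_recr big1 => [|l _] /=; first by rewrite eqxx add0r scale1r.
    by rewrite (ltn_eqF (ltn_ord l)) scale0r.
  have := lower N b; rewrite /Xt rel normr0 => h.
  have := coef N b q qN; move: bq; rewrite -normr_gt0; lra.
have e0 : 0 < 1 / 8 :> R by [].
apply: (bounded_below_isomorphism _ bSV e0); first by have [] := subspace_closure sV.
apply: (bounded_below_closure sV bSV (ltW e0)) => _ [N [b ->]].
have := upper N b; have := Slower N b; lra.
Qed.

End StrictSingularityFails.

(** * Diagonal operators and the conclusion *)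

Section Conclusion.
Variables (R : realType) (j : nat -> nat) (sigma : seq (c00 R) -> nat).
Variables (XU : completeNormedModType R) (iota : {linear c00 R -> XU}).

Local Notation G := (gowers_norm j sigma).

Let sG : solid_norm G := norm_solid j sigma.

Lemma diagonal_mulc (D : XU -> XU) : diagonal_operator iota D ->
  exists lam : nat -> R, forall x, D (iota x) = iota (mulc lam x).
Proof.
move=> [[Dl _] [lam Dlam]]; exists lam => x.
have Dsum (I : Type) (r : seq I) (P : pred I) (a : I -> R) (v : I -> XU) :
    D (\sum_(i <- r | P i) a i *: v i) = \sum_(i <- r | P i) a i *: D (v i).
  have D0 : D 0 = 0 by have := Dl (-1) 0 0 Logic.I Logic.I; rewrite scaler0 addr0 scaleN1r addNr.
  elim: r => [|i r IH]; first by rewrite !big_nil.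
  by rewrite !big_cons; case: ifP => // _; rewrite Dl // IH.
have [n xn] := c00_finsupp x.
have decomp (z : c00 R) : (forall i, (n <= i)%N -> z i = 0) ->
    iota z = \sum_(i < n) z i *: iota (unit_vec R i).
  move=> zn; rewrite [in LHS](c00_decomp zn) linear_sum.
  by apply: eq_bigr => i _; rewrite [iota _]linearZ.
rewrite (decomp x xn) Dsum decomp => [|i ni]; last by rewrite mulcE xn ?mulr0.
by apply: eq_bigr => i _; rewrite Dlam scalerA mulcE mulrC.
Qed.

(** If [w] is negligible off [A] then it is not negligible on [A], and since it
lies below the average of the moduli of the [v k], one of these is not. *)
Lemma spread_system_large X p m e d (Z : system XU) (A : set nat) :
  spread_system j sigma iota X p m e d Z ->
  1 / 16 <= G (restr (~` A) (sys_w Z)) \/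
  exists2 k, (k < sys_dim Z)%N & 1 / 16 <= G (restr A (sys_v Z k)).
Proof.
move=> SZ; have [h|h] := lerP (1 / 16) (G (restr (~` A) (sys_w Z))); first by left.
right; apply: contrapT => none.
have d0 : 0 < (sys_dim Z)%:R :> R by rewrite ltr0n (sys_dim_gt0 SZ).
have small k : (k < sys_dim Z)%N -> G (restr A (sys_v Z k)) < 1 / 16.
  by move=> kd; rewrite ltNge; apply/negP => le; apply: none; exists k.
have : G (restr A (sys_w Z)) <= 1 / 16.
  apply: (@le_trans _ _ (G ((sys_dim Z)%:R^-1 *:
      \sum_(k < sys_dim Z) restr A (modulus (sys_v Z k))))).
    apply: (solid_dom sG) => t; rewrite restrE c00Z c00_sum.
    case: ifPn => tA; last by rewrite normr0.
    apply: (le_trans (sys_w_le SZ t)); apply: le_trans (ler_norm _).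
    rewrite ler_wpM2l ?invr_ge0 // le_eqVlt; apply/orP; left; apply/eqP.
    by apply: eq_bigr => k _; rewrite restrE tA.
  rewrite solidZ // ger0_norm ?invr_ge0 // ler_pdivrMl //.
  apply: (le_trans (solid_sum _ _ _ sG)).
  apply: (@le_trans _ _ (\sum_(k < sys_dim Z) (1 / 16))); last first.
    by rewrite sumr_const card_ord -[leLHS]mulr_natl.
  apply: ler_sum => k _; apply/ltW; apply: le_lt_trans (small k (ltn_ord k)).
  by apply: (solid_dom sG) => t; rewrite !restrE; case: ifP; rewrite ?modulusE ?normr_id.
have := sys_w_ge SZ; have := solid_setC A (sys_w Z) sG; lra.
Qed.

Lemma system_seq_ris X (S : nat -> system XU) p m (ch : nat -> nat) :
  system_seq j sigma iota X S p m -> (forall n, (ch n <= sys_dim (S n))%N) ->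
  ris j sigma (fun n => sys_vec (S n) (ch n)) m.
Proof.
move=> SS chd; split.
- move=> l l' i k ll' yl yl'.
  have /andP[_ h1] := sys_vec_zone SS (chd l) yl.
  have /andP[h2 _] := sys_vec_zone SS (chd l') yl'.
  exact: leq_trans h1 (leq_trans (seq_start SS ll') h2).
- move=> n; have sp := seq_spread SS n; have := chd n.
  by case: (ch n) => [_|k kd]; [exact: (sys_w_avg sp)|exact: (sys_v_avg sp kd)].
- exact: seq_m_gt0 SS.
- exact: seq_m_mono SS.
- by move=> n; exact: (seq_l1 SS (chd n)).
Qed.

Lemma often_subseq (P : nat -> Prop) : (forall N, exists2 n, (N <= n)%N & P n) ->
  exists phi : nat -> nat, (forall l l', (l < l')%N -> (phi l < phi l')%N) /\
    forall l, P (phi l).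
Proof.
move=> often; have /choice[nxt nxtP] N : exists n, (N <= n)%N /\ P n.
  by have [n] := often N; exists n.
pose phi := fix phi l := if l is l'.+1 then nxt (phi l').+1 else nxt 0%N.
have step l : (phi l < phi l.+1)%N by have [] := nxtP (phi l).+1.
exists phi; split; last by case=> [|l]; [exact: (nxtP 0%N).2|exact: (nxtP (phi l).+1).2].
move=> l; elim=> // l' IH; rewrite ltnS leq_eqVlt => /orP[/eqP ->|/IH h]; first exact: step.
exact: ltn_trans h (step l').
Qed.

End Conclusion.

Theorem theorem2p10 (R : realType) (j : nat -> nat) (sigma : seq (c00 R) -> nat)
  (hj : admissible_J R j) (hsigma : coding_function j sigma)
  (XU : completeNormedModType R) (iota : {linear c00 R -> XU})
  (hXU : is_completion (gowers_norm j sigma) iota)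
  (X : set XU) (hX : closed_subspace X) (hXinf : ~ finite_dimensional X) :
  exists (W : set XU) (T : XU -> XU),
    [/\ closed_subspace W, W `<=` X, bounded_operator W T
      & ~ exists (D S : XU -> XU),
          [/\ diagonal_operator iota D, bounded_operator W S,
              strictly_singular W S
            & forall w, W w -> T w = D w + S w]].
Proof.
have [Z [p [m SZ]]] := system_seq_exists hXU hX hXinf.
have [W [T [cW WX bT Tw Tv]]] := operator_on_span hXU hX SZ.
exists W, T; split => // -[D [S [dD bS SSW TDS]]].
have [lam Dlam] := diagonal_mulc dD; have [[Dl [C Db]] _] := dD.
have Dsub u v : D (u - v) = D u - D v.
  by rewrite addrC -scaleN1r Dl // scaleN1r addrC.
pose G := gowers_norm j sigma.
pose A := [set i | 1 / 2 <= `|lam i|].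
(* A choice of one vector from each of infinitely many systems, on which [S] is
up to small errors the multiplier [mu], is all that is needed. *)
have main (ch : nat -> nat) (B : set nat) (mu : nat -> R) (good : nat -> Prop) :
    (forall i, B i -> 1 / 2 <= `|mu i|) -> (forall n, (ch n <= sys_dim (Z n))%N) ->
    (forall n, good n -> 1 / 16 <= G (restr B (sys_vec (Z n) (ch n)))) ->
    (forall n, good n -> let y := sys_vec (Z n) (ch n) in
       let yt := sys_vect (Z n) (ch n) in
       [/\ W yt, `|yt - iota y| <= tol R n &
        `|S yt - iota (mulc mu y)| <= (1 + `|C|) * tol R n]) ->
    ~ (forall N, exists2 n, (N <= n)%N & good n).
  move=> muB chd big appr /often_subseq[phi [mono gphi]].
  have ry := ris_subseq mono (system_seq_ris SZ chd).
  have c0 : 0 < 1 / 16 :> R by [].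
  have K0 : 0 <= 1 + `|C| by have := normr_ge0 C; lra.
  apply: (not_strictly_singular hj hsigma hXU cW bS muB ry c0
    (fun l => big _ (gphi l)) K0 _ SSW (yt := fun l => sys_vect (Z (phi l)) (ch (phi l)))).
  move=> l; have [h1 h2 h3] := appr _ (gphi l).
  have le : tol R (phi l) <= tol R l.
    rewrite /tol ler_wiXn2l ?invr_ge0 ?invf_le1 ?ler1n // ltnS.
    elim: l {h1 h2 h3} => // l IH; exact: leq_ltn_trans IH (mono l l.+1 (ltnSn l)).
  split => //; first exact: le_trans h2 le.
  by apply: (le_trans h3); rewrite ler_wpM2l.
have tol144 n : tol R n / 144 <= tol R n by have := tol_gt0 R n; lra.
have Dbd u : `|D u| <= `|C| * `|u|.
  by apply: (le_trans (Db u Logic.I)); rewrite ler_wpM2r // ler_norm.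
(* Where [lam] is small, [S] acts on the [w] as the multiplier [1 - lam]; where
it is large, [S] acts on the [v k] as [- lam]. *)
have [caseW|] := pselect (forall N, exists2 n, (N <= n)%N &
    1 / 16 <= G (restr (~` A) (sys_w (Z n)))).
  apply: (main (fun=> 0%N) (~` A) (fun i => 1 - lam i) _ _ _ _ _ caseW) => //.
    move=> i /negP; rewrite -ltNge => lt.
    have := ler_normD (1 - lam i) (lam i); rewrite subrK normr1; lra.
  move=> n _ /=; have [Wy Ty] := Tw n; have [_ ap] := sys_w_approx (seq_spread SZ n).
  split=> //; first exact: le_trans ap (tol144 n).
  have -> : S (sys_wt (Z n)) = sys_wt (Z n) - D (sys_wt (Z n)).
    by rewrite -[in X in X - _]Ty TDS // addrC addKr.
  have -> : mulc (fun i => 1 - lam i) (sys_w (Z n)) = sys_w (Z n) - mulc lam (sys_w (Z n)).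
    by apply: c00P => i; rewrite c00D c00N !mulcE mulrBl mul1r.
  rewrite linearB -Dlam.
  have -> : sys_wt (Z n) - D (sys_wt (Z n)) - (iota (sys_w (Z n)) - D (iota (sys_w (Z n)))) =
      (sys_wt (Z n) - iota (sys_w (Z n))) - D (sys_wt (Z n) - iota (sys_w (Z n))).
    by rewrite Dsub !opprB addrACA [RHS]addrACA; congr (_ + _); rewrite addrC.
  apply: (le_trans (ler_normB _ _)); rewrite mulrDl mul1r; apply: lerD.
    exact: le_trans ap (tol144 n).
  apply: (le_trans (Dbd _)); rewrite ler_wpM2l //; exact: le_trans ap (tol144 n).
move=> nW; apply: nW => N; apply: contrapT => noW.
pose good n := exists2 k, (k < sys_dim (Z n))%N & 1 / 16 <= G (restr A (sys_v (Z n) k)).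
have goodN n : (N <= n)%N -> good n.
  move=> Nn; have [h|//] := spread_system_large A (seq_spread SZ n).
  by exfalso; apply: noW; exists n.
have /choice[ch chP] n : exists c, (c <= sys_dim (Z n))%N /\ (good n ->
    exists k, [/\ c = k.+1, (k < sys_dim (Z n))%N &
      1 / 16 <= G (restr A (sys_v (Z n) k))]).
  have [[k kd h]|ng] := pselect (good n); first by exists k.+1; split=> // _; exists k.
  by exists 0%N.
apply: (main ch A (fun i => - lam i) good) => //.
- by move=> i; rewrite normrN.
- by move=> n; have [] := chP n.
- by move=> n gn; have [_ /(_ gn)[k [-> _ h]]] := chP n.
- move=> n gn; have [_ /(_ gn)[k [-> kd _]]] := chP n => /=.
  have [Wy Ty] := Tv n k kd; have [_ ap] := sys_v_approx (seq_spread SZ n) kd.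
  have ap' := le_trans ap (tol144 n); split=> //.
  have -> : S (sys_vt (Z n) k) = - D (sys_vt (Z n) k).
    by apply/eqP; rewrite -addr_eq0 addrC -TDS // Ty.
  have -> : mulc (fun i => - lam i) (sys_v (Z n) k) = - mulc lam (sys_v (Z n) k).
    by apply: c00P => i; rewrite c00N !mulcE mulNr.
  rewrite linearN -Dlam -opprD normrN -Dsub; apply: (le_trans (Dbd _)).
  by apply: ler_pM => //; lra.
- by move=> M; exists (maxn M N); [exact: leq_maxl|apply: goodN; exact: leq_maxr].
Qed.
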